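(* Let $(V,\Delta)$ and $(V',\Delta')$ be two triangulations of $3$-dimensional manifolds, and let $f:\Delta_3\rightarrow\Delta'_3$ be an intersection preserving map. Then $f$ extends to an isomorphism, i.e. there is an isomorphism of simplicial complexes $\varphi:V\rightarrow V'$ such that $\varphi(X)=f(X)$ for all $X\in\Delta_3$.
   Context: An (abstract) simplicial complex is a pair $(V,\Delta)$ with $V$ a finite set and $\Delta\subseteq 2^V$ such that $X\in\Delta$ and $Y\subseteq X$ imply $Y\in\Delta$. An element of $\Delta$ with $i+1$ elements is an $i$-simplex, and $\Delta_i$ denotes the set of $i$-simplices. An isomorphism from $(V,\Delta)$ to $(V',\Delta')$ is a bijection $\varphi:V\to V'$ such that $X\in\Delta$ if and only if $\varphi(X)\in\Delta'$. A triangulation of a $3$-dimensional manifold is a simplicial complex of dimension $3$ whose geometric realization has a $3$-dimensional manifold as underlying space. Manifolds are without boundary: for every $v\in V$ the neighbourhood of $v$, that is, the $2$-dimensional complex whose facets are the sets $X\setminus\{v\}$ with $v\in X\in\Delta_3$, spans a space homeomorphic to the $2$-sphere. A map $f:\Delta_3\to\Delta'_3$ is intersection preserving if it is bijective and $|X\cap Y|=|f(X)\cap f(Y)|$ for all $X,Y\in\Delta_3$. *)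

(* Defs.v *)
From HB Require Import structures.
From mathcomp Require Import all_boot all_order all_algebra.
From mathcomp Require Import all_classical all_reals all_analysis.

Set Implicit Arguments.
Unset Strict Implicit.
Unset Printing Implicit Defensive.

Import Order.TTheory GRing.Theory Num.Theory.
Import numFieldNormedType.Exports.

Local Open Scope ring_scope.

Definition simplicial_complex (V : finType) (D : {set {set V}}) : Prop :=
  forall X Y : {set V}, X \in D -> Y \subset X -> Y \in D.

Definition simplices (V : finType) (i : nat) (D : {set {set V}}) : {set {set V}} :=
  [set X in D | #|X| == i.+1].

Definition has_dimension (V : finType) (n : nat) (D : {set {set V}}) : Prop :=
  (exists X, X \in simplices n D) /\ (forall X, X \in D -> (#|X| <= n.+1)%N).

Definition generated_complex (V : finType) (D : {set {set V}}) : {set {set V}} :=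
  [set Y : {set V} | [exists X in D, Y \subset X]].

Definition neighbourhood (V : finType) (D : {set {set V}}) (v : V) : {set {set V}} :=
  generated_complex [set X :\ v | X in simplices 3 D & v \in X].

Definition isomorphism (V V' : finType) (D : {set {set V}})
    (D' : {set {set V'}}) (phi : V -> V') : Prop :=
  bijective phi /\ forall X : {set V}, (X \in D) = (phi @: X \in D').

(* [f] is total for convenience: only its values on the 3-simplices of [D]
   are constrained, so it stands for a map from those to the ones of [D']. *)
Definition intersection_preserving (V V' : finType) (D : {set {set V}})
    (D' : {set {set V'}}) (f : {set V} -> {set V'}) : Prop :=
  [/\ {in simplices 3 D &, injective f},
      f @: simplices 3 D = simplices 3 D' &
      {in simplices 3 D &, forall X Y, #|X :&: Y| = #|f X :&: f Y|}].

Local Open Scope classical_set_scope.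

Definition homeomorphic {S T : topologicalType} (A : set S) (B : set T) : Prop :=
  exists (f : S -> T) (g : T -> S),
    [/\ {within A, continuous f} /\ {within B, continuous g},
        (forall x, A x -> B (f x) /\ g (f x) = x) &
        (forall y, B y -> A (g y) /\ f (g y) = y)].

(* The Hausdorff and second-countability axioms are omitted because they hold
   for every subspace of a Euclidean space. *)
Definition topological_manifold (R : realType) (n m : nat)
    (A : set 'rV[R]_m) : Prop :=
  forall x, A x -> exists (U : set 'rV[R]_m) (W : set 'rV[R]_n),
    [/\ open U, U x, open W & homeomorphic (A `&` U) W].

Definition two_sphere (R : realType) : set 'rV[R]_3 :=
  [set x : 'rV[R]_3 | \sum_(i < 3) x 0 i ^+ 2 = 1].

(* Barycentric coordinates: the vertices of the complex are placed at the
   standard basis vectors of R^V, whose coordinates are numbered by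
   [enum_rank]. *)
Definition realization (R : realType) (V : finType) (D : {set {set V}}) :
    set 'rV[R]_#|V| :=
  [set x : 'rV[R]_#|V| | [/\ forall i, 0 <= x 0 i, \sum_i x 0 i = 1 &
    finset (fun v : V => x 0 (enum_rank v) != 0) \in D]].

Arguments two_sphere R : clear implicits.
Arguments realization R {V} D.

Definition manifold_triangulation (R : realType) (V : finType)
    (D : {set {set V}}) : Prop :=
  [/\ simplicial_complex D,
      has_dimension 3 D,
      topological_manifold 3 (realization R D) &
      forall v : V,
        homeomorphic (realization R (neighbourhood D v)) (two_sphere R)].

(* Main.v *)
(* The neighbours of a tetrahedron [X] across its facets are mapped by [f] to the
   neighbours of [f X] across the facets of [f X], which gives a bijection from
   the vertices of [X] to those of [f X].  If the bijections of adjacent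
   tetrahedra agree on the common vertices, then, as links of vertices are
   strongly connected, they glue to an isomorphism.  Otherwise, for some
   adjacent [1234] and [1235], they differ on [123] by a transposition or by a
   3-cycle.  The intersection numbers then determine the apexes of the
   neighbours of both tetrahedra, and the links of vertices turn out not to be
   planar: immediately for a transposition, and for a 3-cycle after two further
   layers of neighbours.  Planarity is used in the form that two closed curves
   in a 2-sphere do not cross exactly once.

   The topological input (every simplex lies in a tetrahedron, every triangle in
   exactly two of them, planarity of links) rests on one fact about maps into the
   punctured plane: an odd loop is not homotopic to a loop that retraces its
   steps as [a b a^-1 b^-1].  This is proved by counting, on a fine grid, the
   quarter turns of the map around 0.  Invariance of domain in the plane follows
   with the homotopy from [f (x + p) - f (x - p)] to [f (x + p) - f x], and the
   statement on curves by considering the difference of the two curves on the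
   torus without a small square around the crossing. *)

Require Import Defs.
From HB Require Import structures.
From mathcomp Require Import all_boot all_order all_algebra.
From mathcomp Require Import all_classical all_reals all_analysis.
From mathcomp Require Import zify ring lra.

Set Implicit Arguments.
Unset Strict Implicit.
Unset Printing Implicit Defensive.

Import Order.TTheory GRing.Theory Num.Theory.
Import numFieldNormedType.Exports.

Local Open Scope classical_set_scope.
Local Open Scope ring_scope.

(** The invariant is the number of quarter turns. Each half of an odd loop makes the same number of
    them, congruent to 2 modulo 4, so the total is not 0, whereas a loop [a b a^-1 b^-1] makes 0.
    The boundary of a square becomes such a loop when opposite sides are identified to a torus, and
    constant loops are of this form too; hence one lemma serves both invariance of domain and
    crossing curves. Dimension 3 is reduced to the plane. Triangles at a vertex are edges of its
    spherical link, which is projected stereographically. The charts of the 3-manifold enter when a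
    maximal simplex with at most three vertices is excluded: there an open set of R^3 would embed in
    the plane. The obstacle of the combinatorial part is that [f] knows tetrahedra but no vertices.
    Equality of vertex sets ([maps]) is therefore kept apart from a matching of vertices ([labels]),
    and coincidences of vertices not yet decided are boolean unknowns in equations between
    intersection sizes. *)

(** * Loops in the punctured plane *)

(* The four sectors |y| <= |x|, |x| < |y| of the plane, split by sign, in the
   cyclic order (true, true), (false, true), (true, false), (false, false). *)
Definition sector_index (a : bool * bool) : int :=
  match a with
  | (true, true) => 0 | (false, true) => 1 | (true, false) => 2 | (false, false) => 3
  end.

Definition opposite (a : bool * bool) : bool * bool := (a.1, ~~ a.2).

(* Signed quarter turn from one sector to a neighbouring one (junk value 0
   for opposite sectors). *)
Definition turn (a b : bool * bool) : int :=
  match a.1, b.1 with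
  | true, false => if a.2 == b.2 then 1 else -1
  | false, true => if a.2 == b.2 then -1 else 1
  | _, _ => 0
  end.

Lemma turnC a b : turn b a = - turn a b.
Proof. by case: a b => [[] []] [[] []]. Qed.

Lemma turn_opposite a b : turn (opposite a) (opposite b) = turn a b.
Proof. by case: a b => [[] []] [[] []]. Qed.

(** Pairwise non-opposite sectors lie in two adjacent ones, where [turn] is the difference of a
    potential; so both ways around the cell give the same sum. *)
Lemma turn_cell a b c d :
  b != opposite a -> c != opposite a -> d != opposite a ->
  c != opposite b -> d != opposite b -> d != opposite c ->
  turn a b + turn b c = turn a d + turn d c.
Proof. by case: a b c d => [[] []] [[] []] [[] []] [[] []]. Qed.

Lemma turn_mod4 a b : b != opposite a ->
  exists k : int, turn a b = sector_index b - sector_index a + 4 * k.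
Proof.
case: a b => [[] []] [[] []] //= _; by [exists 0|exists 1|exists (-1)].
Qed.

Definition turns (l : nat -> bool * bool) (m n : nat) : int :=
  \sum_(m <= j < n) turn (l j) (l j.+1).

Lemma turns_cat l m n p : (m <= n)%N -> (n <= p)%N ->
  turns l m p = turns l m n + turns l n p.
Proof. by move=> mn np; rewrite /turns (big_cat_nat mn np). Qed.

Lemma turns_mod4 l n : (forall j, (j < n)%N -> l j.+1 != opposite (l j)) ->
  exists k : int, turns l 0 n = sector_index (l n) - sector_index (l 0) + 4 * k.
Proof.
elim: n => [|n IH] near.
  by exists 0; rewrite /turns big_geq // subrr.
have [k Hk] := IH (fun j jn => near j (leqW jn)).
have [k' Hk'] := turn_mod4 (near n (leqnn _)).
exists (k + k'); rewrite /turns big_nat_recr //= -/(turns l 0 n) Hk Hk'; ring.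
Qed.

Lemma turns_rev l m n s : (forall j, (m <= j <= n)%N -> l j = l (s - j)%N) ->
  (m <= n)%N -> (n <= s)%N -> turns l m n = - turns l (s - n) (s - m).
Proof.
move=> H; elim: n => [|n IH] in H * => mn ns.
  have -> : m = 0%N by lia.
  by rewrite /turns !big_geq ?oppr0 //; lia.
have [mn'|->] : (m <= n)%N \/ m = n.+1 by lia.
  rewrite /turns big_nat_recr //= -/(turns l m n) IH; [|by move=> j Hj; apply: H; lia|lia|lia].
  rewrite [in RHS]big_ltn; last lia.
  have E : (s - n.+1).+1 = (s - n)%N by lia.
  have H1 : l n = l (s - n)%N by apply: H; lia.
  have H2 : l n.+1 = l (s - n.+1)%N by apply: H; lia.
  by rewrite E -/(turns l (s - n) (s - m)) opprD addrC H1 H2 turnC.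
by rewrite /turns !big_geq ?oppr0.
Qed.

(** * Discrete homotopies of loops *)

Section Grid.
Variables (n N : nat) (l : nat -> nat -> bool * bool).
Hypothesis NE : N = (4 * n)%N.
Hypothesis near : forall i j i' j', (i < N)%N -> (j < N)%N ->
  (i <= i' <= i.+1)%N -> (j <= j' <= j.+1)%N ->
  forall i'' j'', (i <= i'' <= i.+1)%N -> (j <= j'' <= j.+1)%N ->
  l i'' j'' != opposite (l i' j').
Hypothesis per : forall i, (i <= N)%N -> l i N = l i 0%N.
Hypothesis odd_end : forall j, (j <= 2 * n)%N -> l N (j + 2 * n)%N = opposite (l N j).
Hypothesis ret1 : forall j, (j <= n)%N -> l 0%N j = l 0%N (3 * n - j)%N.
Hypothesis ret2 : forall j, (n <= j <= 2 * n)%N -> l 0%N j = l 0%N (5 * n - j)%N.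

(** Discrete homotopy invariance: [turn_cell] is summed over the cells between two rows, and the
    turns along the two ends agree by periodicity. *)
Lemma turns_step i : (i < N)%N -> turns (l i) 0 N = turns (l i.+1) 0 N.
Proof.
move=> iN; have H m : (m <= N)%N ->
    turns (l i) 0 m + turn (l i m) (l i.+1 m)
    = turn (l i 0) (l i.+1 0) + turns (l i.+1) 0 m.
  elim: m => [|m IH] mN.
    by rewrite /turns !big_geq // addrC.
  rewrite /turns !big_nat_recr //= -!/(turns _ _ _).
  have C : turn (l i m) (l i m.+1) + turn (l i m.+1) (l i.+1 m.+1) =
           turn (l i m) (l i.+1 m) + turn (l i.+1 m) (l i.+1 m.+1).
    by apply: turn_cell; apply: (near (i := i) (j := m)); lia.
  by rewrite -addrA C addrA IH ?addrA // ltnW.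
have /= := H _ (leqnn N); rewrite !per ?leqnn //; last exact: ltnW.
lia.
Qed.

(** In row 0 every piece cancels against its reverse. In row [N] the two halves contribute equally,
    and each is congruent to 2 modulo 4 because it leads to the opposite sector; the total is 4
    modulo 8. *)
Lemma no_odd_grid : (0 < n)%N -> False.
Proof.
move=> n0.
have cst i : (i <= N)%N -> turns (l i) 0 N = turns (l 0%N) 0 N.
  elim: i => // i IH iN; rewrite -turns_step // IH //; exact: ltnW.
have D0 : turns (l 0%N) 0 N = 0.
  have -> : turns (l 0%N) 0 N = turns (l 0%N) 0 n + turns (l 0%N) n (2 * n)
      + (turns (l 0%N) (2 * n) (3 * n) + turns (l 0%N) (3 * n) N).
    by rewrite -!turns_cat //; lia.
  rewrite (@turns_rev _ 0 n (3 * n)%N); [|by move=> j Hj; apply: ret1; lia|lia|lia].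
  rewrite (@turns_rev _ n (2*n) (5 * n)%N); [|by move=> j Hj; apply: ret2; lia|lia|lia].
  have -> : (3 * n - n = 2 * n)%N by lia.
  have -> : (3 * n - 0 = 3 * n)%N by lia.
  have -> : (5 * n - n = N)%N by lia.
  have -> : (5 * n - 2 * n = 3 * n)%N by lia.
  ring.
have := cst N (leqnn N); rewrite D0 (@turns_cat _ 0 (2 * n) N); try lia.
have -> : turns (l N) (2 * n) N = turns (l N) 0 (2 * n).
  rewrite /turns.
  have -> : \sum_(2 * n <= j < N) turn (l N j) (l N j.+1) = \sum_(0 + 2 * n <= j < 2 * n + 2 * n) turn (l N j) (l N j.+1).
    by apply: congr_big => //; congr (index_iota _ _); lia.
  rewrite big_addn addnK !big_nat; apply: eq_bigr => i Hi.
  rewrite -addSn !odd_end ?turn_opposite //; lia.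
have [|k ->] := @turns_mod4 (l N) (2 * n)%N.
  by move=> j Hj; apply: (near (i := N.-1) (j := j)); lia.
have -> : l N (2 * n)%N = opposite (l N 0%N) by rewrite -odd_end.
case: (l N 0%N) => [[] []] /=; lia.
Qed.
End Grid.

Definition sector (R : realType) (x y : R) : bool * bool :=
  if `|y| <= `|x| then (true, 0 <= x) else (false, 0 <= y).

Lemma sectorN (R : realType) (x y : R) : x != 0 \/ y != 0 ->
  sector (- x) (- y) = opposite (sector x y).
Proof.
move=> nz; rewrite /sector /opposite !normrN.
case: ifP => h /=; congr pair; rewrite oppr_ge0.
  have x0 : x != 0.
    case: nz => // y0; apply: contra_neq y0 => x0.
    by apply/eqP; rewrite -normr_le0 (le_trans h) // x0 normr0.
  by rewrite -ltNge lt_neqAle x0.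
have y0 : y != 0.
  by apply: contraFneq h => ->; rewrite normr0.
by rewrite -ltNge lt_neqAle y0.
Qed.

(** Opposite sectors have the same dominant coordinate with different signs, so this coordinate
    would differ by at least [m]. *)
Lemma sector_near (R : realType) (m x y x' y' : R) :
  m / 2 <= Num.max `|x| `|y| -> `|x - x'| < m / 2 -> `|y - y'| < m / 2 ->
  m / 2 <= Num.max `|x'| `|y'| ->
  sector x' y' != opposite (sector x y).
Proof.
rewrite /sector /opposite !le_max !ltr_norml => h1 /andP[h2 h3] /andP[h4 h5] h6.
apply/negP; case: (leP `|y| `|x|) => hyx; case: (leP `|y'| `|x'|) => hyx' //=.
  have {}h1 : m / 2 <= `|x| by case/orP: h1 => // h1; exact: le_trans h1 hyx.
  have {}h6 : m / 2 <= `|x'| by case/orP: h6 => // h6; exact: le_trans h6 hyx'.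
  move: h1 h6; case: (ger0P x) => x0 h1; case: (ger0P x') => x0' h6 //= _; lra.
have {}h1 : m / 2 <= `|y| by case/orP: h1 => // h1; apply: le_trans h1 (ltW hyx).
have {}h6 : m / 2 <= `|y'| by case/orP: h6 => // h6; apply: le_trans h6 (ltW hyx').
move: h1 h6; case: (ger0P y) => x0 h1; case: (ger0P y') => x0' h6 //= _; lra.
Qed.

(* A loop in the punctured plane which is odd cannot be deformed into a loop
   that retraces its own steps as [a b a^-1 b^-1]. *)
Lemma no_odd_homotopy (R : realType) (H1 H2 : R * R -> R) :
  continuous H1 -> continuous H2 ->
  (forall r t, 0 <= r <= 1 -> 0 <= t <= 1 -> H1 (r, t) != 0 \/ H2 (r, t) != 0) ->
  (forall r, 0 <= r <= 1 -> H1 (r, 1) = H1 (r, 0) /\ H2 (r, 1) = H2 (r, 0)) ->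
  (forall t, 0 <= t <= 1 / 2 ->
     H1 (1, t + 1 / 2) = - H1 (1, t) /\ H2 (1, t + 1 / 2) = - H2 (1, t)) ->
  (forall t, 0 <= t <= 1 / 4 ->
     H1 (0, t) = H1 (0, 3 / 4 - t) /\ H2 (0, t) = H2 (0, 3 / 4 - t)) ->
  (forall t, 1 / 4 <= t <= 1 / 2 ->
     H1 (0, t) = H1 (0, 5 / 4 - t) /\ H2 (0, t) = H2 (0, 5 / 4 - t)) ->
  False.
Proof.
move=> c1 c2 nz per odd_end ret1 ret2.
pose l p := sector (H1 p) (H2 p).
have /compact_near_coveringP : compact (`[0:R, 1] `*` `[0:R, 1]).
  by apply: compact_setX; exact: segment_compact.
(* [P n x] says that the mesh [1 / (n + 1)] is fine enough at [x]; compactness of the unit square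
   yields one mesh for all its points. *)
pose P (n : nat) (x : R * R) := forall p q : R * R,
  `|x.1 - p.1| <= n.+1%:R^-1 -> `|x.2 - p.2| <= n.+1%:R^-1 ->
  `|x.1 - q.1| <= n.+1%:R^-1 -> `|x.2 - q.2| <= n.+1%:R^-1 -> l q != opposite (l p).
move/(_ _ \oo P _)=> [].
  move=> [r t] [/= Hr Ht].
  pose m := Num.max `|H1 (r, t)| `|H2 (r, t)|.
  have m0 : 0 < m.
    rewrite lt_max !normr_gt0; apply/orP; apply: nz; [by move: Hr; rewrite in_itv|].
    by move: Ht; rewrite in_itv.
  (* Values within [m / 4] of the one at [(r, t)] are within [m / 2] of each other, and their larger
     coordinate still has modulus at least [m / 2], as [sector_near] requires. *)
  have m4 : 0 < m / 4 by rewrite divr_gt0.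
  have /cvgrPdist_lt/(_ _ m4) := c1 (r, t).
  have /cvgrPdist_lt/(_ _ m4) := c2 (r, t).
  move=> n2 n1; have [d d0 Hd] : exists2 d, 0 < d & forall p : R * R, `|r - p.1| < d -> `|t - p.2| < d ->
      `|H1 (r, t) - H1 p| < m / 4 /\ `|H2 (r, t) - H2 p| < m / 4.
    have : nbhs (r, t) (fun p => `|H1 (r, t) - H1 p| < m / 4 /\ `|H2 (r, t) - H2 p| < m / 4).
      by near=> p; split; near: p.
    move=> /nbhs_ballP[d /= d0 Hd].
    exists d => // p p1 p2; apply: Hd; split => //=.
  have d2 : 0 < d / 2 by rewrite divr_gt0.
  exists (ball (r, t) (d / 2), [set n | n.+1%:R^-1 < d / 2]).
    split; first by apply: nbhsx_ballx.
    exact: near_infty_natSinv_lt (PosNum d2).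
  move=> [[r' t'] n] /= [[/= b1 b2] nd] p q p1 p2 q1 q2.
  rewrite /ball /= in b1 b2.
  have T (a b c : R) : `|a - b| < d / 2 -> `|b - c| <= n.+1%:R^-1 -> `|a - c| < d.
    move=> ab bc; have -> : a - c = (a - b) + (b - c) by ring.
    have {}nd : n.+1%:R^-1 < d / 2 := nd.
    rewrite (splitr d); apply: (le_lt_trans (ler_normD _ _)).
    by apply: ltrD => //; exact: le_lt_trans bc nd.
  have [hp1 hp2] := Hd p (T _ _ _ b1 p1) (T _ _ _ b2 p2).
  have [hq1 hq2] := Hd q (T _ _ _ b1 q1) (T _ _ _ b2 q2).
  have big u v : `|H1 (r, t) - u| < m / 4 -> `|H2 (r, t) - v| < m / 4 -> m / 2 <= Num.max `|u| `|v|.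
    move=> hu hv; rewrite le_max.
    have : (m <= `|H1 (r, t)|) || (m <= `|H2 (r, t)|) by rewrite -le_max.
    case/orP => hm; apply/orP; [left|right].
      have := ler_normB (H1 (r, t) - u) (H1 (r, t)).
      rewrite (_ : _ - _ - _ = - u) ?normrN; last by ring.
      have := ler_normD (H1 (r, t) - u) u; rewrite subrK; lra.
    have := ler_normD (H2 (r, t) - v) v; rewrite subrK; lra.
  have dd (a b c : R) : `|a - b| < m / 4 -> `|a - c| < m / 4 -> `|b - c| < m / 2.
    rewrite !ltr_norml => /andP[? ?] /andP[? ?]; apply/andP; split; lra.
  by apply: (@sector_near _ m); eauto.
move=> n0 _ /(_ n0 (leqnn _)) {}H.
(* The factor 4 makes 1/4, 1/2 and 3/4 grid points. *)
pose n := n0.+1; pose N := (4 * n)%N.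
pose g (i : nat) : R := i%:R / N%:R.
have N0 : (0:R) < N%:R by rewrite ltr0n.
have gle i : (i <= N)%N -> 0 <= g i <= 1.
  by move=> iN; rewrite divr_ge0 //= ler_pdivrMr // mul1r ler_nat.
have gD i j : g (i + j)%N = g i + g j by rewrite /g natrD mulrDl.
have gn k : g (k * n)%N = k%:R / 4.
  rewrite /g /N !natrM; field; rewrite pnatr_eq0 //.
have gN : g N = 1 by rewrite /g divff // gt_eqF.
have g0 : g 0%N = 0 by rewrite /g mul0r.
have gB i j : (j <= i)%N -> g (i - j)%N = g i - g j.
  by move=> ji; rewrite /g natrB // mulrBl.
have gmono i j : (g i <= g j) = (i <= j)%N.
  by rewrite /g ler_pM2r ?invr_gt0 // ler_nat.
have e4 : 1 / 4 = g n by rewrite -[n]mul1n gn.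
have e2 : 1 / 2 = g (2 * n)%N by rewrite gn; lra.
apply: (@no_odd_grid n N (fun i j => l (g i, g j))) => //.
- move=> i j i' j' iN jN Hi' Hj' i'' j'' Hi'' Hj''.
  have D a b : (a <= b <= a.+1)%N -> `|g a - g b| <= n0.+1%:R^-1.
    move=> /andP[ab ba]; rewrite distrC ger0_norm ?subr_ge0 ?gmono //.
    rewrite -gB //; apply: (@le_trans _ _ (g 1%N)); first by rewrite gmono; lia.
    by rewrite /g mul1r lef_pV2 ?posrE ?ltr0n // ler_nat; lia.
  apply: (H (g i, g j)); rewrite /= ?in_itv /= ?gle ?D //; exact: ltnW.
- by move=> i iN; rewrite /l gN g0; have [-> ->] := per _ (gle _ iN).
- move=> j jn; rewrite /l gN gD gn.
  have hj : 0 <= g j <= 1 / 2.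
    by rewrite e2 -g0 !gmono leq0n.
  rewrite -gn -e2.
  have [-> ->] := odd_end _ hj; apply: sectorN; apply: nz; lra.
- move=> j jn; rewrite /l g0 gB ?gn; last lia.
  have hj : 0 <= g j <= 1 / 4.
    by rewrite e4 -g0 !gmono leq0n.
  by have [-> ->] := ret1 _ hj.
- move=> j jn; rewrite /l g0 gB ?gn; last lia.
  have hj : 1 / 4 <= g j <= 1 / 2.
    by rewrite e4 e2 !gmono.
  by have [-> ->] := ret2 _ hj.
Unshelve. all: by end_near.
Qed.

(** * Plane invariance of domain *)

(** A head symbol by which the tactic [continuity] recognizes its goals and decomposes the function
    syntactically. *)
Definition cont (T U : topologicalType) (f : T -> U) := continuous f.

Section RealFunctions.
Variables (R : realType) (T : topologicalType).
Implicit Types f g : T -> R.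

Lemma cont_add f g : cont f -> cont g -> cont (fun x => f x + g x).
Proof. by move=> cf cg x; apply: cvgD; [exact: cf|exact: cg]. Qed.

Lemma cont_opp f : cont f -> cont (fun x => - f x).
Proof. by move=> cf x; apply: cvgN; exact: cf. Qed.

Lemma cont_mul f g : cont f -> cont g -> cont (fun x => f x * g x).
Proof. by move=> cf cg x; apply: cvgM; [exact: cf|exact: cg]. Qed.

Lemma cont_max f g : cont f -> cont g -> cont (fun x => Num.max (f x) (g x)).
Proof. by move=> cf cg x; apply: continuous_max; [exact: cf|exact: cg]. Qed.

Lemma cont_min f g : cont f -> cont g -> cont (fun x => Num.min (f x) (g x)).
Proof. by move=> cf cg x; apply: continuous_min; [exact: cf|exact: cg]. Qed.

Lemma cont_norm f : cont f -> cont (fun x => `|f x|).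
Proof. by move=> cf x; apply: cvg_norm; exact: cf. Qed.

Lemma cont_inv f : cont f -> (forall x, f x != 0) -> cont (fun x => (f x)^-1).
Proof. by move=> cf f0 x; apply: continuousV; [exact: f0|exact: cf]. Qed.
End RealFunctions.

Section TopologicalFunctions.
Variables T U V : topologicalType.

Lemma cont_cst (u : U) : cont (fun _ : T => u).
Proof. by move=> x; exact: cvg_cst. Qed.

Lemma cont_id : cont (fun x : T => x).
Proof. by move=> x; exact: cvg_id. Qed.

Lemma cont_comp (f : T -> U) (g : U -> V) : cont g -> cont f -> cont (fun x => g (f x)).
Proof. by move=> cg cf x; apply: continuous_comp; [exact: cf|exact: cg]. Qed.

Lemma cont_pair (f : T -> U) (g : T -> V) : cont f -> cont g -> cont (fun x => (f x, g x)).
Proof. by move=> cf cg x; apply: cvg_pair; [exact: cf|exact: cg]. Qed.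

Lemma cont_fst (f : T -> U * V) : cont f -> cont (fun x => (f x).1).
Proof. by move=> cf x; apply: continuous_comp; [exact: cf|exact: cvg_fst]. Qed.

Lemma cont_snd (f : T -> U * V) : cont f -> cont (fun x => (f x).2).
Proof. by move=> cf x; apply: continuous_comp; [exact: cf|exact: cvg_snd]. Qed.
End TopologicalFunctions.

Lemma cont_row (R : realType) (T : topologicalType) n (f : T -> 'rV[R]_n) :
  (forall i, cont (fun x => f x 0 i)) -> cont f.
Proof.
move=> cf x; apply/cvgrPdist_lt => e e0.
have : \forall y \near x, forall i, `|f x 0 i - f y 0 i| < e.
  by apply: filter_forall => i; have /cvgrPdist_lt := cf i x; exact.
apply: filterS => y Hy; rewrite /Num.Def.normr /= mx_normrE.
apply/bigmax_ltP; split=> // -[i j] _ /=; rewrite !mxE ord1; exact: Hy.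
Qed.

Lemma cont_coord (R : realType) (T : topologicalType) m n (f : T -> 'M[R]_(m, n)) i j :
  cont f -> cont (fun x => f x i j).
Proof. by apply: (@cont_comp _ _ _ f (fun M => M i j)); exact: coord_continuous. Qed.

Ltac continuity := repeat first [assumption | lazymatch goal with
  | |- cont (fun _ => ?c) => exact: cont_cst
  | |- cont (fun x => @Algebra.add _ (@?f x) (@?g x)) => refine (@cont_add _ _ f g _ _)
  | |- cont (fun x => @Algebra.opp _ (@?f x)) => refine (@cont_opp _ _ f _)
  | |- cont (fun x => @GRing.mul _ (@?f x) (@?g x)) => refine (@cont_mul _ _ f g _ _)
  | |- cont (fun x => @Order.max _ _ (@?f x) (@?g x)) => refine (@cont_max _ _ f g _ _)
  | |- cont (fun x => @Order.min _ _ (@?f x) (@?g x)) => refine (@cont_min _ _ f g _ _)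
  | |- cont (fun x => @Num.norm _ _ (@?f x)) => refine (@cont_norm _ _ f _)
  | |- cont (fun x => @GRing.inv _ (@?f x)) => refine (@cont_inv _ _ f _ _)
  | |- cont (fun x => (@?f x, @?g x)) => refine (@cont_pair _ _ _ f g _ _)
  | |- cont (fun x => fst (@?f x)) => refine (@cont_fst _ _ _ f _)
  | |- cont (fun x => snd (@?f x)) => refine (@cont_snd _ _ _ f _)
  | |- cont (fun x => @fun_of_matrix _ _ _ (@?f x) ?i ?j) => refine (@cont_coord _ _ _ _ f i j _)
  | |- cont (fun x => x) => exact: cont_id
  | |- cont (fun x => ?h (@?f x)) =>
      refine (@cont_comp _ _ _ f h _ _);
        [assumption|]
  end].

(** * Piecewise linear parameters for homotopies *)

Section Clip.
Variable R : realType.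
Implicit Types x : R.

Definition clip01 x := Num.max 0 (Num.min 1 x).
(** A trapezoid: 1 for [|x| <= 1], -1 for [|x| >= 3], of slope 1 or -1 in between. The square has
    perimeter 8, whence the factor 8 below; the shifts 3 and 5 differ by the length 2 of one
    side. *)
Definition square_wave x := Num.max (-1) (Num.min 1 (2 - `|x|)).

(* [(square_x t, square_y t)], [0 <= t <= 1], runs once around the boundary of
   the square [-1, 1]^2, starting at the corner (-1, -1). *)
Definition square_x t := square_wave (8 * t - 3).
Definition square_y t := square_wave (8 * t - 5).

Lemma clip01_ge0 x : 0 <= clip01 x.
Proof. by rewrite le_max lexx. Qed.

Lemma clip01_le1 x : clip01 x <= 1.
Proof. by rewrite ge_max ler01 ge_min lexx. Qed.

Lemma clip01_0 x : x <= 0 -> clip01 x = 0.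
Proof. by move=> x0; rewrite /clip01 min_r ?max_l //; lra. Qed.

Lemma clip01_1 x : 1 <= x -> clip01 x = 1.
Proof. by move=> x0; rewrite /clip01 min_l ?max_r //; lra. Qed.

Lemma clip01_id x : 0 <= x <= 1 -> clip01 x = x.
Proof. by move=> x01; rewrite /clip01 min_r ?max_r //; lra. Qed.

Lemma clip01_lt1 x : x < 1 -> clip01 x < 1.
Proof. by move=> x1; rewrite /clip01 gt_max ltr01 gt_min x1 orbT. Qed.

Lemma cont_clip01 : cont clip01.
Proof. by rewrite /clip01; continuity. Qed.

Lemma square_wave_bound x : `|square_wave x| <= 1.
Proof.
have : 0 <= `|x| by [].
rewrite /square_wave ler_norml; move: `|x| => y y0.
case: (leP 1 (2 - y)) => ?; [case: (leP (-1) 1)|case: (leP (-1) (2 - y))] => ?; lra.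
Qed.

Lemma cont_square_x : cont square_x.
Proof. by rewrite /square_x /square_wave; continuity. Qed.

Lemma cont_square_y : cont square_y.
Proof. by rewrite /square_y /square_wave; continuity. Qed.

Lemma square_waveE x :
  [\/ x <= -3 /\ square_wave x = -1, -3 <= x <= -1 /\ square_wave x = 2 + x,
   -1 <= x <= 1 /\ square_wave x = 1 | (1 <= x <= 3 /\ square_wave x = 2 - x) \/
   (3 <= x /\ square_wave x = -1)].
Proof.
rewrite /square_wave; case: (ger0P x) => x0.
  case: (leP 1 (2 - x)) => h1; [case: (leP (-1) 1)|case: (leP (-1) (2 - x))] => h2; try lra.
  - by constructor 3; split; lra.
  - by constructor 4; left; split; lra.
  - by constructor 4; right; split; lra.
case: (leP 1 (2 - - x)) => h1; [case: (leP (-1) 1)|case: (leP (-1) (2 - - x))] => h2; try lra.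
- by constructor 3; split; lra.
- by constructor 2; split; lra.
- by constructor 1; split; lra.
Qed.

Ltac square_tac := rewrite /square_x /square_y;
  repeat match goal with |- context [square_wave ?x] =>
    case: (square_waveE x) => [[? ->]|[? ->]|[? ->]|[[? ->]|[? ->]]]; try lra
  end.

Lemma square_boundary t : 0 <= t <= 1 -> `|square_x t| = 1 \/ `|square_y t| = 1.
Proof.
move=> ht.
have : square_x t = 1 \/ square_x t = -1 \/ square_y t = 1 \/ square_y t = -1.
  rewrite /square_x /square_y.
  case: (square_waveE (8 * t - 3)) => [[? ->]|[? ->]|[? ->]|[[? ->]|[? ->]]];
  case: (square_waveE (8 * t - 5)) => [[? ->]|[? ->]|[? ->]|[[? ->]|[? ->]]]; lra.
by case=> [->|[->|[->|->]]]; rewrite ?normrN normr1; auto.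
Qed.

Lemma square_period : square_x 1 = square_x 0 /\ square_y 1 = square_y 0.
Proof. by split; square_tac. Qed.

Lemma square_antipode t : 0 <= t <= 1 / 2 ->
  square_x (t + 1 / 2) = - square_x t /\ square_y (t + 1 / 2) = - square_y t.
Proof. by move=> ht; split; square_tac. Qed.

(** Opposite sides are traversed in opposite directions; this is the pattern [a b a^-1 b^-1] once
    they are identified. *)
Lemma square_horizontal t : 0 <= t <= 1 / 4 ->
  [/\ square_x (3 / 4 - t) = square_x t, square_y t = -1 & square_y (3 / 4 - t) = 1].
Proof. by move=> ht; split; square_tac. Qed.

Lemma square_vertical t : 1 / 4 <= t <= 1 / 2 ->
  [/\ square_y (5 / 4 - t) = square_y t, square_x t = 1 & square_x (5 / 4 - t) = -1].
Proof. by move=> ht; split; square_tac. Qed.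
End Clip.
#[global] Opaque clip01 square_wave square_x square_y.

Ltac continuity_loops := repeat first [progress continuity | lazymatch goal with
  | |- cont (fun x => clip01 (@?f x)) => refine (@cont_comp _ _ _ f (@clip01 _) (@cont_clip01 _) _)
  | |- cont (fun x => square_x (@?f x)) => refine (@cont_comp _ _ _ f (@square_x _) (@cont_square_x _) _)
  | |- cont (fun x => square_y (@?f x)) => refine (@cont_comp _ _ _ f (@square_y _) (@cont_square_y _) _)
  end].

(* If [f x0] were not interior to the image, then the boundary of a small square
   around [x0], which [f] maps to a loop homotopic to the odd loop
   [f (x0 + p) - f (x0 - p)], could be contracted in the plane minus a point. *)
Lemma planar_invariance_of_domain (R : realType) (W : set (R * R))
    (f : R * R -> R * R) (x0 : R * R) :
  open W -> (forall x, W x -> {for x, continuous f}) ->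
  (forall x y, W x -> W y -> f x = f y -> x = y) -> W x0 ->
  nbhs (f x0) (f @` W).
Proof.
move=> oW cf inj Wx0.
have /nbhs_ballP[d0 /= d00 Hd0] : nbhs x0 W by apply: open_nbhs_nbhs.
have [d d_gt0 dd0] : exists2 d : R, 0 < d & d < d0 by exists (d0 / 2); lra.
pose pt (s : R) (t : R) : R * R := (x0.1 + s * (d * square_x t), x0.2 + s * (d * square_y t)).
have small (s u : R) : `|s| <= 1 -> `|u| <= 1 -> `|s| * (`|d| * `|u|) < d0.
  move=> s1 u1; rewrite (gtr0_norm d_gt0) (@le_lt_trans _ _ (1 * (d * 1))) //; last by lra.
  by rewrite ler_pM ?mulr_ge0 ?ler_pM //; exact: ltW.
have dI x : d * x = 0 -> x = 0.
  by move/eqP; rewrite mulf_eq0 gt_eqF //= => /eqP.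
have Wpt s t : `|s| <= 1 -> W (pt s t).
  move=> s1; apply: Hd0; rewrite /pt; split; rewrite /= /ball /= opprD addrA subrr sub0r normrN !normrM.
    exact: small (square_wave_bound _).
  exact: small (square_wave_bound _).
have pt0 t : pt 0 t = x0 by rewrite /pt !mul0r !addr0 -surjective_pairing.
have cpt (S : topologicalType) (s t : S -> R) : cont s -> cont t ->
    cont (fun z => pt (s z) (t z)).
  by move=> cs ct; rewrite /pt; continuity_loops.
(* The minimum of this distance between [f x0] and the image of the square boundary is the radius of
   a ball contained in the image of [W]. *)
pose m (t : R) : R := Num.max `|(f (pt 1 t)).1 - (f x0).1| `|(f (pt 1 t)).2 - (f x0).2|.
have m_gt0 t : 0 <= t <= 1 -> 0 < m t.
  move=> ht; rewrite lt_max !normr_gt0 !subr_eq0; apply/negPn/negP.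
  rewrite negb_or !negbK => /andP[/eqP e1 /eqP e2].
  have : pt 1 t = x0.
    apply: inj => //; first by apply: Wpt; rewrite normr1.
    by rewrite (surjective_pairing (f _)) e1 e2 -surjective_pairing.
  rewrite /pt (surjective_pairing x0) /= !mul1r => -[h1 h2].
  have {}h1 : square_x t = 0.
    by apply: dI; lra.
  have {}h2 : square_y t = 0.
    by apply: dI; lra.
  by have := square_boundary ht; rewrite h1 h2 normr0; lra.
have cfpt (S : topologicalType) (s t : S -> R) : cont s -> cont t ->
    (forall z, `|s z| <= 1) -> cont (fun z => f (pt (s z) (t z))).
  move=> cs ct s1 z; apply: continuous_comp; first exact: (cpt _ _ _ cs ct).
  by apply: cf; exact: Wpt.
have cm : cont m.
  have cf1 : cont (fun t => f (pt 1 t)).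
    by apply: (@cfpt _ (fun=> 1) id); [exact: cont_cst|exact: cont_id|rewrite normr1].
  by rewrite /m; continuity; apply: cf1.
have [t0 ht0 Hm] := @EVT_min R m 0 1 ler01 (continuous_subspaceT cm).
have e0 : 0 < m t0 by apply: m_gt0; move: ht0; rewrite in_itv.
apply/nbhs_ballP; exists (m t0) => // y [/= y1 y2].
rewrite /ball /= in y1 y2.
apply: contrapT => Hy.
(* Three stages of length 1/3. The square grows from a point, and 0 is avoided because [y] is no
   value of [f]. Then [k] falls from 1 to 0, moving [y] to [f x0], which stays closer to [f x0] than
   the loop does. Finally [s1] and [s2] move to 1/2 and -1/2; the denominators keep [s1 - s2 = 1],
   so that injectivity applies. *)
pose s1 (r : R) : R := clip01 (3 * r) / (1 + clip01 (3 * r - 2)).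
pose s2 (r : R) : R := - clip01 (3 * r - 2) / (1 + clip01 (3 * r - 2)).
pose k (r : R) : R := clip01 (2 - 3 * r).
have den (x : R) : 1 + clip01 x != 0 by have := clip01_ge0 x; lra.
have s1b r : `|s1 r| <= 1.
  have ? := clip01_ge0 (3 * r); have ? := clip01_le1 (3 * r); have ? := clip01_ge0 (3 * r - 2).
  by rewrite ger0_norm /s1 ?divr_ge0 ?ler_pdivrMr; lra.
have s2b r : `|s2 r| <= 1.
  have ? := clip01_ge0 (3 * r - 2).
  by rewrite /s2 mulNr normrN ger0_norm ?divr_ge0 ?ler_pdivrMr; lra.
have c1 : cont s1 by rewrite /s1; continuity_loops => x; exact: den.
have c2 : cont s2 by rewrite /s2; continuity_loops => x; exact: den.
have ck : cont k by rewrite /k; continuity_loops.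
pose F (r t : R) := f (pt (s1 r) t).
pose G (r t : R) := f (pt (s2 r) t).
have cF : cont (fun z : R * R => F z.1 z.2).
  by apply: (@cfpt _ (fun z => s1 z.1) (fun z => z.2)) => //; continuity.
have cG : cont (fun z : R * R => G z.1 z.2).
  by apply: (@cfpt _ (fun z => s2 z.1) (fun z => z.2)) => //; continuity.
pose H1 (z : R * R) : R := (F z.1 z.2).1 - (G z.1 z.2).1 - k z.1 * (y.1 - (f x0).1).
pose H2 (z : R * R) : R := (F z.1 z.2).2 - (G z.1 z.2).2 - k z.1 * (y.2 - (f x0).2).
apply: (@no_odd_homotopy R H1 H2).
- by change (cont H1); rewrite /H1; continuity.
- by change (cont H2); rewrite /H2; continuity.
- move=> r t hr ht; apply: contrapT => /not_orP[/negP/negPn/eqP e1 /negP/negPn/eqP e2].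
  move: e1 e2; rewrite /H1 /H2 /=.
  have [r1|r1] := leP (3 * r) 1.
    rewrite /G /s2 /k (@clip01_0 _ (3 * r - 2)) ?(@clip01_1 _ (2 - 3 * r)); [|lra|lra].
    rewrite oppr0 mul0r pt0 !mul1r => e1 e2; apply: Hy; exists (pt (s1 r) t); first exact: Wpt.
    by rewrite (surjective_pairing y) (surjective_pairing (f _)) -/(F r t); congr pair; lra.
  have [r2|r2] := leP (3 * r) 2.
    rewrite /F /G /s1 /s2 (@clip01_0 _ (3 * r - 2)) ?(@clip01_1 _ (3 * r)); [|lra|lra].
    rewrite oppr0 mul0r pt0 addr0 divr1 => e1 e2.
    have ? := clip01_ge0 (2 - 3 * r); have ? := clip01_le1 (2 - 3 * r).
    have {}ht0 : m t0 <= m t by apply: Hm; rewrite in_itv.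
    have hk a b : `|a - b| < m t0 -> `|k r * (b - a)| < m t0.
      move=> h; apply: le_lt_trans h; rewrite normrM distrC ger0_norm // ler_piMl //.
    have hk1 := hk _ _ y1; have hk2 := hk _ _ y2.
    move: ht0; rewrite {2}/m le_max => /orP[]; rewrite leNgt.
      by rewrite (_ : _ - _ = k r * (y.1 - (f x0).1)) ?hk1 //; lra.
    by rewrite (_ : _ - _ = k r * (y.2 - (f x0).2)) ?hk2 //; lra.
  rewrite /k (@clip01_0 _ (2 - 3 * r)); last lra.
  rewrite !mul0r !subr0 => e1 e2.
  have : pt (s1 r) t = pt (s2 r) t.
    apply: inj; [exact: Wpt|exact: Wpt|].
    by rewrite -/(F r t) -/(G r t) (surjective_pairing (F _ _)) (surjective_pairing (G _ _)); congr pair; lra.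
  rewrite /pt => -[/addrI h1 /addrI h2].
  have : s1 r - s2 r = 1.
    by rewrite /s1 /s2 (@clip01_1 _ (3 * r)) -?mulrBl ?opprK ?divff //; lra.
  move=> s12; have {}h1 : square_x t = 0.
    have : (s1 r - s2 r) * (d * square_x t) = 0 by rewrite mulrBl h1 subrr.
    by rewrite s12 mul1r => /dI.
  have {}h2 : square_y t = 0.
    have : (s1 r - s2 r) * (d * square_y t) = 0 by rewrite mulrBl h2 subrr.
    by rewrite s12 mul1r => /dI.
  by have := square_boundary ht; rewrite h1 h2 normr0; lra.
- move=> r _; have [ex ey] := square_period R.
  by rewrite /H1 /H2 /F /G /pt /= ex ey.
- move=> t ht; have [ex ey] := square_antipode ht.
  have s12 : s2 1 = - s1 1.
    by rewrite /s1 /s2 !(@clip01_1 _ (3 * 1)) ?(@clip01_1 _ (3 * 1 - 2)) ?mulNr //; lra.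
  have ptN s : pt s (t + 1 / 2) = pt (- s) t by rewrite /pt ex ey !mulrN !mulNr.
  have k1 : k 1 = 0 by rewrite /k clip01_0 //; lra.
  by rewrite /H1 /H2 /F /G /= !ptN s12 opprK k1 !mul0r !subr0 !opprB.
- by move=> t _; rewrite /H1 /H2 /F /G /s1 /s2 /= !mulr0 sub0r !clip01_0 ?oppr0 ?mul0r ?pt0 //; lra.
- by move=> t _; rewrite /H1 /H2 /F /G /s1 /s2 /= !mulr0 sub0r !clip01_0 ?oppr0 ?mul0r ?pt0 //; lra.
Qed.

(** * Triangulated 2-spheres *)

Lemma continuous_within_comp (S T U : topologicalType) (A : set T) (h : T -> U)
    (g : S -> T) (s : S) :
  {within A, continuous h} -> {for s, continuous g} -> (\forall z \near s, A (g z)) ->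
  {for s, continuous (fun z => h (g z))}.
Proof.
move=> ch cg Ag; have As : A (g s) by exact: nbhs_singleton Ag.
move=> B hB.
have wB : within A (nbhs (g s)) (h @^-1` B).
  by rewrite nbhs_subspace_in //; exact: (ch (g s) B hB).
have {}wB : nbhs s (g @^-1` [set x | A x -> B (h x)]) by exact: (cg _ wB).
by apply: filterS2 wB Ag => z; exact.
Qed.

Section Stereographic.
Variable R : realType.
Implicit Types x y n : 'rV[R]_3.

Definition dot3 x y := x 0 0 * y 0 0 + x 0 1 * y 0 1 + x 0 2 * y 0 2.

Lemma two_sphereE x : two_sphere R x <-> dot3 x x = 1.
Proof.
rewrite /two_sphere /dot3 /= !big_ord_recl big_ord0 addr0 -!expr2 addrA.
have -> : lift ord0 (ord0 : 'I_2) = 1 :> 'I_3 by exact: val_inj.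
by have -> : lift ord0 (lift ord0 (ord0 : 'I_1)) = 2 :> 'I_3 by exact: val_inj.
Qed.

Lemma row3P x y : x 0 0 = y 0 0 -> x 0 1 = y 0 1 -> x 0 2 = y 0 2 -> x = y.
Proof.
move=> e0 e1 e2; apply/rowP => -[[|[|[|//]]] Hi].
- by rewrite (_ : Ordinal Hi = 0) //; exact: val_inj.
- by rewrite (_ : Ordinal Hi = 1) //; exact: val_inj.
- by rewrite (_ : Ordinal Hi = 2) //; exact: val_inj.
Qed.

Definition row3 (a b c : R) : 'rV[R]_3 :=
  \row_i (if i == 0 then a else if i == 1 then b else c).

Lemma row3E a b c : [/\ row3 a b c 0 0 = a, row3 a b c 0 1 = b & row3 a b c 0 2 = c].
Proof. by rewrite /row3; split; rewrite mxE. Qed.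

(* Exchanges [n] and the first basis vector [e] (junk division by 0 makes it the
   identity when [n = e]). *)
Definition reflection n x : 'rV[R]_3 :=
  let w := n - row3 1 0 0 in x - (2 * dot3 x w / dot3 w w) *: w.

(** True for the junk quotient as well: if [dot3 w w] vanishes, then so does [w], and both sides are
    0. *)
Lemma reflection_axis n x (w := n - row3 1 0 0) :
  2 * dot3 x w / dot3 w w * dot3 w w = 2 * dot3 x w.
Proof.
have [w0|w0] := eqVneq (dot3 w w) 0; last by rewrite divfK.
have : w = 0.
  move: w0; rewrite /dot3 -!expr2 => w0.
  have := sqr_ge0 (w 0 0); have := sqr_ge0 (w 0 1); have := sqr_ge0 (w 0 2) => h2 h1 h0.
  by apply: row3P; rewrite [RHS]mxE; apply/eqP; rewrite -sqrf_eq0; apply/eqP; lra.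
by move=> ->; rewrite /dot3 !mxE; ring.
Qed.

Lemma dot3_reflection n x : dot3 (reflection n x) (reflection n x) = dot3 x x.
Proof.
have := reflection_axis n x; rewrite /reflection.
move: (n - _) (_ / _) => w c; rewrite /dot3 !mxE => H.
have : c * (c * (w 0 0 * w 0 0 + w 0 1 * w 0 1 + w 0 2 * w 0 2))
  = c * (2 * (x 0 0 * w 0 0 + x 0 1 * w 0 1 + x 0 2 * w 0 2)) by rewrite H.
lra.
Qed.

Lemma reflectionK n : involutive (reflection n).
Proof.
move=> x; have := reflection_axis n x; rewrite /reflection.
set w := n - _; set c := _ / _ => H.
have E : dot3 (x - c *: w) w = - dot3 x w by move: H; rewrite /dot3 !mxE; lra.
by rewrite E mulrN mulNr -/c scaleNr opprK subrK.
Qed.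

Lemma reflection_pole n : dot3 n n = 1 -> reflection n n = row3 1 0 0.
Proof.
move=> n1; rewrite /reflection; set w := n - _.
have [e0 e1 e2] := row3E 1 0 0.
have wE : [/\ w 0 0 = n 0 0 - 1, w 0 1 = n 0 1 & w 0 2 = n 0 2].
  by rewrite !mxE /= !subr0.
have ww : dot3 w w = 2 * dot3 n w.
  by move: n1; rewrite /dot3; case: wE => -> -> ->; lra.
rewrite -ww; have [w0|w0] := eqVneq (dot3 w w) 0; last by rewrite divff // scale1r /w opprB addrC subrK.
have n0 : n 0 0 = 1 by move: w0 n1; rewrite /dot3; case: wE => -> -> ->; lra.
have w00 : w 0 0 = 0 by case: wE => -> _ _; rewrite n0 subrr.
rewrite w0 mul0r scale0r subr0; apply: row3P; rewrite ?e0 ?e1 ?e2 //.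
  by apply/eqP; rewrite -sqrf_eq0; apply/eqP; have := sqr_ge0 (n 0 1); have := sqr_ge0 (n 0 2);
     move: n1; rewrite /dot3 n0 !expr2; lra.
by apply/eqP; rewrite -sqrf_eq0; apply/eqP; have := sqr_ge0 (n 0 1); have := sqr_ge0 (n 0 2);
     move: n1; rewrite /dot3 n0 !expr2; lra.
Qed.

(** [reflection n] moves the pole [n] to the first basis vector, from which [q] projects; [r] is the
    inverse projection, with denominator [nu u = |u|^2 + 1]. *)
Lemma stereographic n : two_sphere R n -> exists (s : 'rV[R]_3 -> R * R) (p : R * R -> 'rV[R]_3),
  [/\ forall x, two_sphere R x -> x <> n -> {for x, continuous s} /\ p (s x) = x,
      cont p &
      forall u, [/\ two_sphere R (p u), p u <> n & s (p u) = u]].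
Proof.
move=> /two_sphereE n1.
pose q y : R * R := (y 0 1 / (1 - y 0 0), y 0 2 / (1 - y 0 0)).
pose nu (u : R * R) := u.1 * u.1 + u.2 * u.2 + 1.
have nu0 u : nu u != 0.
  by rewrite gt_eqF // /nu -!expr2; have := sqr_ge0 u.1; have := sqr_ge0 u.2; lra.
pose r u := row3 ((nu u - 2) / nu u) (2 * u.1 / nu u) (2 * u.2 / nu u).
have rS u : dot3 (r u) (r u) = 1.
  rewrite /dot3; have [-> -> ->] := row3E ((nu u - 2) / nu u) (2 * u.1 / nu u) (2 * u.2 / nu u).
  by have := nu0 u; rewrite /nu => ?; field.
have rq y : dot3 y y = 1 -> y 0 0 != 1 -> r (q y) = y.
  move=> y1 y0; have d0 : 1 - y 0 0 != 0 by rewrite subr_eq0 eq_sym.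
  have nE : nu (q y) = 2 / (1 - y 0 0).
    rewrite /nu /q /=; have -> : y 0 1 / (1 - y 0 0) * (y 0 1 / (1 - y 0 0)) +
      y 0 2 / (1 - y 0 0) * (y 0 2 / (1 - y 0 0)) = (dot3 y y - y 0 0 * y 0 0) / (1 - y 0 0) ^+ 2.
      by rewrite /dot3; field.
    by rewrite y1; field.
  rewrite /r nE /q /=; set a := y 0 0 in d0 *.
  have [e0 e1 e2] := row3E ((2 / (1 - a) - 2) / (2 / (1 - a))) (2 * (y 0 1 / (1 - a)) / (2 / (1 - a))) (2 * (y 0 2 / (1 - a)) / (2 / (1 - a))).
  by apply: row3P; rewrite ?e0 ?e1 ?e2 /a; field.
have qr u : q (r u) = u.
  rewrite /q /r; have [-> -> ->] := row3E ((nu u - 2) / nu u) (2 * u.1 / nu u) (2 * u.2 / nu u).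
  rewrite [RHS]surjective_pairing; congr pair; by field; rewrite nu0 /= opprB addrC subrK pnatr_eq0 //.
have cr : cont (reflection n).
  apply: cont_row => i; rewrite /reflection /=; move: (n - _) => w.
  rewrite (_ : (fun x => _) = fun x => x 0 i - 2 * (x 0 0 * w 0 0 + x 0 1 * w 0 1 + x 0 2 * w 0 2) / dot3 w w * w 0 i).
    by continuity.
  by apply/funext => x; rewrite /dot3 !mxE.
exists (fun x => q (reflection n x)); exists (fun u => reflection n (r u)); split.
- move=> x /two_sphereE x1 xn.
  have y0 : reflection n x 0 0 != 1.
    apply/eqP => y0; apply: xn; rewrite -[x](reflectionK n) -[RHS](reflectionK n); congr reflection.
    rewrite reflection_pole //; have [e0 e1 e2] := row3E 1 0 0.
    have := x1; rewrite -(dot3_reflection n) /dot3 y0 => y1.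
    by apply: row3P; rewrite ?e0 ?e1 ?e2 //; apply/eqP; rewrite -sqrf_eq0; apply/eqP;
      have := sqr_ge0 (reflection n x 0 1); have := sqr_ge0 (reflection n x 0 2);
      move: y1; rewrite !expr2; lra.
  split; last by rewrite /= rq ?reflectionK // dot3_reflection.
  apply: (@continuous_comp _ _ _ (reflection n) q); first exact: cr.
  have d0 : 1 - reflection n x 0 0 != 0 by rewrite subr_eq0 eq_sym.
  have ci i : {for reflection n x, continuous (fun y : 'rV[R]_3 => y 0 i)} by exact: coord_continuous.
  have cd : {for reflection n x, continuous (fun y : 'rV[R]_3 => (1 - y 0 0)^-1)}.
    have c1 : cont (fun y : 'rV[R]_3 => 1 - y 0 0) by continuity.
    by apply: continuousV => //; exact: c1.
  have cc i : {for reflection n x, continuous (fun y : 'rV[R]_3 => y 0 i / (1 - y 0 0))}.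
    by apply: continuousM => //; exact: ci.
  exact: cvg_pair (cc 1) (cc 2).
- apply: (@cont_comp _ _ _ r (reflection n)) => //; apply: cont_row => i; rewrite /r /row3.
  rewrite (_ : (fun u => _) = fun u => if i == 0 then (nu u - 2) / nu u else if i == 1 then 2 * u.1 / nu u else 2 * u.2 / nu u).
    by case: (i == 0); case: (i == 1); rewrite /nu; continuity => //; exact: nu0.
  by apply/funext => u; rewrite mxE.
- move=> u; split; last by rewrite /= reflectionK qr.
    by apply/two_sphereE; rewrite dot3_reflection.
  move=> /= e; have := qr u; have : r u = row3 1 0 0.
    by rewrite -(reflectionK n (r u)) e reflection_pole.
  move=> re _; have := row3E 1 0 0 => -[e0 _ _]; move: e0; rewrite -re.
  have [-> _ _] := row3E ((nu u - 2) / nu u) (2 * u.1 / nu u) (2 * u.2 / nu u).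
  move/eqP; rewrite -subr_eq0 => /eqP h.
  have : nu u * ((nu u - 2) / nu u - 1) = 0 by rewrite h mulr0.
  rewrite mulrBr mulr1 mulrCA divff // mulr1; lra.
Qed.
End Stereographic.

Section Barycentric.
Variables (R : realType) (V : finType).
Implicit Types (w : seq (V * R)) (L : {set {set V}}).

(** A vertex may be listed repeatedly, and its weights add up; curves through possibly coinciding
    vertices thus need no case distinction. *)
Fixpoint coord (v : V) w : R :=
  if w is x :: w' then x.2 * (v == x.1)%:R + coord v w' else 0.

Definition bary w : 'rV[R]_#|V| := \row_i coord (enum_val i) w.

Lemma baryE w v : bary w 0 (enum_rank v) = coord v w.
Proof. by rewrite mxE enum_rankK. Qed.

Lemma sum_enum_rank (g : 'I_#|V| -> R) : \sum_i g i = \sum_v g (enum_rank v).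
Proof. by rewrite (reindex_onto enum_rank enum_val) // => [|i _]; [apply: eq_bigl => v; rewrite enum_rankK eqxx|rewrite enum_valK]. Qed.

Lemma rowV_inj (x y : 'rV[R]_#|V|) :
  (forall v, x 0 (enum_rank v) = y 0 (enum_rank v)) -> x = y.
Proof. by move=> H; apply/rowP => i; rewrite -[i]enum_valK H. Qed.

Lemma sum_coord w : \sum_v coord v w = \sum_(x <- w) x.2.
Proof.
elim: w => [|x w IH]; first by rewrite big_nil big1.
rewrite big_cons -IH big_split /= (bigD1 x.1) //= eqxx mulr1 big1 ?addr0 // => v /negPf ->.
by rewrite mulr0.
Qed.

(** Only vertices of nonzero weight have to lie in [F], so that a single piecewise linear formula
    can run through several simplices. *)
Lemma bary_in L w (F : {set V}) : simplicial_complex L -> F \in L ->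
  all (fun x => 0 <= x.2) w -> \sum_(x <- w) x.2 = 1 ->
  all (fun x => (x.2 != 0) ==> (x.1 \in F)) w ->
  realization R L (bary w).
Proof.
move=> sL FL w0 w1 wF; split.
- move=> i; rewrite mxE; elim: w w0 {w1 wF} => //= x w IH /andP[x0 /IH w0].
  by rewrite addr_ge0 // mulr_ge0.
- by rewrite sum_enum_rank -{}w1 -sum_coord; apply: eq_bigr => v _; rewrite baryE.
apply: sL FL _; apply/fintype.subsetP => v; rewrite inE baryE; apply: contraR => vF; apply/eqP.
elim: w wF {w0 w1} => //= x w IH /andP[xF /IH ->]; rewrite addr0.
have [->|x0] := eqVneq x.2 0; first by rewrite mul0r.
by have [E|] := eqVneq v x.1; [move: xF; rewrite x0 -E (negPf vF)|rewrite mulr0].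
Qed.

Lemma cont_bary (T : topologicalType) (w : T -> seq (V * R)) :
  (forall v, cont (fun t => coord v (w t))) -> cont (fun t => bary (w t)).
Proof.
move=> cw; apply: cont_row => i.
by rewrite (_ : (fun t => _) = fun t => coord (enum_val i) (w t)) //; apply/funext => t; rewrite mxE.
Qed.

End Barycentric.

Ltac bary_continuity := apply: cont_bary => ? /=; continuity_loops.

Lemma open_cont_lt (R : realType) (T : topologicalType) (f : T -> R) (a : R) :
  cont f -> open [set x | f x < a].
Proof.
move=> cf; rewrite (_ : [set x | _] = f @^-1` [set x | x < a]) //.
by apply: open_comp => [x _|]; [exact: cf|exact: open_lt].
Qed.

Lemma open_cont_gt (R : realType) (T : topologicalType) (f : T -> R) (a : R) :
  cont f -> open [set x | a < f x].
Proof.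
move=> cf; rewrite (_ : [set x | _] = f @^-1` [set x | a < x]) //.
by apply: open_comp => [x _|]; [exact: cf|exact: open_gt].
Qed.

(** * Edges and triangles of a triangulated sphere *)

Section SphereComplex.
Variables (R : realType) (V : finType) (L : {set {set V}}).
Hypothesis sL : simplicial_complex L.
Hypothesis homL : homeomorphic (realization R L) (two_sphere R).

(** Stereographic projection from the image of [y]. Continuity of [F] is phrased for composites
    because [F] is controlled only on the realization without [y], a subspace. *)
Lemma planar_chart (y : 'rV[R]_#|V|) : realization R L y ->
  exists (F : 'rV[R]_#|V| -> R * R) (G : R * R -> 'rV[R]_#|V|),
  [/\ forall (T : topologicalType) (g : T -> 'rV[R]_#|V|) t,
        {for t, continuous g} -> (\forall z \near t, realization R L (g z)) ->
        g t <> y -> {for t, continuous (fun z => F (g z))},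
      forall x, realization R L x -> x <> y -> G (F x) = x,
      cont G &
      forall u, [/\ realization R L (G u), G u <> y & F (G u) = u]].
Proof.
move=> Ly; have [h [k [[ch ck] hk kh]]] := homL.
have [S [P [HS cP HP]]] := stereographic (proj1 (hk _ Ly)).
have hy x : realization R L x -> x <> y -> h x <> h y.
  by move=> Lx xy E; apply: xy; rewrite -(proj2 (hk _ Lx)) E (proj2 (hk _ Ly)).
exists (fun x => S (h x)); exists (fun u => k (P u)); split.
- move=> T g t cg Lg gy; have Lt := nbhs_singleton Lg.
  apply: (@continuous_comp _ _ _ (fun z => h (g z)) S).
    exact: (continuous_within_comp ch cg).
  by have [] := HS _ (proj1 (hk _ Lt)) (hy _ Lt gy).
- move=> x Lx xy; have [_ ->] := HS _ (proj1 (hk _ Lx)) (hy _ Lx xy).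
  exact: (proj2 (hk _ Lx)).
- move=> u; apply: (continuous_within_comp ck); first exact: cP.
  by apply: filterE => z; have [] := HP z.
- move=> u; have [Su Nu Eu] := HP u; have [Lu Ku] := kh _ Su.
  by split=> //; [move=> E; apply: Nu; rewrite -Ku E|rewrite Ku].
Qed.

(* Three triangles on an edge: two of them form an open disc, whose image in the
   sphere would be open although it is a limit of points of the third. *)
Lemma edge_three_triangles (p q s t u : V) : p != q ->
  [set p; q; s]%SET \in L -> [set p; q; t]%SET \in L -> [set p; q; u]%SET \in L ->
  s \notin [set p; q]%SET -> t \notin [set p; q]%SET -> u \notin [set p; q]%SET ->
  s != t -> s != u -> t != u -> False.
Proof.
rewrite !inE !negb_or => pq Ls Lt Lu /andP[sp sq] /andP[tp tq] /andP[up uq] st su tu.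
(* [z.1] moves along the edge and [z.2] across it, towards [s] or [t] according to its sign; the
   segment [e] leaves the same midpoint towards [u]. *)
pose g (z : R * R) := bary [:: (p, 1 / 2 + z.1 - `|z.2| / 2); (q, 1 / 2 - z.1 - `|z.2| / 2);
   (s, Num.max 0 z.2); (t, Num.max 0 (- z.2))].
pose e (x : R) := bary [:: (p, (1 - clip01 x) / 2); (q, (1 - clip01 x) / 2); (u, clip01 x)].
have cg : cont g by rewrite /g; bary_continuity.
have ce : cont e by rewrite /e; bary_continuity.
pose W := [set z : R * R | `|z.1| < 1 / 4 /\ `|z.2| < 1 / 4].
have gL z : W z -> realization R L (g z).
  case=> z1 z2; have z20 : 0 <= `|z.2| by [].
  have [z3|z3] := ltP z.2 0.
    apply: (bary_in sL Lt); rewrite /= ?big_cons ?big_nil /=.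
    - by move: z1; rewrite ltr_norml !le_max !lexx /=; lra.
    - by rewrite ltr0_norm // (max_l (ltW z3)) max_r; lra.
    - by rewrite (max_l (ltW z3)) !inE !eqxx ?orbT /= !implybT.
  apply: (bary_in sL Ls); rewrite /= ?big_cons ?big_nil /=.
  - by move: z1; rewrite ltr_norml !le_max !lexx /=; lra.
  - by rewrite ger0_norm // (max_r z3) max_l; lra.
  - by rewrite (@max_l _ _ 0 (- z.2)) ?oppr_le0 // !inE !eqxx ?orbT /= !implybT.
have eL x : realization R L (e x).
  have ? := clip01_ge0 x; have ? := clip01_le1 x.
  apply: (bary_in sL Lu); rewrite /= ?big_cons ?big_nil /= ?eqxx ?inE ?eqxx ?orbT ?implybT //; lra.
have gu z : g z 0 (enum_rank u) = 0.
  by rewrite baryE /= (negPf up) (negPf uq) ![u == _]eq_sym (negPf su) (negPf tu) !mulr0 !addr0.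
have eu x : e x 0 (enum_rank u) = clip01 x.
  by rewrite baryE /= (negPf up) (negPf uq) eqxx !mulr0 mulr1 !add0r addr0.
(* The centre of projection is the vertex [u], which lies on neither of the other two triangles. *)
have [F [G [cF GF _ _]]] := planar_chart (eL 1).
have clip1 : clip01 1 = 1 :> R by rewrite clip01_1.
have gN z : W z -> g z <> e 1.
  move=> Wz /(congr1 (fun x : 'rV_#|V| => x 0 (enum_rank u))).
  by rewrite gu eu clip1 => /esym/eqP; rewrite oner_eq0.
have oW : open W by apply: openI; apply: open_cont_lt; continuity.
have W0 : W (0, 0) by rewrite /W /= normr0; lra.
have Finj x y : realization R L x -> realization R L y -> x <> e 1 -> y <> e 1 ->
    F x = F y -> x = y.
  by move=> Lx Ly xN yN E; rewrite -(GF _ Lx xN) E GF.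
have ginj x y : W x -> W y -> g x = g y -> x = y.
  move=> _ _ E.
  have Ev v := congr1 (fun x : 'rV_#|V| => x 0 (enum_rank v)) E.
  have := Ev p; have := Ev q; have := Ev s; have := Ev t; rewrite !baryE /= !eqxx.
  rewrite (negPf pq) [q == p]eq_sym (negPf pq) (negPf sp) (negPf sq) (negPf tp) (negPf tq).
  rewrite (negPf st) ![_ == s]eq_sym ![_ == t]eq_sym (negPf sp) (negPf sq) (negPf tp) (negPf tq).
  rewrite [t == s]eq_sym (negPf st) !mulr0 !mulr1 !addr0 !add0r => e1 e2 e3 e4.
  rewrite [x]surjective_pairing [y]surjective_pairing; congr pair; first lra.
  move: e1 e2; clear; case: (leP 0 x.2) => ?; case: (leP 0 (- x.2)) => ?;
  case: (leP 0 y.2) => ?; case: (leP 0 (- y.2)) => ?; lra.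
have im : nbhs (F (g (0, 0))) ((fun z => F (g z)) @` W).
  apply: planar_invariance_of_domain => // [x Wx|x y Wx Wy E].
    apply: cF (cg x) _ (gN _ Wx).
    by apply: filterS (open_nbhs_nbhs (conj oW Wx)) => ? ?; exact: gL.
  apply: ginj => //; apply: Finj E; [exact: gL|exact: gL|exact: gN|exact: gN].
have e0 : e 0 = g (0, 0).
  apply: rowV_inj => v; rewrite !baryE /= clip01_0 //.
  by rewrite normr0 oppr0 maxxx; lra.
have eN x : x < 1 -> e x <> e 1.
  move=> x1 /(congr1 (fun x : 'rV_#|V| => x 0 (enum_rank u))).
  by rewrite !eu clip1 => h1; have := clip01_lt1 x1; rewrite h1 ltxx.
have ceS : {for 0, continuous (fun x => F (e x))}.
  by apply: cF (ce 0) _ (eN _ ltr01); apply: filterE => ?; exact: eL.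
rewrite -e0 in im; have := ceS _ im.
rewrite /= => /nbhs_ballP[d /= d0 Hd].
pose x := Num.min (d / 2) (1 / 2).
have x0 : 0 < x by rewrite lt_min; apply/andP; split; lra.
have x1 : x <= 1 / 2 by rewrite ge_min lexx orbT.
have xd : x <= d / 2 by rewrite ge_min lexx.
have [|z Wz E] := Hd x; first by rewrite /ball /= sub0r normrN gtr0_norm //; lra.
have /(congr1 (fun y : 'rV_#|V| => y 0 (enum_rank u))) : g z = e x.
  by apply: Finj => //; [exact: gL|exact: gN|apply: eN; lra].
by rewrite gu eu clip01_id; lra.
Qed.
End SphereComplex.

Section SphereComplexEdges.
Variables (R : realType) (V : finType) (L : {set {set V}}).
Hypothesis sL : simplicial_complex L.
Hypothesis homL : homeomorphic (realization R L) (two_sphere R).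

Lemma realization_support (x : 'rV[R]_#|V|) (p q : V) (F : {set V}) :
  (forall X : {set V}, X \in L -> p \in X -> q \in X -> X \subset F) ->
  realization R L x -> x 0 (enum_rank p) != 0 -> x 0 (enum_rank q) != 0 ->
  forall v, v \notin F -> x 0 (enum_rank v) = 0.
Proof.
move=> H [_ _ xL] xp xq v vF; apply/eqP; apply: contraNT vF => xv.
by have := H _ xL; rewrite !inE => /(_ xp xq)/fintype.subsetP; apply; rewrite inE.
Qed.

(* The points of the sphere near an edge contained in one triangle only would
   map injectively and continuously onto a half disc. *)
Lemma edge_one_triangle (p q s : V) : p != q -> s \notin [set p; q]%SET ->
  [set p; q; s]%SET \in L ->
  (forall X : {set V}, X \in L -> p \in X -> q \in X -> X \subset [set p; q; s]%SET) ->
  False.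
Proof.
rewrite !inE !negb_or => pq /andP[sp sq] Ls H.
pose x0 : 'rV[R]_#|V| := bary [:: (p, 1 / 2); (q, 1 / 2)].
pose y : 'rV[R]_#|V| := bary [:: (s, 1)].
have Lx0 : realization R L x0.
  by apply: (bary_in sL Ls); rewrite /= ?big_cons ?big_nil /= ?eqxx ?inE ?eqxx ?orbT ?implybT //; lra.
have Ly : realization R L y.
  by apply: (bary_in sL Ls); rewrite /= ?big_cons ?big_nil /= ?eqxx ?inE ?eqxx ?orbT ?implybT //; lra.
have x0p : x0 0 (enum_rank p) = 1 / 2 by rewrite baryE /= eqxx (negPf pq) mulr0 mulr1 !addr0.
have x0q : x0 0 (enum_rank q) = 1 / 2 by rewrite baryE /= eqxx [q == p]eq_sym (negPf pq) mulr0 mulr1 add0r addr0.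
have x0s : x0 0 (enum_rank s) = 0 by rewrite baryE /= (negPf sp) (negPf sq) !mulr0 !addr0.
have xy : x0 <> y.
  move=> /(congr1 (fun x : 'rV_#|V| => x 0 (enum_rank s))).
  by rewrite x0s baryE /= eqxx mulr1 addr0 => /esym/eqP; rewrite oner_eq0.
have [F [G [cF GF cG FG]]] := planar_chart homL Ly.
pose W := [set u | 0 < G u 0 (enum_rank p) /\ 0 < G u 0 (enum_rank q)].
have oW : open W by apply: openI; apply: open_cont_gt; continuity.
have G0 : G (F x0) = x0 by rewrite GF.
have zero u v : W u -> v \notin [set p; q; s]%SET -> G u 0 (enum_rank v) = 0.
  move=> [up uq]; have [Lu _ _] := FG u.
  by apply: (realization_support H Lu); rewrite gt_eqF.
have qE u : W u -> G u 0 (enum_rank q) = 1 - G u 0 (enum_rank p) - G u 0 (enum_rank s).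
  move=> Wu; have [[_ + _] _ _] := FG u; rewrite sum_enum_rank.
  rewrite (bigD1 p) //= (bigD1 q) 1?eq_sym //= (bigD1 s) ?sp ?sq //= big1; last first.
    by move=> v /andP[/andP[vp vq] vs]; apply: zero => //; rewrite !inE !negb_or vp vq.
  lra.
(* Two coordinates determine a point of the triangle. An open image around [(1 / 2, 0)] would
   contain points with negative coordinate at [s]. *)
have im : nbhs ((1 / 2, 0) : R * R) ((fun u => (G u 0 (enum_rank p), G u 0 (enum_rank s))) @` W).
  have -> : (1 / 2, 0) = (G (F x0) 0 (enum_rank p), G (F x0) 0 (enum_rank s)).
    by rewrite G0 x0p x0s.
  apply: (@planar_invariance_of_domain _ W (fun u => (G u 0 (enum_rank p), G u 0 (enum_rank s)))) => //.
  - have c : cont (fun u => (G u 0 (enum_rank p), G u 0 (enum_rank s))) by continuity.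
    by move=> u _; exact: c.
  - move=> u u' Wu Wu' [ep es].
    have [_ _ <-] := FG u; have [_ _ <-] := FG u'; congr F; apply: rowV_inj => v.
    have [->|vp] := eqVneq v p; first exact: ep.
    have [->|vs] := eqVneq v s; first exact: es.
    have [->|vq] := eqVneq v q; first by rewrite !qE // ep es.
    by rewrite !zero // !inE !negb_or vp vq.
  - by rewrite /W /= G0 x0p x0q; lra.
have /nbhs_ballP[d /= d0 Hd] := im.
have [|u Wu [_ es]] := Hd (1 / 2, - (d / 2)).
  by split; rewrite /ball /= ?subrr ?normr0 // sub0r opprK gtr0_norm; lra.
have [[+ _ _] _ _] := FG u; move=> /(_ (enum_rank s)); rewrite es; lra.
Qed.

Lemma cont_bigsum (T : topologicalType) (I : finType) (P : pred I) (f : I -> T -> R) :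
  (forall i, cont (f i)) -> cont (fun x => \sum_(i | P i) f i x).
Proof.
move=> cf; elim: (index_enum I) => [|i r IH].
  by rewrite (_ : (fun x => _) = fun=> 0); [exact: cont_cst|apply/funext => x; rewrite big_nil].
rewrite (_ : (fun x => _) = fun x => (if P i then f i x else 0) + \sum_(j <- r | P j) f j x).
  by apply: cont_add => //; case: (P i); [exact: cf|exact: cont_cst].
by apply/funext => x; rewrite big_cons; case: (P i); rewrite // add0r.
Qed.

Lemma cont_bigprod (T : topologicalType) (I : finType) (P : pred I) (f : I -> T -> R) :
  (forall i, cont (f i)) -> cont (fun x => \prod_(i | P i) f i x).
Proof.
move=> cf; elim: (index_enum I) => [|i r IH].
  by rewrite (_ : (fun x => _) = fun=> 1); [exact: cont_cst|apply/funext => x; rewrite big_nil].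
rewrite (_ : (fun x => _) = fun x => (if P i then f i x else 1) * \prod_(j <- r | P j) f j x).
  by apply: cont_mul => //; case: (P i); [exact: cf|exact: cont_cst].
by apply/funext => x; rewrite big_cons; case: (P i); rewrite // mul1r.
Qed.

(** Not a metric distance, but a continuous function whose zeros in the realization are the points
    of the simplices in [K]: each factor is the weight outside [Z]. *)
Definition distance_to (K : {set {set V}}) (x : 'rV[R]_#|V|) : R :=
  \prod_(Z in K) \sum_(v | v \notin Z) `|x 0 (enum_rank v)|.

Lemma cont_distance_to K : cont (distance_to K).
Proof. by apply: cont_bigprod => Z; apply: cont_bigsum => v; continuity. Qed.

Lemma distance_to_ge0 K x : 0 <= distance_to K x.
Proof. by apply: prodr_ge0 => Z _; apply: sumr_ge0 => v _. Qed.

Lemma distance_to_eq0 K x :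
  distance_to K x = 0 <->
  exists2 Z, Z \in K & finset (fun v => x 0 (enum_rank v) != 0) \subset Z.
Proof.
split=> [/eqP/prodf_eq0[Z ZK]|[Z ZK /fintype.subsetP HZ]].
  rewrite psumr_eq0 // => /allP H; exists Z => //.
  apply/fintype.subsetP => v; rewrite inE; apply: contraR => vZ.
  by have := H v (mem_index_enum v); rewrite vZ /= normr_eq0.
apply/eqP/prodf_eq0; exists Z => //; rewrite big1 // => v vZ.
by apply/eqP; rewrite normr_eq0; apply: contraNT vZ => xv; apply: HZ; rewrite inE.
Qed.

Hypothesis pureL : forall X, X \in L -> exists Z, [/\ Z \in L, X \subset Z & #|Z| = 3%N].

(* The unions of the triangles of [K] and of the other triangles meet in
   finitely many points, which cannot separate the sphere: among sufficiently
   many parallel segments between the two parts, one avoids these points. *)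
Lemma strongly_connected (K : {set {set V}}) (Z0 Z1 : {set V}) :
  (forall Z, Z \in K -> Z \in L /\ #|Z| = 3%N) ->
  (forall Z Z', Z \in K -> Z' \in L -> #|Z'| = 3%N -> #|Z :&: Z'| = 2%N -> Z' \in K) ->
  Z0 \in K -> Z1 \in L -> #|Z1| = 3%N -> Z1 \in K.
Proof.
move=> KL Kadj KZ0 LZ1 Z1c; apply/negPn/negP => KZ1.
pose K' := finset (fun Z : {set V} => [&& Z \in L, #|Z| == 3%N & Z \notin K]).
have cover x : realization R L x -> distance_to K x * distance_to K' x = 0.
  move=> [_ _ /pureL[Z [LZ sZ cZ]]]; apply/eqP; rewrite mulf_eq0; apply/orP.
  have [ZK|ZK] := boolP (Z \in K); [left|right]; apply/eqP/distance_to_eq0; exists Z => //.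
  by rewrite inE LZ cZ eqxx.
have meet x : realization R L x -> distance_to K x = 0 -> distance_to K' x = 0 ->
    exists v, x = bary [:: (v, 1)].
  move=> [x0 x1 xL] /distance_to_eq0[Z ZK sZ] /distance_to_eq0[Z' + sZ'].
  rewrite inE => /and3P[LZ' /eqP cZ' nZ'K].
  have cI : (#|Z :&: Z'| <= 1)%N.
    rewrite leqNgt; apply/negP => c2; move: nZ'K.
    have [LZ cZ] := KL _ ZK.
    have : (#|Z :&: Z'| <= 3)%N by rewrite -cZ subset_leq_card // subsetIl.
    rewrite leq_eqVlt => /orP[/eqP c3|c3]; last first.
      by rewrite (Kadj Z) //; apply/eqP; rewrite eqn_leq c2 andbT -ltnS.
    have e1 : Z :&: Z' = Z by apply/eqP; rewrite eqEcard subsetIl cZ c3.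
    have e2 : Z :&: Z' = Z' by apply/eqP; rewrite eqEcard subsetIr cZ' c3.
    by rewrite -e2 e1 ZK.
  pose S := finset (fun v : V => x 0 (enum_rank v) != 0).
  have cS : (#|S| <= 1)%N.
    by apply: leq_trans cI; apply: subset_leq_card; rewrite finset.subsetI sZ.
  have [v vS] : exists v, v \in S.
    apply/set0Pn; apply/negP => /eqP S0.
    move: x1; rewrite sum_enum_rank big1 => [/esym/eqP|v _]; first by rewrite oner_eq0.
    by apply/eqP/negPn/negP => xv; have : v \in S; [rewrite inE|rewrite S0 inE].
  have zero u : u != v -> x 0 (enum_rank u) = 0.
    move=> uv; apply/eqP/negPn/negP => xu.
    have : (#|[set u; v]%SET| <= #|S|)%N.
      by apply: subset_leq_card; apply/fintype.subsetP => w; rewrite !inE => /orP[/eqP->//|/eqP->]; move: vS; rewrite inE.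
    by rewrite cards2 uv /= => /leq_trans/(_ cS).
  exists v; apply: rowV_inj => u; rewrite baryE /= addr0 mul1r.
  have [->|uv] := eqVneq u v; last by rewrite zero.
  by move: x1; rewrite sum_enum_rank (bigD1 v) //= big1 ?addr0 // => w /zero.
have center (Z : {set V}) : Z \in L -> #|Z| = 3%N -> exists2 x, realization R L x &
    (finset (fun v => x 0 (enum_rank v) != 0) = Z).
  move=> LZ cZ; pose x : 'rV[R]_#|V| := \row_i (if enum_val i \in Z then 1 / 3 else 0).
  have xE v : x 0 (enum_rank v) = if v \in Z then 1 / 3 else 0 by rewrite mxE enum_rankK.
  have Sx : finset (fun v => x 0 (enum_rank v) != 0) = Z.
    apply/finset.setP => v; rewrite inE xE; case: (v \in Z); last by rewrite eqxx.
    by rewrite gt_eqF //; lra.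
  exists x => //; split; last by rewrite Sx.
    by move=> i; rewrite mxE; case: ifP => _ //; lra.
  rewrite sum_enum_rank (eq_bigr _ (fun v _ => xE v)) -big_mkcond /= sumr_const cZ.
  by rewrite -mulr_natr; lra.
have [LZ0 Z0c] := KL _ KZ0.
have [xa La Sa] := center _ LZ0 Z0c.
have [xb Lb Sb] := center _ LZ1 Z1c.
have [v0 v0Z] : exists v, v \in Z0 by apply/set0Pn; rewrite -cards_eq0 Z0c.
(* Projecting from a vertex keeps the barycentres [xa] and [xb], supported on three vertices, in the
   domain. *)
pose y : 'rV[R]_#|V| := bary [:: (v0, 1)].
have Ly : realization R L y.
  apply: (bary_in sL LZ0); rewrite /= ?big_cons ?big_nil /= ?v0Z ?implybT //; lra.
have Sy : finset (fun v => y 0 (enum_rank v) != 0) = [set v0]%SET.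
  apply/finset.setP => v; rewrite !inE baryE /= addr0 mul1r.
  by case: (v == v0); rewrite ?oner_eq0 ?eqxx.
have neq : forall (x : 'rV[R]_#|V|) (Z : {set V}), #|Z| = 3%N -> finset (fun v => x 0 (enum_rank v) != 0) = Z -> x <> y.
  by move=> x Z cZ Sx E; move: cZ; rewrite -Sx E Sy cards1.
have [F [G [cF GF cG FG]]] := planar_chart homL Ly.
have cA : cont (distance_to K) := @cont_distance_to K.
have cB : cont (distance_to K') := @cont_distance_to K'.
pose A u := distance_to K (G u); pose B u := distance_to K' (G u).
have cAG : cont A by rewrite /A; continuity.
have cBG : cont B by rewrite /B; continuity.
pose a := F xa; pose b := F xb.
have Ba : 0 < B a.
  rewrite lt_neqAle distance_to_ge0 andbT eq_sym; apply/eqP => /distance_to_eq0[Z].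
  rewrite /a GF //; last exact: neq _ _ Z0c Sa.
  rewrite Sa inE => /and3P[LZ /eqP cZ nZ] sZ.
  have E : Z0 = Z by apply/eqP; rewrite eqEcard sZ cZ Z0c.
  by rewrite -E KZ0 in nZ.
have Ab : 0 < A b.
  rewrite lt_neqAle distance_to_ge0 andbT eq_sym; apply/eqP => /distance_to_eq0[Z].
  rewrite /b GF //; last exact: neq _ _ Z1c Sb.
  rewrite Sb => ZK sZ; have [LZ cZ] := KL _ ZK.
  have E : Z1 = Z by apply/eqP; rewrite eqEcard sZ cZ Z1c.
  by rewrite E ZK in KZ1.
have AB u : A u * B u = 0 by apply: cover; have [] := FG u.
pose d1 := b.1 - a.1; pose d2 := b.2 - a.2.
(* The line from [a] to [b], shifted by [t] times the normal vector. *)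
pose P (t c : R) : R * R := (a.1 - t * d2 + c * d1, a.2 + t * d1 + c * d2).
have Pa : P 0 0 = a by rewrite /P [RHS]surjective_pairing; congr pair; ring.
have Pb : P 0 1 = b by rewrite /P [RHS]surjective_pairing /d1 /d2; congr pair; ring.
have cPt c : cont (fun t => P t c) by rewrite /P; continuity.
have cPc t : cont (fun c => P t c) by rewrite /P; continuity.
have near0 : \forall t \near (0 : R), 0 < B (P t 0) /\ 0 < A (P t 1).
  have c1 : cont (fun t => B (P t 0)) by move: (cPt 0) => ?; continuity.
  have c2 : cont (fun t => A (P t 1)) by move: (cPt 1) => ?; continuity.
  have o1 := @open_cont_gt _ _ _ 0 c1; have o2 := @open_cont_gt _ _ _ 0 c2.
  apply: (open_nbhs_nbhs (conj (openI o1 o2) _)).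
  by split; rewrite /= ?Pa ?Pb.
have /nbhs_ballP[e /= e0 He] := near0.
(* One line more than there are vertices: each will meet a vertex, so two distinct parallel lines
   would meet the same one. *)
pose N := #|V|.+1.
pose t (i : 'I_N) : R := e * (i%:R / N.+1%:R).
have Hc (i : 'I_N) : exists cv : R * V, G (P (t i) cv.1) = bary [:: (cv.2, 1)].
  have t0 : 0 <= t i by rewrite /t mulr_ge0 ?divr_ge0 // ltW.
  have te : t i < e.
    rewrite /t gtr_pMr // ltr_pdivrMr ?ltr0n // mul1r ltr_nat.
    exact: leq_trans (ltn_ord i) (leqnSn _).
  have [|Bt At] := He (t i); first by rewrite /ball /= sub0r normrN ger0_norm.
  have AB0 u : 0 < A u -> B u = 0.
    by move=> Au; have /eqP := AB u; rewrite mulf_eq0 gt_eqF //= => /eqP.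
  have BA0 u : 0 < B u -> A u = 0.
    by move=> Bu; have /eqP := AB u; rewrite mulf_eq0 (gt_eqF Bu) orbF => /eqP.
  (* Its sign changes between 0 and 1. At a zero, [A = B] and [A B = 0] make both vanish, and [meet]
     provides the vertex. *)
  pose phi c := A (P (t i) c) - B (P (t i) c).
  have cphi : cont phi by rewrite /phi; move: (cPc (t i)) => ?; continuity.
  have [|c _ phi0] := @IVT R phi 0 1 0 ler01 (continuous_subspaceT cphi).
    rewrite /phi (BA0 _ Bt) (AB0 _ At) sub0r subr0 ge_min le_max oppr_le0 (ltW Bt) /=.
    by rewrite (ltW At) orbT.
  have [Lc _ _] := FG (P (t i) c).
  have := AB (P (t i) c); move: phi0; rewrite /phi => /eqP; rewrite subr_eq0 => /eqP E.
  move/eqP; rewrite E mulf_eq0 orbb => /eqP B0.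
  have [v Hv] := meet _ Lc (etrans E B0) B0.
  by exists (c, v).
have [g Hg] := choice Hc.
have ginj : injective (fun i => (g i).2).
  move=> i j E; have := Hg i; rewrite E -Hg => /(congr1 F).
  have [_ _ ->] := FG (P (t i) (g i).1); have [_ _ ->] := FG (P (t j) (g j).1).
  rewrite /P => -[E1 E2].
  have ab : d1 * d1 + d2 * d2 != 0.
    rewrite -!expr2; apply/negP => /eqP d0.
    have := sqr_ge0 d1; have := sqr_ge0 d2 => h2 h1.
    have z1 : d1 = 0 by apply/eqP; rewrite -sqrf_eq0; apply/eqP; lra.
    have z2 : d2 = 0 by apply/eqP; rewrite -sqrf_eq0; apply/eqP; lra.
    have E' : a = b.
      by rewrite [a]surjective_pairing [b]surjective_pairing; congr pair; [move: z1|move: z2]; rewrite /d1 /d2; lra.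
    by move: Ab (AB a); rewrite -E' => Aa /eqP; rewrite mulf_eq0 !gt_eqF.
  have : (t i - t j) * (d1 * d1 + d2 * d2) = 0.
    rewrite (_ : _ * _ = d1 * ((a.2 + t i * d1 + (g i).1 * d2) - (a.2 + t j * d1 + (g j).1 * d2))
      - d2 * ((a.1 - t i * d2 + (g i).1 * d1) - (a.1 - t j * d2 + (g j).1 * d1))); last by ring.
    by rewrite E1 E2 !subrr !mulr0 subr0.
  move/eqP; rewrite mulf_eq0 (negPf ab) orbF subr_eq0 => /eqP.
  move/(mulfI (lt0r_neq0 e0)) => /(mulIf _); rewrite invr_eq0 pnatr_eq0 => /(_ isT) /eqP.
  by rewrite eqr_nat => /eqP; exact: val_inj.
have := leq_card _ ginj; rewrite card_ord ltnn //.
Qed.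
End SphereComplexEdges.

(** * Crossing curves in a triangulated 2-sphere *)

Definition tent (R : realType) (x : R) : R := Num.max 0 (1 - `|x|).

Lemma tent_pos (R : realType) (x : R) : 0 <= x <= 1 -> tent x = 1 - x.
Proof. by move=> /andP[x0 x1]; rewrite /tent ger0_norm // max_r //; lra. Qed.

Lemma tent_neg (R : realType) (x : R) : -1 <= x <= 0 -> tent x = 1 + x.
Proof. by move=> /andP[x0 x1]; rewrite /tent ler0_norm // max_r //; lra. Qed.

Lemma tent_left (R : realType) (x : R) : x <= -1 -> tent x = 0.
Proof. by move=> x0; rewrite /tent ler0_norm ?max_l //; lra. Qed.

Lemma tent_right (R : realType) (x : R) : 1 <= x -> tent x = 0.
Proof. by move=> x0; rewrite /tent ger0_norm ?max_l //; lra. Qed.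

(** Half of this trapezoid, half of the hat [loop_s] and [loop_a] are the barycentric weights of the
    loop with parameter in [-2, 2], which has its corners at the integers. Replacing [y] by [- y]
    exchanges [q] with [p] and [s] with [t]. *)
Definition loop_q (R : realType) (y : R) : R :=
  Num.max 0 (Num.min 1 (Num.min (2 - y) (1 + y))).

Definition loop_s (R : realType) (y : R) : R := Num.max 0 (Num.min y (2 - y)).

Definition loop_a (R : realType) (y : R) : R := Num.max 0 (`|y| - 1).

Lemma loop_qE (R : realType) (y : R) :
  [\/ y <= -1 /\ loop_q y = 0, -1 <= y <= 0 /\ loop_q y = 1 + y,
      0 <= y <= 1 /\ loop_q y = 1 | (1 <= y <= 2 /\ loop_q y = 2 - y) \/ (2 <= y /\ loop_q y = 0)].
Proof.
rewrite /loop_q; have [y1|y1] := leP y (1 / 2).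
  rewrite (@min_r _ _ (2 - y)); last lra.
  have [y0|y0] := leP 0 y.
    by constructor 3; split; [lra|rewrite min_l ?max_r //; lra].
  rewrite min_r; last lra.
  have [y2|y2] := leP y (-1); [constructor 1|constructor 2]; (split; first lra).
    by rewrite max_l //; lra.
  by rewrite max_r //; lra.
rewrite (@min_l _ _ (2 - y)); last lra.
have [y0|y0] := leP y 1.
  by constructor 3; split; [lra|rewrite min_l ?max_r //; lra].
rewrite min_r; last lra.
have [y2|y2] := leP y 2; constructor 4; [left|right]; (split; first lra).
  by rewrite max_r //; lra.
by rewrite max_l //; lra.
Qed.

Lemma loop_sE (R : realType) (y : R) :
  [\/ y <= 0 /\ loop_s y = 0, 0 <= y <= 1 /\ loop_s y = y,
      1 <= y <= 2 /\ loop_s y = 2 - y | 2 <= y /\ loop_s y = 0].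
Proof.
rewrite /loop_s; have [y1|y1] := leP y 1.
  rewrite min_l; last lra.
  have [y0|y0] := leP y 0; [constructor 1|constructor 2]; (split; first lra); lra.
rewrite min_r; last lra.
have [y2|y2] := leP y 2; [constructor 3|constructor 4]; (split; first lra).
  by rewrite max_r //; lra.
by rewrite max_l //; lra.
Qed.

Lemma loop_s_le0 (R : realType) (y : R) : y <= 0 -> loop_s y = 0.
Proof. by move=> y0; case: (loop_sE y) => [[? ->]|[? ->]|[? ->]|[? ->]]; lra. Qed.

Lemma loop_s_id (R : realType) (y : R) : 0 <= y <= 1 -> loop_s y = y.
Proof. by move=> y0; case: (loop_sE y) => [[? ->]|[? ->]|[? ->]|[? ->]]; lra. Qed.

(** [y] and [- (t * y)] lie on different sides of 0, and [loop_s] vanishes on the negative side. *)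
Lemma loop_s_reverse (R : realType) (t y : R) : 0 <= t <= 1 -> - (1 / 4) <= y <= 1 / 4 ->
  loop_s (- (t * y)) = loop_s y -> loop_s (- - (t * y)) = loop_s (- y) -> y = 0.
Proof.
move=> t01 y1; have [y2|y2] := leP 0 y => e1 e2.
  have hy : 0 <= t * y by apply: mulr_ge0; lra.
  by move: e1; rewrite loop_s_le0 ?loop_s_id; lra.
have hy : t * y <= 0 by apply: mulr_ge0_le0; lra.
by move: e2; rewrite opprK loop_s_le0 ?loop_s_id; lra.
Qed.

Lemma loop_ends (R : realType) :
  [/\ loop_q (- 2) = 0 :> R, loop_q 2 = 0 :> R, loop_s (- 2) = 0 :> R & loop_s 2 = 0 :> R].
Proof.
split.
- by case: (loop_qE (- 2 : R)) => [[? ->]|[? ->]|[? ->]|[[? ->]|[? ->]]]; lra.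
- by case: (loop_qE (2 : R)) => [[? ->]|[? ->]|[? ->]|[[? ->]|[? ->]]]; lra.
- by apply: loop_s_le0; lra.
- by case: (loop_sE (2 : R)) => [[? ->]|[? ->]|[? ->]|[? ->]]; lra.
Qed.

Lemma loop_aE (R : realType) (y : R) :
  [\/ -1 <= y <= 1 /\ loop_a y = 0, 1 <= y /\ loop_a y = y - 1 |
      y <= -1 /\ loop_a y = - y - 1].
Proof.
rewrite /loop_a; have [y0|y0] := leP 0 y.
  rewrite ger0_norm //; have [y1|y1] := leP y 1; [constructor 1|constructor 2]; (split; first lra).
    by rewrite max_l //; lra.
  by rewrite max_r //; lra.
rewrite ltr0_norm //; have [y1|y1] := leP (-1) y; [constructor 1|constructor 3]; (split; first lra).
  by rewrite max_l //; lra.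
by rewrite max_r //; lra.
Qed.

(** The hats are centred at the parameters of the corners: [q] at -1/2, [p] at 1/2, [u] at 3/2, [w]
    at -3/2, modulo 4. The ends -2 and 2 halve the edge [u w]; the last case covers both halves,
    with [z] the weight of [u]. *)
Lemma path_point_values (R : realType) (x : R) : -2 <= x <= 2 ->
  [\/ [/\ - (1 / 2) <= x <= 1 / 2, tent (x + 1 / 2) = 1 / 2 - x, tent (x - 1 / 2) = 1 / 2 + x,
          tent (x - 3 / 2) + tent (x + 5 / 2) = 0 & tent (x + 3 / 2) + tent (x - 5 / 2) = 0],
      [/\ 1 / 2 <= x <= 3 / 2, tent (x + 1 / 2) = 0, tent (x - 1 / 2) = 3 / 2 - x,
          tent (x - 3 / 2) + tent (x + 5 / 2) = x - 1 / 2 & tent (x + 3 / 2) + tent (x - 5 / 2) = 0],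
      [/\ - (3 / 2) <= x <= - (1 / 2), tent (x + 1 / 2) = x + 3 / 2, tent (x - 1 / 2) = 0,
          tent (x - 3 / 2) + tent (x + 5 / 2) = 0 &
          tent (x + 3 / 2) + tent (x - 5 / 2) = - (1 / 2) - x] |
      exists z, [/\ 0 <= z <= 1 /\ (x <= - (3 / 2) \/ 3 / 2 <= x),
          tent (x + 1 / 2) = 0, tent (x - 1 / 2) = 0,
          tent (x - 3 / 2) + tent (x + 5 / 2) = z & tent (x + 3 / 2) + tent (x - 5 / 2) = 1 - z]].
Proof.
move=> x2; have [x0|x0] := leP x (- (3 / 2)).
  constructor 4; exists (- x - 3 / 2); split; first by split; lra.
  - by rewrite tent_left //; lra.
  - by rewrite tent_left //; lra.
  - by rewrite tent_left ?tent_pos //; lra.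
  - by rewrite tent_neg ?tent_left //; lra.
have [x1|x1] := leP x (- (1 / 2)).
  constructor 3; split; first lra.
  - by rewrite tent_neg //; lra.
  - by rewrite tent_left //; lra.
  - by rewrite tent_left ?tent_right //; lra.
  - by rewrite tent_pos ?tent_left //; lra.
have [x3|x3] := leP x (1 / 2).
  constructor 1; split; first lra.
  - by rewrite tent_pos //; lra.
  - by rewrite tent_neg //; lra.
  - by rewrite tent_left ?tent_right //; lra.
  - by rewrite tent_right ?tent_left //; lra.
have [x4|x4] := leP x (3 / 2).
  constructor 2; split; first lra.
  - by rewrite tent_right //; lra.
  - by rewrite tent_pos //; lra.
  - by rewrite tent_neg ?tent_right //; lra.
  - by rewrite tent_right ?tent_left //; lra.
constructor 4; exists (5 / 2 - x); split; first by split; lra.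
- by rewrite tent_right //; lra.
- by rewrite tent_right //; lra.
- by rewrite tent_pos ?tent_right //; lra.
- by rewrite tent_right ?tent_neg //; lra.
Qed.

Lemma loop_point_values (R : realType) (y : R) : -2 <= y <= 2 ->
  [\/ [/\ 0 <= y <= 1, loop_q y = 1, loop_q (- y) = 1 - y, loop_a y = 0 & loop_s y = y /\ loop_s (- y) = 0],
      [/\ -1 <= y <= 0, loop_q y = 1 + y, loop_q (- y) = 1, loop_a y = 0 & loop_s y = 0 /\ loop_s (- y) = - y],
      [/\ 1 <= y <= 2, loop_q y = 2 - y, loop_q (- y) = 0, loop_a y = y - 1 & loop_s y = 2 - y /\ loop_s (- y) = 0] |
      [/\ -2 <= y <= -1, loop_q y = 0, loop_q (- y) = 2 + y, loop_a y = - y - 1 & loop_s y = 0 /\ loop_s (- y) = 2 + y]].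
Proof.
have half (z : R) : 0 <= z <= 2 ->
   [/\ loop_q z = Num.min 1 (2 - z), loop_q (- z) = Num.max 0 (1 - z),
    loop_s z = Num.min z (2 - z) & loop_s (- z) = 0].
  move=> z0; split.
  - by case: (loop_qE z) => [[? ->]|[? ->]|[? ->]|[[? ->]|[? ->]]]; case: leP; lra.
  - by case: (loop_qE (- z)) => [[? ->]|[? ->]|[? ->]|[[? ->]|[? ->]]]; case: leP; lra.
  - by case: (loop_sE z) => [[? ->]|[? ->]|[? ->]|[? ->]]; case: leP; lra.
  - by case: (loop_sE (- z)) => [[? ->]|[? ->]|[? ->]|[? ->]]; lra.
move=> y2; have [y0|y0] := leP 0 y.
  have [|-> -> -> ->] := half y; first lra.
  have [y1|y1] := leP y 1; [constructor 1|constructor 3].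
    split; [lra|by case: leP; lra|by case: leP; lra| |split=> //; by case: leP; lra].
    by case: (loop_aE y) => [[? ->]|[? ->]|[? ->]]; lra.
  split; [lra|by case: leP; lra|by case: leP; lra| |split=> //; by case: leP; lra].
  by case: (loop_aE y) => [[? ->]|[? ->]|[? ->]]; lra.
have [|] := half (- y); first lra.
rewrite opprK => -> -> -> ->.
have [y1|y1] := leP (-1) y; [constructor 2|constructor 4].
  split; [lra|by case: leP; lra|by case: leP; lra| |split=> //; by case: leP; lra].
  by case: (loop_aE y) => [[? ->]|[? ->]|[? ->]]; lra.
split; [lra|by case: leP; lra|by case: leP; lra| |split=> //; by case: leP; lra].
by case: (loop_aE y) => [[? ->]|[? ->]|[? ->]]; lra.
Qed.

Section Crossing.
Variables (R : realType) (V : finType) (L : {set {set V}}).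
Hypothesis sL : simplicial_complex L.
Hypothesis homL : homeomorphic (realization R L) (two_sphere R).
Variables p q s t a u w : V.

(* For [y = 0] this is the closed curve [q p u w], parametrized by
   [-2 <= x <= 2] with [x = 0] at the midpoint of [q p]; near this point [y]
   moves it across the edge, towards [s] for [y > 0] and [t] for [y < 0]. *)
Definition path_point (x y : R) : seq (V * R) :=
  [:: (q, tent (x + 1 / 2) - Num.max 0 (- y) / 2);
      (p, tent (x - 1 / 2) - Num.max 0 y / 2);
      (u, tent (x - 3 / 2) + tent (x + 5 / 2));
      (w, tent (x + 3 / 2) + tent (x - 5 / 2));
      (s, Num.max 0 y / 2); (t, Num.max 0 (- y) / 2)].

(* For [x = 0] this is the closed curve from [a] through the midpoints of
   [p t], [p q] and [q s] back to [a], parametrized by [-2 <= y <= 2]. *)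
Definition loop_point (x y : R) : seq (V * R) :=
  [:: (q, loop_q y / 2 - x); (p, loop_q (- y) / 2 + x); (a, loop_a y);
      (s, loop_s y / 2); (t, loop_s (- y) / 2)].

Hypothesis distinct : uniq [:: p; q; s; t; a].
Hypotheses (Lpqs : [set p; q; s]%SET \in L) (Lpqt : [set p; q; t]%SET \in L).
Hypotheses (Lqsa : [set q; s; a]%SET \in L) (Lpta : [set p; t; a]%SET \in L).
Hypotheses (Lpu : [set p; u]%SET \in L) (Luw : [set u; w]%SET \in L) (Lwq : [set w; q]%SET \in L).
Hypotheses (ua : u != a) (wa : w != a).
Hypothesis uncrossed : forall e, e \in [:: [set p; u]; [set u; w]; [set w; q]]%SET ->
  e \notin [:: [set q; s]; [set p; q]; [set p; t]]%SET.

Lemma crossing_neq : (((p == q) = false) * ((p == s) = false) * ((p == t) = false) * ((p == a) = false)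
  * ((q == p) = false) * ((q == s) = false) * ((q == t) = false) * ((q == a) = false)
  * ((s == p) = false) * ((s == q) = false) * ((s == t) = false) * ((s == a) = false)
  * ((t == p) = false) * ((t == q) = false) * ((t == s) = false) * ((t == a) = false)
  * ((a == p) = false) * ((a == q) = false) * ((a == s) = false) * ((a == t) = false))%type.
Proof.
move: distinct; rewrite /= !inE !negb_or !andbT.
move=> /andP[/and4P[h1 h2 h3 h4] /andP[/and3P[h5 h6 h7] /andP[/andP[h8 h9] h10]]].
by do !split; apply/negP => /eqP E; move: h1 h2 h3 h4 h5 h6 h7 h8 h9 h10; rewrite E eqxx //= ?andbF.
Qed.

Lemma loop_coord (x y : R) :
  [/\ coord q (loop_point x y) = loop_q y / 2 - x, coord p (loop_point x y) = loop_q (- y) / 2 + x,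
      coord a (loop_point x y) = loop_a y, coord s (loop_point x y) = loop_s y / 2 &
      coord t (loop_point x y) = loop_s (- y) / 2].
Proof. by split; rewrite /= !eqxx !crossing_neq !mulr0 !mulr1 ?addr0 ?add0r. Qed.

(** Except at the midpoints of the three edges, a point of the loop has three positive coordinates
    or a positive one at [a]. *)
Lemma loop_support (y : R) (e : {set V}) : -2 <= y <= 2 -> a \notin e -> (#|e| <= 2)%N ->
  (forall v, v \notin e -> coord v (loop_point 0 y) = 0) ->
  [\/ e = [set q; s]%SET, e = [set p; t]%SET | e = [set p; q]%SET /\ y = 0].
Proof.
move=> y2 ae ce H; have [Cq Cp Ca Cs Ct] := loop_coord 0 y.
have M v : coord v (loop_point 0 y) != 0 -> v \in e by apply: contraR => /H ->.
have E x z : x != z -> x \in e -> z \in e -> e = [set x; z]%SET.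
  move=> xz xe ze; apply/esym/eqP; rewrite eqEcard cards2 xz ce andbT.
  by apply/fintype.subsetP => r; rewrite !inE => /orP[]/eqP ->.
have T x x' z : x != x' -> x != z -> x' != z -> x \in e -> x' \in e -> z \in e -> False.
  move=> xy xz yz xe ye; rewrite (E x x') // !inE ![z == _]eq_sym.
  by rewrite (negPf xz) (negPf yz).
have a0 : loop_a y = 0 by rewrite -Ca H.
have lq1 : loop_q 1 = 1 :> R by case: (loop_qE (1 : R)) => [[? ->]|[? ->]|[? ->]|[[? ->]|[? ->]]]; lra.
have ls1 : loop_s 1 = 1 :> R by apply: loop_s_id; rewrite ler01 lexx.
case: (loop_point_values y2) => [[y1 hq hp _ [hs ht]]|[y1 hq hp _ [hs ht]]|[y1 _ _ ha _]|[y1 _ _ ha _]].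
- have qe : q \in e by apply: M; rewrite Cq hq; lra.
  have [y0|y0] := eqVneq y 0.
    constructor 3; split=> //; apply: E; rewrite ?crossing_neq //.
    by apply: M; rewrite Cp hp; lra.
  have se : s \in e by apply: M; rewrite Cs hs; lra.
  have [y11|y11] := eqVneq y 1; first by constructor 1; apply: E; rewrite ?crossing_neq.
  have pe : p \in e by apply: M; rewrite Cp hp; lra.
  by case: (T p q s); rewrite ?crossing_neq.
- have pe : p \in e by apply: M; rewrite Cp hp; lra.
  have [y0|y0] := eqVneq y 0.
    constructor 3; split=> //; apply: E; rewrite ?crossing_neq //.
    by apply: M; rewrite Cq hq; lra.
  have te : t \in e by apply: M; rewrite Ct ht; lra.
  have [y11|y11] := eqVneq y (-1); first by constructor 2; apply: E; rewrite ?crossing_neq.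
  have qe : q \in e by apply: M; rewrite Cq hq; lra.
  by case: (T p q t); rewrite ?crossing_neq.
- have y11 : y = 1 by lra.
  rewrite y11 in Cq Cs; constructor 1; apply: E; rewrite ?crossing_neq //.
    by apply: M; rewrite y11 Cq lq1; lra.
  by apply: M; rewrite y11 Cs ls1; lra.
- have y11 : y = -1 by lra.
  rewrite y11 opprK in Cp Ct; constructor 2; apply: E; rewrite ?crossing_neq //.
    by apply: M; rewrite y11 Cp lq1; lra.
  by apply: M; rewrite y11 Ct ls1; lra.
Qed.

(** For [|y| <= 1/4] the weights of [p] and [q] are at least 3/8, which leaves room for a shift [x]
    of at most 1/4. *)
Lemma loop_point_in (x y : R) : -2 <= y <= 2 ->
  x = 0 \/ - (1 / 4) <= x <= 1 / 4 /\ - (1 / 4) <= y <= 1 / 4 ->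
  realization R L (bary (loop_point x y)).
Proof.
move=> y2 xy.
case: (loop_point_values y2) => [[y1 hq hp ha [hs ht]]|[y1 hq hp ha [hs ht]]|[y1 hq hp ha [hs ht]]|[y1 hq hp ha [hs ht]]].
- apply: (bary_in sL Lpqs); rewrite /= ?big_cons ?big_nil /= hq hp ha hs ht.
  + by do !(apply/andP; split=> //); lra.
  + by lra.
  + by rewrite !inE !eqxx ?orbT !implybT mul0r eqxx.
- apply: (bary_in sL Lpqt); rewrite /= ?big_cons ?big_nil /= hq hp ha hs ht.
  + by do !(apply/andP; split=> //); lra.
  + by lra.
  + by rewrite !inE !eqxx ?orbT !implybT mul0r eqxx.
- have x0 : x = 0 by lra.
  apply: (bary_in sL Lqsa); rewrite /= ?big_cons ?big_nil /= hq hp ha hs ht x0.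
  + by do !(apply/andP; split=> //); lra.
  + by lra.
  + by rewrite !inE !eqxx ?orbT !implybT mul0r add0r eqxx.
- have x0 : x = 0 by lra.
  apply: (bary_in sL Lpta); rewrite /= ?big_cons ?big_nil /= hq hp ha hs ht x0.
  + by do !(apply/andP; split=> //); lra.
  + by lra.
  + by rewrite !inE !eqxx ?orbT !implybT mul0r subr0 eqxx.
Qed.

Lemma path_edge (x : R) : -2 <= x <= 2 -> exists2 e : {set V}, e \in L &
  [/\ a \notin e, (#|e| <= 2)%N, forall v, v \notin e -> coord v (path_point x 0) = 0,
   realization R L (bary (path_point x 0)) &
   (e \notin [:: [set q; s]; [set p; q]; [set p; t]]%SET) \/
   (e = [set p; q]%SET /\ - (1 / 2) <= x <= 1 / 2)].
Proof.
move=> x2.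
have m0 : Num.max 0 0 = 0 :> R by rewrite maxxx.
have in1 (y z v : V) : v \notin [set y; z]%SET -> (v == y) = false.
  by rewrite !inE negb_or => /andP[/negPf].
have in2 (y z v : V) : v \notin [set y; z]%SET -> (v == z) = false.
  by rewrite !inE negb_or => /andP[_ /negPf].
have car (y z : V) : (#|[set y; z]%SET| <= 2)%N by rewrite cards2; case: (_ != _).
case: (path_point_values x2) => [[x1 hq hp hu hw]|[x1 hq hp hu hw]|[x1 hq hp hu hw]|[z [z1 hq hp hu hw]]].
- have Lpq : [set p; q]%SET \in L by apply: sL Lpqs _; rewrite finset.subsetUl.
  exists [set p; q]%SET => //; split; [by rewrite !inE !crossing_neq|exact: car| | |by right].
    move=> v ve; rewrite /= hq hp hu hw oppr0 m0.
    by rewrite (in1 _ _ _ ve) (in2 _ _ _ ve) !mulr0; lra.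
  apply: (bary_in sL Lpq); rewrite /= ?big_cons ?big_nil /= hq hp hu hw oppr0 m0.
  + by do !(apply/andP; split=> //); lra.
  + by lra.
  + by rewrite !inE !eqxx ?orbT !implybT ?mul0r eqxx.
- exists [set p; u]%SET => //; split; [by rewrite !inE !crossing_neq eq_sym|exact: car| | |by left; apply: uncrossed; rewrite !inE eqxx ?orbT].
    move=> v ve; rewrite /= hq hp hu hw oppr0 m0.
    by rewrite (in1 _ _ _ ve) (in2 _ _ _ ve) !mulr0; lra.
  apply: (bary_in sL Lpu); rewrite /= ?big_cons ?big_nil /= hq hp hu hw oppr0 m0.
  + by do !(apply/andP; split=> //); lra.
  + by lra.
  + by rewrite !inE !eqxx ?orbT !implybT ?mul0r ?subr0 eqxx.
- exists [set w; q]%SET => //; split; [by rewrite !inE !crossing_neq orbF eq_sym|exact: car| | |by left; apply: uncrossed; rewrite !inE eqxx ?orbT].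
    move=> v ve; rewrite /= hq hp hu hw oppr0 m0.
    by rewrite (in1 _ _ _ ve) (in2 _ _ _ ve) !mulr0; lra.
  apply: (bary_in sL Lwq); rewrite /= ?big_cons ?big_nil /= hq hp hu hw oppr0 m0.
  + by do !(apply/andP; split=> //); lra.
  + by lra.
  + by rewrite !inE !eqxx ?orbT !implybT ?mul0r ?subr0 eqxx.
exists [set u; w]%SET => //; split; [by rewrite !inE negb_or ![a == _]eq_sym ua|exact: car| | |by left; apply: uncrossed; rewrite !inE eqxx ?orbT].
  move=> v ve; rewrite /= hq hp hu hw oppr0 m0.
  by rewrite (in1 _ _ _ ve) (in2 _ _ _ ve) !mulr0; lra.
apply: (bary_in sL Luw); rewrite /= ?big_cons ?big_nil /= hq hp hu hw oppr0 m0.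
+ by do !(apply/andP; split=> //); lra.
+ by lra.
+ by rewrite !inE !eqxx ?orbT !implybT ?mul0r ?subr0 eqxx.
Qed.

(** Since both families coincide near the crossing, the values of the first at [(x, - y)] and of the
    second at [(- x, y)] are exchanged when [(x, y)] changes sign; their difference is odd. *)
Lemma path_loop_small (x y : R) : - (1 / 4) <= x <= 1 / 4 -> - (1 / 4) <= y <= 1 / 4 ->
  bary (path_point x y) = bary (loop_point x y).
Proof.
move=> x1 y1; apply: rowV_inj => v; rewrite !baryE /=.
have hx : -2 <= x <= 2 by lra.
case: (path_point_values hx) => [[x2 hq hp hu hw]|[x2 hq hp hu hw]|[x2 hq hp hu hw]|[z [z1 hq hp hu hw]]]; try lra.
have hy : -2 <= y <= 2 by lra.
rewrite hq hp hu hw !mul0r.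
case: (loop_point_values hy) => [[y2 lq lp ha [hs ht]]|[y2 lq lp ha [hs ht]]|[y2 lq lp ha [hs ht]]|[y2 lq lp ha [hs ht]]];
  rewrite ?lq ?lp ?ha ?hs ?ht; try lra.
  by rewrite (@max_r _ _ 0 y) ?(@max_l _ _ 0 (- y)); lra.
by rewrite (@max_l _ _ 0 y) ?(@max_r _ _ 0 (- y)); lra.
Qed.

(** The path runs along edges avoiding [a], which the loop meets in three midpoints only;
    [uncrossed] leaves just that of [p q]. *)
Lemma path_loop_disjoint (x y : R) : -2 <= x <= 2 -> -2 <= y <= 2 ->
  bary (path_point x 0) = bary (loop_point 0 y) -> x = 0 /\ y = 0.
Proof.
move=> x2 y2 E; have [e Le [ae ce He _ He']] := path_edge x2.
have [v ve|eqs|ept|[epq y0]] := @loop_support y e y2 ae ce.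
- by rewrite -baryE -E baryE He.
- case: He' => [|[E' _]]; first by rewrite eqs !inE eqxx.
  by move: E'; rewrite eqs => /finset.setP/(_ s); rewrite !inE !crossing_neq eqxx.
- case: He' => [|[E' _]]; first by rewrite ept !inE eqxx !orbT.
  by move: E'; rewrite ept => /finset.setP/(_ t); rewrite !inE !crossing_neq eqxx.
split=> //; case: He' => [|[_ x1]]; first by rewrite epq !inE eqxx orbT.
have [_ Cp _ _ _] := loop_coord 0 y.
move: (congr1 (fun z : 'rV_#|V| => z 0 (enum_rank p)) E); rewrite !baryE Cp y0 oppr0 /= !eqxx !crossing_neq ?oppr0.
have lq0 : loop_q 0 = 1 :> R by case: (loop_qE (0 : R)) => [[? ->]|[? ->]|[? ->]|[[? ->]|[? ->]]]; lra.
rewrite lq0 maxxx; case: (path_point_values x2) => [[x3 hq hp hu hw]|[x3 hq hp hu hw]|[x3 hq hp hu hw]|[z [z1 hq hp hu hw]]];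
  last lra; rewrite hq hp hu hw !mulr0 mulr1.
- by lra.
- have xE : x = 1 / 2 by lra.
  by rewrite xE; lra.
- have xE : x = - (1 / 2) by lra.
  by rewrite xE; lra.
Qed.

Lemma path_closed : bary (path_point 2 0) = bary (path_point (- 2) 0).
Proof.
apply: rowV_inj => v; rewrite !baryE /=.
rewrite (@tent_right _ (2 + 1 / 2)) ?(@tent_right _ (2 - 1 / 2)) ?(@tent_right _ (2 + 5 / 2)) ?(@tent_right _ (2 + 3 / 2)); try lra.
rewrite (@tent_left _ (-2 + 1 / 2)) ?(@tent_left _ (-2 - 1 / 2)) ?(@tent_left _ (-2 - 3 / 2)) ?(@tent_left _ (-2 - 5 / 2)); try lra.
rewrite (@tent_pos _ (2 - 3 / 2)) ?(@tent_neg _ (2 - 5 / 2)) ?(@tent_pos _ (-2 + 5 / 2)) ?(@tent_neg _ (-2 + 3 / 2)); lra.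
Qed.

Lemma loop_closed : bary (loop_point 0 (- 2)) = bary (loop_point 0 2).
Proof.
have [hN hP sN sP] := loop_ends R.
by apply: rowV_inj => v; rewrite !baryE /= !opprK hN hP sN sP /loop_a normrN.
Qed.

(* Two closed curves on a sphere cannot cross exactly once: the difference of
   their images in the plane would have no zero on the torus outside a small
   square around the crossing, but along the boundary of this square it is
   homotopic to an odd loop. *)
Lemma no_single_crossing : False.
Proof.
(* A centre of projection off both curves: it is interior to the triangle [q s a], where the points
   of the loop have equal weights at [q] and [s]. *)
pose y : 'rV[R]_#|V| := bary [:: (q, 1 / 2); (s, 1 / 4); (a, 1 / 4)].
have Ly : realization R L y.
  apply: (bary_in sL Lqsa); rewrite /= ?big_cons ?big_nil /=; [|lra|by rewrite !inE !eqxx ?orbT !implybT].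
  by do !(apply/andP; split=> //); lra.
have [F [G [cF GF _ _]]] := planar_chart homL Ly.
have yq : y 0 (enum_rank q) = 1 / 2 by rewrite baryE /= !eqxx !crossing_neq !mulr0 mulr1; lra.
have ys : y 0 (enum_rank s) = 1 / 4 by rewrite baryE /= !eqxx !crossing_neq !mulr0 mulr1; lra.
have ya : y 0 (enum_rank a) = 1 / 4 by rewrite baryE /= !eqxx !crossing_neq !mulr0 mulr1; lra.
(* Up to [r = 1/2] the square shrinks from half-width 2, where opposite sides are identified, to
   1/4, and the points stay on their curves. Then [tau] grows to 1 and moves them off the curves
   until the difference is odd. *)
pose rho (r : R) : R := 1 / 4 + 7 / 4 * clip01 (1 - 2 * r).
pose tau (r : R) : R := clip01 (2 * r - 1).
pose X (z : R * R) : R := rho z.1 * square_x z.2.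
pose Y (z : R * R) : R := rho z.1 * square_y z.2.
pose P z : 'rV[R]_#|V| := bary (path_point (X z) (- (tau z.1 * Y z))).
pose Q z : 'rV[R]_#|V| := bary (loop_point (- (tau z.1 * X z)) (Y z)).
have bnd (b c : R) : `|c| <= 1 -> 0 <= b -> - b <= b * c <= b.
  by rewrite ler_norml => /andP[c1 c2] b0; apply/andP; split; nra.
have rho2 r : 1 / 4 <= rho r <= 2.
  by have := clip01_ge0 (1 - 2 * r); have := clip01_le1 (1 - 2 * r); rewrite /rho; lra.
have X2 z : - rho z.1 <= X z <= rho z.1.
  by apply: bnd; [exact: square_wave_bound|have := rho2 z.1; lra].
have Y2 z : - rho z.1 <= Y z <= rho z.1.
  by apply: bnd; [exact: square_wave_bound|have := rho2 z.1; lra].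
have tau01 r : 0 <= tau r <= 1 by rewrite clip01_ge0 clip01_le1.
have stage r : tau r = 0 \/ rho r = 1 / 4.
  have [r1|r1] := leP (2 * r) 1; [left|right]; first by rewrite /tau clip01_0 //; lra.
  by rewrite /rho clip01_0; lra.
have small (r x : R) : rho r = 1 / 4 -> - rho r <= x <= rho r -> - (1 / 4) <= - (tau r * x) <= 1 / 4.
  by move=> -> x1; have := tau01 r => t01; apply/andP; split; nra.
have LQ z : realization R L (Q z).
  apply: loop_point_in; first by have := Y2 z; have := rho2 z.1; lra.
  case: (stage z.1) => h; first by left; rewrite h mul0r oppr0.
  by right; split; [apply: small|have := Y2 z; rewrite h].
have PE z : tau z.1 = 0 /\ P z = bary (path_point (X z) 0) \/
    rho z.1 = 1 / 4 /\ P z = bary (loop_point (X z) (- (tau z.1 * Y z))).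
  case: (stage z.1) => h; [left|right]; split=> //; first by rewrite /P h mul0r oppr0.
  by apply: path_loop_small; [have := X2 z; rewrite h|exact: small].
have LP z : realization R L (P z).
  case: (PE z) => -[h ->].
    by have [|e _ []] := @path_edge (X z); first by have := X2 z; have := rho2 z.1; lra.
  apply: loop_point_in; first by have := small _ _ h (Y2 z); lra.
  by right; split; [have := X2 z; rewrite h|exact: small].
have loop_y x c : x = 0 \/ - (1 / 4) <= c <= 1 / 4 -> -2 <= c <= 2 -> bary (loop_point x c) <> y.
  move=> xc c2 E; have [Cq Cp Ca Cs Ct] := loop_coord x c.
  move: yq ys ya; rewrite -E !baryE Cq Cs Ca.
  by case: (loop_point_values c2) => [[c1 hq hp ha [hs ht]]|[c1 hq hp ha [hs ht]]|[c1 hq hp ha [hs ht]]|[c1 hq hp ha [hs ht]]];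
    rewrite hq ha hs; lra.
have Qy z : Q z <> y.
  apply: loop_y; last by have := Y2 z; have := rho2 z.1; lra.
  by case: (stage z.1) => h; [left; rewrite h mul0r oppr0|right; have := Y2 z; rewrite h].
have Py z : P z <> y.
  case: (PE z) => -[h ->].
    have [|e _ [ae _ He _ _]] := @path_edge (X z); first by have := X2 z; have := rho2 z.1; lra.
    by move=> E; move: ya; rewrite -E baryE He //; lra.
  by have := small _ _ h (Y2 z) => ?; apply: loop_y; [right|lra].
have cX : cont X by rewrite /X /rho; continuity_loops.
have cY : cont Y by rewrite /Y /rho; continuity_loops.
have cP : cont P by rewrite /P /path_point /tent /tau; bary_continuity.
have cQ : cont Q by rewrite /Q /loop_point /loop_q /loop_s /loop_a /tau; bary_continuity.
have cFP : cont (fun z => F (P z)) by move=> z; apply: cF (cP z) _ (Py z); apply: filterE.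
have cFQ : cont (fun z => F (Q z)) by move=> z; apply: cF (cQ z) _ (Qy z); apply: filterE.
have PQ r c : 0 <= c <= 1 -> P (r, c) <> Q (r, c).
  move=> c01 E.
  suff [X0 Y0] : X (r, c) = 0 /\ Y (r, c) = 0.
    have r0 : rho r != 0 by have := rho2 r; lra.
    have sx : square_x c = 0 by apply: (mulfI r0); rewrite mulr0.
    have sy : square_y c = 0 by apply: (mulfI r0); rewrite mulr0.
    by have := square_boundary c01; rewrite sx sy normr0; lra.
  case: (PE (r, c)) => -[h PEz].
    apply: path_loop_disjoint; [by have := X2 (r, c); have := rho2 r; rewrite /=; lra|by have := Y2 (r, c); have := rho2 r; rewrite /=; lra|].
    by rewrite -PEz E /Q h mul0r oppr0.
  have [Cq Cp Ca Cs Ct] := loop_coord (X (r, c)) (- (tau r * Y (r, c))).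
  have [Dq Dp Da Ds Dt] := loop_coord (- (tau r * X (r, c))) (Y (r, c)).
  have ev v := congr1 (fun z : 'rV_#|V| => z 0 (enum_rank v)) E.
  move: (ev p) (ev s) (ev t); rewrite PEz !baryE Cp Dp Cs Ds Ct Dt.
  have := small _ _ h (Y2 (r, c)); rewrite /=.
  have := Y2 (r, c); have := X2 (r, c); rewrite h /=; have := tau01 r.
  move: (X (r, c)) (Y (r, c)) (tau r) => x0 y0 t0 t01 x1 y1 ty1 ep es et.
  have y00 : y0 = 0 by apply: (loop_s_reverse t01 y1); lra.
  split=> //; move: ep; rewrite y00 mulr0 !oppr0 => ep.
  have /eqP : (1 + t0) * x0 = 0 by lra.
  by rewrite mulf_eq0 gt_eqF /= => [/eqP|]; lra.
pose H1 z := (F (P z)).1 - (F (Q z)).1.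
pose H2 z := (F (P z)).2 - (F (Q z)).2.
apply: (@no_odd_homotopy R H1 H2).
- by change (cont H1); rewrite /H1; continuity.
- by change (cont H2); rewrite /H2; continuity.
- move=> r c _ c01; apply: contrapT => /not_orP[/negP/negPn/eqP e1 /negP/negPn/eqP e2].
  apply: (PQ r c c01); rewrite -(GF _ (LP _) (Py _)) -(GF _ (LQ _) (Qy _)); congr G.
  by rewrite [LHS]surjective_pairing [RHS]surjective_pairing; congr pair; [move: e1|move: e2]; rewrite /H1 /H2; lra.
- move=> r _; have [ex ey] := square_period R.
  by rewrite /H1 /H2 /P /Q /X /Y /= ex ey.
- move=> c c01; have [ex ey] := square_antipode c01.
  have rho1 : rho 1 = 1 / 4 by rewrite /rho clip01_0; lra.
  have tau1 : tau 1 = 1 by rewrite /tau clip01_1; lra.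
  have XN : X (1, c + 1 / 2) = - X (1, c) by rewrite /X /= ex mulrN.
  have YN : Y (1, c + 1 / 2) = - Y (1, c) by rewrite /Y /= ey mulrN.
  have hX : - (1 / 4) <= X (1, c) <= 1 / 4 by have := X2 (1, c); rewrite /= rho1.
  have hY : - (1 / 4) <= Y (1, c) <= 1 / 4 by have := Y2 (1, c); rewrite /= rho1.
  have E1 : P (1, c + 1 / 2) = Q (1, c).
    by rewrite /P /Q XN YN /= tau1 !mul1r opprK path_loop_small //; lra.
  have E2 : Q (1, c + 1 / 2) = P (1, c).
    by rewrite /P /Q XN YN /= tau1 !mul1r opprK path_loop_small //; lra.
  by rewrite /H1 /H2 E1 E2 !opprB.
- move=> c c01; have [ex ey ey'] := square_horizontal c01.
  have tau0 : tau 0 = 0 by rewrite /tau clip01_0; lra.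
  have rho0 : rho 0 = 2 by rewrite /rho clip01_1; lra.
  have E1 : P (0, c) = P (0, 3 / 4 - c) by rewrite /P /X /= tau0 !mul0r ex.
  have E2 : Q (0, c) = Q (0, 3 / 4 - c).
    by rewrite /Q /Y /= tau0 !mul0r oppr0 ey ey' rho0 mulrN mulr1 loop_closed.
  by rewrite /H1 /H2 E1 E2.
- move=> c c01; have [ey ex ex'] := square_vertical c01.
  have tau0 : tau 0 = 0 by rewrite /tau clip01_0; lra.
  have rho0 : rho 0 = 2 by rewrite /rho clip01_1; lra.
  have E1 : Q (0, c) = Q (0, 5 / 4 - c) by rewrite /Q /Y /= tau0 !mul0r ey.
  have E2 : P (0, c) = P (0, 5 / 4 - c).
    by rewrite /P /X /= tau0 !mul0r ex ex' rho0 mulrN !mulr1 oppr0 path_closed.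
  by rewrite /H1 /H2 E1 E2.
Qed.
End Crossing.

(** * Tetrahedra of triangulated 3-manifolds *)

(** A plane slice through [y0] already has an open image, which then contains values at points off
    the slice. *)
Lemma no_embedding_3_2 (R : realType) (W : set 'rV[R]_3) (c : 'rV[R]_3 -> R * R) (y0 : 'rV[R]_3) :
  open W -> W y0 -> (forall y, W y -> {for y, continuous c}) ->
  (forall y y', W y -> W y' -> c y = c y' -> y = y') -> False.
Proof.
move=> oW W0 cc inj.
pose j (z : R * R) (e : R) : 'rV[R]_3 := y0 + row3 z.1 z.2 e.
have j0 : j (0, 0) 0 = y0.
  apply/row3P; have [e0 e1 e2] := row3E (0 : R) 0 0;
  by rewrite /j mxE ?e0 ?e1 ?e2 addr0.
have cj (T : topologicalType) (g : T -> R * R) (h : T -> R) : cont g -> cont h ->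
    cont (fun t => j (g t) (h t)).
  move=> cg ch; apply: cont_row => i.
  rewrite (_ : (fun t => _) = fun t => y0 0 i +
      (if i == 0 then (g t).1 else if i == 1 then (g t).2 else h t)).
    by case: (i == 0); case: (i == 1); continuity.
  by apply/funext => t; rewrite /j /row3 !mxE.
have cj1 : cont (fun z => j z 0) by apply: (cj _ id (fun=> 0)); [exact: cont_id|exact: cont_cst].
have cj2 : cont (fun e => j (0, 0) e) by apply: (cj _ (fun=> (0, 0)) id); [exact: cont_cst|exact: cont_id].
have jinj z z' e e' : j z e = j z' e' -> z = z' /\ e = e'.
  move=> /addrI E; have [a0 a1 a2] := row3E z.1 z.2 e; have [b0 b1 b2] := row3E z'.1 z'.2 e'.
  move: a0 a1 a2; rewrite E b0 b1 b2 [z]surjective_pairing [z']surjective_pairing /=.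
  by move=> -> -> ->.
pose W' := [set z | W (j z 0)].
have oW' : open W' by apply: open_comp => // z _; exact: cj1.
have im : nbhs (c (j (0, 0) 0)) ((fun z => c (j z 0)) @` W').
  apply: (@planar_invariance_of_domain _ W' (fun z => c (j z 0))) => //.
  - by move=> z Wz; apply: (@continuous_comp _ _ _ (fun z => j z 0) c); [exact: cj1|exact: cc].
  - by move=> z z' Wz Wz' /(inj _ _ Wz Wz')/jinj[].
  - by rewrite /W' /= j0.
have c0 : {for (0 : R), continuous (fun e => c (j (0, 0) e))}.
  by apply: (@continuous_comp _ _ _ (fun e => j (0, 0) e) c); [exact: cj2|apply: cc; rewrite j0].
have n1 : nbhs (0 : R) ((fun e => c (j (0, 0) e)) @^-1` ((fun z => c (j z 0)) @` W')) := c0 _ im.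
have n2 : nbhs (0 : R) [set e | W (j (0, 0) e)].
  by apply: cj2; rewrite j0; exact: open_nbhs_nbhs.
have : nbhs (0 : R) (((fun e => c (j (0, 0) e)) @^-1` ((fun z => c (j z 0)) @` W')) `&` [set e | W (j (0, 0) e)]).
  exact: filterI.
move=> /nbhs_ballP[d /= d0 Hd].
have [|[z Wz E] We] := Hd (d / 2); first by rewrite /ball /= sub0r normrN gtr0_norm; lra.
by have [_] := jinj _ _ _ _ (inj _ _ Wz We E); lra.
Qed.

(** * Every simplex lies in a tetrahedron *)

Section Purity.
Variables (R : realType) (V : finType) (D : {set {set V}}).
Hypothesis sD : simplicial_complex D.

(** Near the barycentre of a maximal [M] all points have support [M]. As the coordinates sum to 1,
    two of them determine the point, and a chart gives an embedding excluded by
    [no_embedding_3_2]. *)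
Lemma low_simplex_not_maximal (M : {set V}) :
  topological_manifold 3 (realization R D) ->
  M \in D -> M != finset.set0 -> (#|M| <= 3)%N ->
  exists2 X, X \in D & M \proper X.
Proof.
move=> mD MD M0 M3; apply: contrapT => maxM.
have {}maxM X : X \in D -> M \subset X -> X = M.
  move=> XD MX; apply/eqP; rewrite eq_sym; apply/negPn/negP => neq; apply: maxM; exists X => //.
  by rewrite finset.properEneq neq.
(* The names may coincide, since [M] may have fewer than three vertices. *)
have [m1 [m2 [m3 [m1M m2M m3M HM]]]] : exists m1 m2 m3 : V,
    [/\ m1 \in M, m2 \in M, m3 \in M & forall v, v \in M -> [|| v == m1, v == m2 | v == m3]].
  have /set0Pn[m mM] := M0.
  have Ms : size (enum M) = #|M| by rewrite -cardE.
  exists (nth m (enum M) 0), (nth m (enum M) 1), (nth m (enum M) 2).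
  have nM i : nth m (enum M) i \in M.
    have [h|h] := ltnP i (size (enum M)); last by rewrite nth_default.
    by rewrite -mem_enum mem_nth.
  split=> // v vM; have : v \in enum M by rewrite mem_enum.
  move: M3; rewrite -Ms; case: (enum M) => [|a [|b [|c [|]]]] //= _; rewrite !inE.
  - by move=> ->.
  - by case/orP => ->; rewrite ?orbT.
  - by [].
pose x0 : 'rV[R]_#|V| := \row_i (if enum_val i \in M then (#|M|%:R)^-1 else 0).
have cM : (0 : R) < #|M|%:R by rewrite ltr0n card_gt0.
have x0E v : x0 0 (enum_rank v) = if v \in M then (#|M|%:R)^-1 else 0 by rewrite mxE enum_rankK.
have Lx0 : realization R D x0.
  split.
  - by move=> i; rewrite mxE; case: ifP => // _; rewrite invr_ge0 ltW.
  - rewrite sum_enum_rank (eq_bigr _ (fun v _ => x0E v)) -big_mkcond /= sumr_const -[LHS]mulr_natr.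
    by rewrite mulVf // gt_eqF.
  - apply: sD MD _; apply/fintype.subsetP => v; rewrite inE x0E; case: ifP => //; by rewrite eqxx.
have [U [W [oU Ux0 oW [f [g [[cf cg] Hf Hg]]]]]] := mD _ Lx0.
have [Wy0 gy0] := Hf x0 (conj Lx0 Ux0).
pose G := [set y | W y /\ forall m, m \in M -> 0 < g y 0 (enum_rank m)].
have cgW y : W y -> {for y, continuous g}.
  move=> Wy; have := @continuous_within_comp _ _ _ W g id y cg.
  by apply; [exact: cvg_id|exact: open_nbhs_nbhs].
have cgm y m : W y -> {for y, continuous (fun y => g y 0 (enum_rank m))}.
  move=> Wy; apply: (@continuous_comp _ _ _ g (fun x => x 0 (enum_rank m))); first exact: cgW.
  exact: coord_continuous.
have oG : open G.
  rewrite openE => y [Wy gy]; apply: filterI; first exact: open_nbhs_nbhs.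
  apply: (@filter_forall _ V (fun m (y' : 'rV[R]_3) => m \in M -> 0 < g y' 0 (enum_rank m)) (nbhs y)) => m; have [mM|mM] := boolP (m \in M); last exact: filterE.
  have : nbhs y [set y' | 0 < g y' 0 (enum_rank m)].
    have n0 : nbhs (g y 0 (enum_rank m)) [set x | 0 < x].
      by apply: open_nbhs_nbhs; split; [exact: open_gt|exact: gy].
    exact: (cgm y m Wy _ n0).
  by apply: filterS => y' ? _.
pose c y := (g y 0 (enum_rank m1), g y 0 (enum_rank m2)).
apply: (@no_embedding_3_2 R G c (f x0) oG).
- split=> // m mM; rewrite gy0 x0E mM invr_gt0 //.
- by move=> y [Wy _]; exact: cvg_pair (cgm y m1 Wy) (cgm y m2 Wy).
have zero y : G y -> forall v, v \notin M -> g y 0 (enum_rank v) = 0.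
  move=> [Wy gy] v vM; have [[[_ _ gD] _] _] := Hg y Wy.
  have E : finset (fun v : V => g y 0 (enum_rank v) != 0) = M.
    by apply: maxM gD _; apply/fintype.subsetP => m mM; rewrite inE gt_eqF // gy.
  by apply/eqP; move: vM; rewrite -E inE negbK.
move=> y y' Gy Gy' [e1 e2].
have [Wy _] := Gy; have [Wy' _] := Gy'.
have [[[_ s1 _] _] <-] := Hg y Wy; have [[[_ s1' _] _] <-] := Hg y' Wy'; congr f.
pose d v := g y 0 (enum_rank v) - g y' 0 (enum_rank v).
have d0 v : v != m3 -> d v = 0.
  move=> v3; have [vM|vM] := boolP (v \in M); last by rewrite /d !zero // subrr.
  have := HM v vM; rewrite (negPf v3) orbF => /orP[]/eqP ->.
    by rewrite /d e1 subrr.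
  by rewrite /d e2 subrr.
have d3 : d m3 = 0.
  have : \sum_v d v = 0 by rewrite sumrB -!sum_enum_rank s1 s1' subrr.
  by rewrite (bigD1 m3) //= big1 ?addr0.
apply: rowV_inj => v; apply/eqP; rewrite -subr_eq0; apply/eqP.
by have [->|] := eqVneq v m3; [exact: d3|exact: d0].
Qed.

Lemma low_simplex_in_tetrahedron (X : {set V}) :
  manifold_triangulation R D -> X \in D -> exists2 Y, Y \in simplices 3 D & X \subset Y.
Proof.
move=> [_ [[Z ZD] dD] mD _].
have [n] := ubnP (4 - #|X|)%N; elim: n X => // n IH X nX XD.
have [X4|X4] := leqP 4 #|X|.
  by exists X => //; rewrite inE XD eqn_leq dD.
(* The empty simplex supports no point; the tetrahedron given by the dimension contains it. *)
have [X0|X0] := eqVneq X finset.set0.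
  by exists Z => //; rewrite X0 finset.sub0set.
have [Y YD XY] := @low_simplex_not_maximal X mD XD X0 X4.
have [|Z' Z'D YZ] := IH Y _ YD.
  by have := fintype.proper_card XY; move: nX X4; lia.
by exists Z' => //; apply: fintype.subset_trans YZ; exact: fintype.proper_sub.
Qed.
End Purity.

(** [x = y] is allowed, so that a path in the link may stay at a vertex. *)
Definition in_link (V : finType) (T : {set {set V}}) (v x y : V) : bool :=
  [exists X in T, [&& v \in X, x \in X, y \in X, x != v & y != v]].

Definition same_edge (V : finType) (x y x' y' : V) : bool :=
  (x == x') && (y == y') || (x == y') && (y == x').

Definition crossed (V : finType) (p q s t x y : V) : bool :=
  [|| same_edge x y q s, same_edge x y p q | same_edge x y p t].

(* What the proof uses of the set [T] of tetrahedra of a triangulated manifold.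
   [tet_crossing] says that in the link of [v], where the triangles [p q s],
   [p q t], [q s a], [p t a] carry a closed curve through [a] crossing the edges
   [q s], [p q] and [p t], no path [p u w q] avoids this curve (with [u = p]
   or [u = w] or [w = q] allowed). *)
Record tetrahedral_manifold (V : finType) (T : {set {set V}}) : Prop := {
  tet_card : forall X, X \in T -> #|X| = 4%N;
  tet_cover : forall v : V, exists2 X, X \in T & v \in X;
  tet_two : forall X Y Z F : {set V}, X \in T -> Y \in T -> Z \in T -> #|F| = 3%N ->
    F \subset X -> F \subset Y -> F \subset Z -> [\/ X = Y, X = Z | Y = Z];
  tet_other : forall X F : {set V}, X \in T -> F \subset X -> #|F| = 3%N ->
    exists Y, [/\ Y \in T, Y != X & F \subset Y];
  tet_connected : forall (v : V) (P : {set V} -> Prop) (X Y : {set V}),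
    (forall Z Z', Z \in T -> Z' \in T -> v \in Z -> v \in Z' -> #|Z :&: Z'| = 3%N ->
      P Z -> P Z') ->
    X \in T -> v \in X -> P X -> Y \in T -> v \in Y -> P Y;
  tet_crossing : forall v p q s t a u w : V, uniq [:: p; q; s; t; a] ->
    [set v; p; q; s]%SET \in T -> [set v; p; q; t]%SET \in T ->
    [set v; q; s; a]%SET \in T -> [set v; p; t; a]%SET \in T ->
    in_link T v p u -> in_link T v u w -> in_link T v w q -> u != a -> w != a ->
    ~~ crossed p q s t p u -> ~~ crossed p q s t u w -> ~~ crossed p q s t w q -> False }.

Section ManifoldTetrahedra.
Variables (R : realType) (V : finType) (D : {set {set V}}).
Hypothesis mD : manifold_triangulation R D.
Local Notation T := (simplices 3 D).

Lemma mem_neighbourhood (v : V) (Y : {set V}) :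
  Y \in neighbourhood D v <-> exists2 X, X \in T & v \in X /\ Y \subset X :\ v.
Proof.
rewrite /neighbourhood inE; split=> [/existsP[Z /andP[/imsetP[X]]]|[X XT [vX sY]]].
  by rewrite inE => /andP[XT vX] -> sY; exists X.
by apply/existsP; exists (X :\ v); rewrite sY andbT; apply/imsetP; exists X; rewrite // inE XT.
Qed.

Lemma tet_cardE (X : {set V}) : X \in T -> #|X| = 4%N.
Proof. by rewrite inE => /andP[_ /eqP]. Qed.

Lemma neighbourhood_sub (v : V) : simplicial_complex (neighbourhood D v).
Proof.
move=> X Y /mem_neighbourhood[Z ZT [vZ sX]] sY; apply/mem_neighbourhood; exists Z => //.
by split=> //; exact: fintype.subset_trans sX.
Qed.

Lemma neighbourhood_facet (v : V) (X : {set V}) : X \in T -> v \in X ->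
  X :\ v \in neighbourhood D v /\ #|X :\ v| = 3%N.
Proof.
move=> XT vX; split; first by apply/mem_neighbourhood; exists X.
by have := cardsD1 v X; rewrite vX tet_cardE // add1n => -[<-].
Qed.

Lemma neighbourhood_pure (v : V) (X : {set V}) : X \in neighbourhood D v ->
  exists Z, [/\ Z \in neighbourhood D v, X \subset Z & #|Z| = 3%N].
Proof.
move=> /mem_neighbourhood[Z ZT [vZ sX]]; exists (Z :\ v).
by have [? ?] := neighbourhood_facet ZT vZ.
Qed.

Lemma neighbourhood3 (v : V) (F : {set V}) : F \in neighbourhood D v -> #|F| = 3%N ->
  v \notin F /\ v |: F \in T.
Proof.
move=> /mem_neighbourhood[Z ZT [vZ sF]] cF.
have [_ cZ] := neighbourhood_facet ZT vZ.
have -> : F = Z :\ v by apply/eqP; rewrite eqEcard sF cF cZ.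
by rewrite finset.setD1K // finset.setD11.
Qed.

Lemma card3E (F : {set V}) : #|F| = 3%N -> exists x y z,
  [/\ F = [set x; y; z]%SET, x != y, x != z & y != z].
Proof.
move=> cF; have [x xF] : exists x, x \in F by apply/set0Pn; rewrite -cards_eq0 cF.
have cx : #|F :\ x| == 2%N by have := cardsD1 x F; rewrite xF cF add1n => -[<-].
have /cards2P[y [z [yz E]]] := cx.
have : y \in F :\ x by rewrite E !inE eqxx.
have : z \in F :\ x by rewrite E !inE eqxx orbT.
rewrite !inE => /andP[zx zF] /andP[yx yF]; exists x, y, z; split=> //; try by rewrite eq_sym.
by rewrite -(finset.setD1K xF) E finset.setUA.
Qed.

Lemma tet_apex (X F : {set V}) : X \in T -> F \subset X -> #|F| = 3%N ->
  exists2 x, x \notin F & X = x |: F.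
Proof.
move=> XT sF cF.
have /cards1P[x E] : #|X :\: F| == 1%N by rewrite cardsDS // cF tet_cardE.
have : x \in X :\: F by rewrite E inE.
rewrite inE => /andP[xF xX]; exists x => //.
by rewrite -E finset.setUC finset.setDE finset.setUIr finset.setUCr finset.setIT; apply/esym/finset.setUidPr.
Qed.

(** A triangle [v p q] of a tetrahedron is the edge [p q] in the link of [v], so the statements on
    triangles are those on edges of a sphere. Every vertex is covered because its link, being a
    sphere, has a point. *)
Lemma manifold_tetrahedra : tetrahedral_manifold T.
Proof.
have [sD [[Z0 Z0T] dD] _ hD] := mD.
split.
- exact: tet_cardE.
- move=> v; have [h [k [_ hk kh]]] := hD v.
  have [] := kh (row3 1 0 0).
    by apply/two_sphereE; rewrite /dot3; have [-> -> ->] := row3E (1 : R) 0 0; lra.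
  move=> [_ _ /mem_neighbourhood[X XT [vX _]]] _; by exists X.
- move=> X Y Z F XT YT ZT cF sX sY sZ; apply: contrapT => H.
  have [x xF EX] := tet_apex XT sX cF.
  have [y yF EY] := tet_apex YT sY cF.
  have [z zF EZ] := tet_apex ZT sZ cF.
  have [v [p [q [EF vp vq pq]]]] := card3E cF.
  have N r W : W \in T -> W = r |: F -> r \notin F -> [set p; q; r]%SET \in neighbourhood D v.
    move=> WT EW rF; apply/mem_neighbourhood; exists W => //; split.
      by rewrite EW EF !inE eqxx ?orbT.
    apply/fintype.subsetP => i; rewrite EW; move: rF; rewrite EF !inE !negb_or => /andP[/andP[rv rp] rq].
    by move=> /orP[/orP[]|] /eqP ->; rewrite ?eqxx ?orbT ?andbT // eq_sym.
  have nF r : r \notin F -> r \notin [set p; q]%SET.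
    by apply: contra; rewrite EF !inE => /orP[]/eqP ->; rewrite eqxx ?orbT.
  apply: (@edge_three_triangles R V _ (@neighbourhood_sub v) (hD v) p q x y z) => //.
  + exact: N XT EX xF.
  + exact: N YT EY yF.
  + exact: N ZT EZ zF.
  + exact: nF. 
  + exact: nF.
  + exact: nF.
  + by apply/eqP => E; apply: H; constructor 1; rewrite EX EY E.
  + by apply/eqP => E; apply: H; constructor 2; rewrite EX EZ E.
  + by apply/eqP => E; apply: H; constructor 3; rewrite EY EZ E.
- move=> X F XT sX cF; apply: contrapT => H.
  have {}H Y : Y \in T -> F \subset Y -> Y = X.
    by move=> YT sY; apply: contrapT => YX; apply: H; exists Y; split=> //; apply/eqP.
  have [x xF EX] := tet_apex XT sX cF.
  have [v [p [q [EF vp vq pq]]]] := card3E cF.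
  have [xv xp xq] : [/\ x != v, x != p & x != q].
    by move: xF; rewrite EF !inE !negb_or => /andP[/andP[]].
  apply: (@edge_one_triangle R V _ (@neighbourhood_sub v) (hD v) p q x) => //.
  + by rewrite !inE negb_or xp xq.
  + apply/mem_neighbourhood; exists X => //; split; first by rewrite EX EF !inE eqxx ?orbT.
    apply/fintype.subsetP => i; rewrite EX EF !inE.
    by move=> /orP[/orP[]|] /eqP ->; rewrite ?eqxx ?orbT ?andbT // eq_sym.
  + move=> Y /mem_neighbourhood[Z ZT [vZ sYZ]] pY qY.
    have ZX : Z = X.
      apply: H => //; rewrite EF; apply/fintype.subsetP => i; rewrite !inE => /orP[/orP[]|] /eqP -> //.
        by have /fintype.subsetP/(_ _ pY) := sYZ; rewrite inE => /andP[].
      by have /fintype.subsetP/(_ _ qY) := sYZ; rewrite inE => /andP[].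
    apply: fintype.subset_trans sYZ _; rewrite ZX EX EF.
    by apply/fintype.subsetP => i; rewrite !inE; case: (i == v); case: (i == p); case: (i == q); case: (i == x).
- move=> v P X Y adj XT vX PX YT vY.
  pose K := finset (fun F : {set V} => [&& F \in neighbourhood D v, #|F| == 3%N & `[< P (v |: F) >]]).
  have KE F : (F \in K) = [&& F \in neighbourhood D v, #|F| == 3%N & `[< P (v |: F) >]] by rewrite finset.in_set.
  have [LX cX] := neighbourhood_facet XT vX.
  have [LY cY] := neighbourhood_facet YT vY.
  have : Y :\ v \in K.
    apply: (@strongly_connected R V _ (@neighbourhood_sub v) (hD v) (@neighbourhood_pure v) K (X :\ v)) => //.
    + by move=> F; rewrite KE => /and3P[? /eqP].
    + move=> F F'; rewrite !KE => /and3P[LF /eqP cF /asboolP PF] LF' cF' cFF'.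
      rewrite LF' cF' eqxx /=; apply/asboolP.
      have [vF FT] := neighbourhood3 LF cF; have [vF' FT'] := neighbourhood3 LF' cF'.
      apply: adj PF => //; try by rewrite !inE eqxx.
      rewrite -finset.setUIr cardsU1 cFF' inE negb_and vF //.
    + by rewrite KE LX cX eqxx finset.setD1K //; apply/asboolP.
  by rewrite KE finset.setD1K // => /and3P[_ _ /asboolP].
- move=> v p q s t a u w un T1 T2 T3 T4 lpu luw lwq ua wa c1 c2 c3.
  have ne (X : {set V}) b c d : X \in T -> X = [set v; b; c; d]%SET -> [set b; c; d]%SET \in neighbourhood D v.
    move=> XT EX; apply/mem_neighbourhood; exists X => //; split; first by rewrite EX !inE eqxx.
    have EF : [set b; c; d]%SET = b |: (c |: [set d]%SET) by rewrite !finset.setUA.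
    have EX' : X = v |: [set b; c; d]%SET by rewrite EX !finset.setUA.
    have cl : (#|[set b; c; d]%SET| <= 3)%N.
      by rewrite EF !cardsU1 cards1; do 2 case: (_ \notin _).
    have vF : v \notin [set b; c; d]%SET.
      by have := tet_cardE XT; rewrite EX' cardsU1; case: (v \notin _) => //= E; rewrite add0n in E; rewrite E in cl.
    by rewrite EX' finset.setU1K.
  have ed x y : in_link T v x y -> [set x; y]%SET \in neighbourhood D v.
    move=> /existsP[X /andP[XT /and5P[vX xX yX xv yv]]]; apply/mem_neighbourhood; exists X => //; split=> //.
    by apply/fintype.subsetP => i; rewrite !inE => /orP[]/eqP ->; rewrite ?xv ?yv.
  have se x y x' y' : x' != y' -> [set x; y]%SET = [set x'; y']%SET -> same_edge x y x' y'.
    move=> xy' /finset.setP E; have := E x; have := E x'; have := E y'.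
    rewrite /same_edge !inE !eqxx ?orbT /= => /orP ey' /orP ex' /esym/orP[]/eqP ex.
      apply/orP; left; rewrite ex eqxx /=; case: ey' => /eqP ey'; last by rewrite ey'.
      by rewrite ey' ex eqxx in xy'.
    apply/orP; right; rewrite ex eqxx /=; case: ex' => /eqP ex'; last by rewrite ex'.
    by rewrite ex' ex eqxx in xy'.
  have [pq qs pt] : [/\ p != q, q != s & p != t].
    by move: un; rewrite /= !inE !negb_or => /andP[/and4P[-> _ -> _] /andP[/andP[-> _] _]].
  have unc x y : ~~ crossed p q s t x y -> [set x; y]%SET \notin [:: [set q; s]; [set p; q]; [set p; t]]%SET.
    apply: contra; rewrite !inE /crossed => /or3P[] /eqP /se -> //; by rewrite ?orbT.
  apply: (@no_single_crossing R V _ (@neighbourhood_sub v) (hD v) p q s t a u w un) => //.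
  + exact: ne T1 _.
  + exact: ne T2 _.
  + exact: ne T3 _.
  + exact: ne T4 _.
  + exact: ed.
  + exact: ed.
  + exact: ed.
  + by move=> e; rewrite in_cons in_cons in_cons in_nil orbF => /or3P[]/eqP ->; exact: unc.
Qed.
End ManifoldTetrahedra.

Local Close Scope ring_scope.
Local Close Scope classical_set_scope.
From mathcomp Require Import fintype finset.

(** * Intersection preserving maps *)

Lemma uniq4 (W : eqType) (a b c d : W) : uniq [:: a; b; c; d] ->
  [/\ a != b, a != c, a != d & [/\ b != c, b != d & c != d]].
Proof. by rewrite /= !inE !negb_or => /and4P[/and3P[-> -> ->] /andP[-> ->] -> _]. Qed.

Definition tet (W : finType) (S : {set {set W}}) (l : seq W) : bool := [set x in l] \in S.

Section Tetrahedra.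
Variables (W : finType) (S : {set {set W}}).
Hypothesis hS : tetrahedral_manifold S.

Lemma tet_uniq l : tet S l -> size l = 4 -> uniq l.
Proof. by move=> tl sl; apply/card_uniqP; rewrite sl -cardsE (tet_card hS). Qed.

Lemma tet_eq l m : tet S l -> l =i m -> tet S m.
Proof.
by move=> tl E; rewrite /tet (_ : [set x in m] = [set x in l]) //; apply/setP => x; rewrite !inE E.
Qed.

Lemma tet_link l v x y : tet S l -> v \in l -> x \in l -> y \in l -> x != v -> y != v ->
  in_link S v x y.
Proof.
move=> tl vl xl yl xv yv; apply/existsP; exists [set z in l].
by apply/andP; split; rewrite // !inE vl xl yl xv yv.
Qed.

Lemma no_crossing v p q s t a u w : uniq [:: p; q; s; t; a] ->
  tet S [:: v; p; q; s] -> tet S [:: v; p; q; t] -> tet S [:: v; q; s; a] -> tet S [:: v; p; t; a] ->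
  in_link S v p u -> in_link S v u w -> in_link S v w q -> u != a -> w != a ->
  ~~ crossed p q s t p u -> ~~ crossed p q s t u w -> ~~ crossed p q s t w q -> False.
Proof.
have E (b c d e : W) : [set x in [:: b; c; d; e]] = [set b; c; d; e].
  by apply/setP => x; rewrite !inE !orbA.
rewrite /tet !E => *.
exact: (tet_crossing hS (v := v) (p := p) (q := q) (s := s) (t := t) (a := a) (u := u) (w := w)).
Qed.

Lemma third_apex x y z b c d : tet S [:: x; b; c; d] -> tet S [:: y; b; c; d] ->
  tet S [:: z; b; c; d] -> x != z -> y != z -> x = y.
Proof.
move=> tx ty tz xz yz; have ux := tet_uniq tx erefl; have uy := tet_uniq ty erefl.
have cF : #|[set u in [:: b; c; d]]| = 3.
  by rewrite cardsE; apply/card_uniqP; case/andP: ux.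
have sF u : [set v in [:: b; c; d]] \subset [set v in [:: u; b; c; d]].
  by apply/subsetP => v; rewrite !inE => ->; rewrite orbT.
have eq u v : uniq [:: u; b; c; d] -> [set i in [:: u; b; c; d]] = [set i in [:: v; b; c; d]] -> u = v.
  move=> /uniq4[/negPf n1 /negPf n2 /negPf n3 _] /setP/(_ u).
  by rewrite !inE eqxx n1 n2 n3 !orbF => /esym/eqP.
have [|E|E] := tet_two hS tx ty tz cF (sF x) (sF y) (sF z); first exact: eq.
  by rewrite (eq _ _ ux E) eqxx in xz.
by rewrite (eq _ _ uy E) eqxx in yz.
Qed.
End Tetrahedra.

(** * Matching the vertices of a tetrahedron with those of its image *)

Section Correspondence.
Variables (V V' : finType) (T : {set {set V}}) (T' : {set {set V'}}).
Variable f : {set V} -> {set V'}.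
Hypotheses (hT : tetrahedral_manifold T) (hT' : tetrahedral_manifold T').
Hypothesis f_inj : {in T &, injective f}.
Hypothesis f_im : f @: T = T'.
Hypothesis f_card : {in T &, forall X Y, #|X :&: Y| = #|f X :&: f Y|}.
Implicit Types X Y : {set V}.

Lemma f_in X : X \in T -> f X \in T'.
Proof. by move=> XT; rewrite -f_im imset_f. Qed.

(** An equation of sets: the lists only name the vertices, and their order is immaterial. In
    [labels] the order matters. *)
Definition maps (l : seq V) (l' : seq V') :=
  [/\ tet T l, f [set x in l] = [set x in l'], size l = 4 & size l' = 4].

Lemma maps_uniq l l' : maps l l' -> uniq l /\ uniq l'.
Proof.
case=> tl fl sl sl'; split; apply/card_uniqP.
  by rewrite sl -cardsE (tet_card hT).
by rewrite sl' -cardsE -fl (tet_card hT') // f_in.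
Qed.

Lemma card_setI_seq (W : finType) (s r : seq W) : uniq s ->
  #|[set x in s] :&: [set x in r]| = count (mem r) s.
Proof.
move=> us; rewrite -size_filter -(card_uniqP (filter_uniq _ us)).
by apply: eq_card => x; rewrite !inE mem_filter andbC.
Qed.

Lemma maps_count l l' m m' : maps l l' -> maps m m' ->
  count (fun x => x \in m) l = count (fun x => x \in m') l'.
Proof.
move=> hl hm; have [ul ul'] := maps_uniq hl.
case: hl hm => tl fl _ _ [tm fm _ _].
by rewrite -!card_setI_seq // f_card // fl fm.
Qed.

Lemma maps_eq l l' m m' : maps l l' -> l =i m -> l' =i m' -> size m = 4 -> size m' = 4 -> maps m m'.
Proof.
move=> [tl fl _ _] el el' sm sm'.
have El : [set x in l] = [set x in m] by apply/setP => x; rewrite !inE el.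
have El' : [set x in l'] = [set x in m'] by apply/setP => x; rewrite !inE el'.
by split=> //; [rewrite /tet -El|rewrite -El fl El'].
Qed.

(* A vertex map inducing [f] has to map [v] to the only [v'] with this property. *)
Definition corresponds X (v : V) (v' : V') : Prop :=
  [/\ v \in X, v' \in f X & forall Y, Y \in T -> Y != X -> X :\ v \subset Y ->
    f X :\ v' \subset f Y].

Lemma facet_card (W : finType) (S : {set {set W}}) (X : {set W}) v :
  tetrahedral_manifold S -> X \in S -> v \in X -> #|X :\ v| = 3.
Proof. by move=> hS XS vX; have := cardsD1 v X; rewrite vX (tet_card hS) // add1n => -[<-]. Qed.

Lemma tet_sub X Y : X \in T -> Y \in T -> X \subset Y -> X = Y.
Proof. by move=> XT YT sXY; apply/eqP; rewrite eqEcard sXY !(tet_card hT). Qed.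

Lemma facet_neighbour X v : X \in T -> v \in X ->
  exists Y, [/\ Y \in T, Y != X, X :\ v \subset Y &
    forall Z, Z \in T -> Z != X -> X :\ v \subset Z -> Z = Y].
Proof.
move=> XT vX; have cF := facet_card hT XT vX.
have [Y [YT YX sY]] := tet_other hT XT (subsetDl _ _) cF.
exists Y; split=> // Z ZT ZX sZ.
have [E|E|//] := tet_two hT XT ZT YT cF (subsetDl _ _) sZ sY.
  by rewrite E eqxx in ZX.
by rewrite E eqxx in YX.
Qed.

Lemma neighbour_facet X v Y : X \in T -> v \in X -> Y \in T -> Y != X ->
  X :\ v \subset Y -> X :&: Y = X :\ v /\ #|f X :&: f Y| = 3.
Proof.
move=> XT vX YT YX sY; have cF := facet_card hT XT vX.
suff E : X :&: Y = X :\ v by split=> //; rewrite -f_card // E.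
apply/eqP; rewrite eq_sym eqEcard subsetI subsetDl sY /=.
rewrite cF leqNgt; apply/negP => c4; case/eqP: YX; apply/esym/tet_sub => //.
apply/setIidPl/eqP; rewrite eqEcard subsetIl (tet_card hT XT) //.
Qed.

(** If [Y] is the neighbour across the facet opposite [v], then [f Y] contains three vertices of
    [f X]; [v'] is the fourth. *)
Lemma corresponds_ex X v : X \in T -> v \in X -> exists v', corresponds X v v'.
Proof.
move=> XT vX; have [Y [YT YX sY uY]] := facet_neighbour XT vX.
have [_ cI] := neighbour_facet XT vX YT YX sY.
have /cards1P[v' E] : #|f X :\: f Y| == 1.
  by have := cardsID (f Y) (f X); rewrite cI (tet_card hT' (f_in XT)); lia.
have : v' \in f X :\: f Y by rewrite E inE.
rewrite inE => /andP[v'Y v'X]; exists v'; split=> // Z ZT ZX sZ.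
rewrite (uY Z) //; apply/subsetP => w; rewrite !inE => /andP[wv wX].
apply: contraNT wv => wY; have : w \in f X :\: f Y by rewrite inE wY.
by rewrite E inE.
Qed.

Lemma corresponds_fun X v v' w' : X \in T ->
  corresponds X v v' -> corresponds X v w' -> v' = w'.
Proof.
move=> XT [vX v'X Hv'] [_ w'X Hw']; apply/eqP/negPn/negP => vw.
have [Y [YT YX sY _]] := facet_neighbour XT vX.
have [_ cI] := neighbour_facet XT vX YT YX sY.
have : f X \subset f Y.
  apply/subsetP => u uX; have [uv|uv] := eqVneq u v'.
    by have /subsetP := Hw' Y YT YX sY; apply; rewrite !inE uv vw.
  by have /subsetP := Hv' Y YT YX sY; apply; rewrite !inE uv.
by move/setIidPl => E; move: cI; rewrite E (tet_card hT' (f_in XT)).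
Qed.

(** Otherwise [f X] and the images of two different neighbours would be three tetrahedra on one
    triangle. *)
Lemma corresponds_inj X v w v' : X \in T ->
  corresponds X v v' -> corresponds X w v' -> v = w.
Proof.
move=> XT [vX v'X Hv] [wX _ Hw]; apply/eqP/negPn/negP => vw.
have [Y [YT YX sY _]] := facet_neighbour XT vX.
have [Z [ZT ZX sZ _]] := facet_neighbour XT wX.
have cF := facet_card hT' (f_in XT) v'X.
have [E|E|E] := tet_two hT' (f_in XT) (f_in YT) (f_in ZT) cF (subsetDl _ _) (Hv Y YT YX sY) (Hw Z ZT ZX sZ).
- by case/eqP: YX; apply: f_inj.
- by case/eqP: ZX; apply: f_inj.
have {}E := f_inj YT ZT E; case/eqP: YX; apply/esym/tet_sub => //.
apply/subsetP => u uX; have [uv|uv] := eqVneq u v; last first.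
  by have /subsetP := sY; apply; rewrite !inE uv.
by rewrite E; have /subsetP := sZ; apply; rewrite !inE uv vw.
Qed.

Definition labels a b c d a' b' c' d' : Prop :=
  maps [:: a; b; c; d] [:: a'; b'; c'; d'] /\
  let X := [set x in [:: a; b; c; d]] in
  [/\ corresponds X a a', corresponds X b b', corresponds X c c' & corresponds X d d'].

Lemma labels_ex a b c d : tet T [:: a; b; c; d] ->
  exists a' b' c' d', labels a b c d a' b' c' d'.
Proof.
move=> tX; have u := tet_uniq hT tX erefl; move: (u) => /uniq4[ab ac ad [bc bd cd]].
have ex x : x \in [:: a; b; c; d] -> exists x', corresponds [set x in [:: a; b; c; d]] x x'.
  by move=> xX; apply: corresponds_ex => //; rewrite inE.
have [|a' Ha] := ex a; first by rewrite !inE eqxx.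
have [|b' Hb] := ex b; first by rewrite !inE eqxx ?orbT.
have [|c' Hc] := ex c; first by rewrite !inE eqxx ?orbT.
have [|d' Hd] := ex d; first by rewrite !inE eqxx ?orbT.
exists a', b', c', d'; split=> //; split=> //.
have ne x x' y y' : x != y -> corresponds [set x in [:: a; b; c; d]] x x' ->
    corresponds [set x in [:: a; b; c; d]] y y' -> x' != y'.
  by move=> xy Hx Hy; apply: contra_neq xy => E; apply: corresponds_inj Hx _ => //; rewrite E.
have u' : uniq [:: a'; b'; c'; d'].
  by rewrite /= !inE !negb_or (ne a a' b b') ?(ne a a' c c') ?(ne a a' d d') ?(ne b b' c c') ?(ne b b' d d') ?(ne c c' d d').
apply/esym/eqP; rewrite eqEcard cardsE (card_uniqP u') (tet_card hT' (f_in tX)) leqnn andbT.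
apply/subsetP => x; rewrite !inE.
by case: Ha Hb Hc Hd => _ ? _ [_ ? _] [_ ? _] [_ ? _] /or4P[]/eqP ->.
Qed.

(** Together with [labels_rot] this generates all 24 permutations, through which [known_labels]
    searches. *)
Lemma labels_swap a b c d a' b' c' d' : labels a b c d a' b' c' d' -> labels b a c d b' a' c' d'.
Proof.
case=> m [ha hb hc hd]; have E : [set x in [:: b; a; c; d]] = [set x in [:: a; b; c; d]].
  by apply/setP => x; rewrite !inE orbCA.
split; last by rewrite E.
by apply: maps_eq m _ _ _ _ => // x; rewrite !inE orbCA.
Qed.

Lemma labels_rot a b c d a' b' c' d' : labels a b c d a' b' c' d' -> labels b c d a b' c' d' a'.
Proof.
case=> m [ha hb hc hd]; have E : [set x in [:: b; c; d; a]] = [set x in [:: a; b; c; d]].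
  by apply/setP => x; rewrite !inE; do !case: (_ == _).
split; last by rewrite E.
by apply: maps_eq m _ _ _ _ => // x; rewrite !inE; do !case: (_ == _).
Qed.

Lemma facet_seq (W : finType) (a b c d : W) : uniq [:: a; b; c; d] ->
  [set x in [:: a; b; c; d]] :\ a = [set x in [:: b; c; d]].
Proof.
move=> /uniq4[ab ac ad _]; apply/setP => x; rewrite !inE.
by have [->|] := eqVneq x a; rewrite ?(negPf ab) ?(negPf ac) ?(negPf ad).
Qed.

Lemma apex (W : finType) (S : {set {set W}}) (X : {set W}) b c d : tetrahedral_manifold S ->
  X \in S -> uniq [:: b; c; d] -> [set x in [:: b; c; d]] \subset X ->
  exists x, X = [set y in [:: x; b; c; d]].
Proof.
move=> hS XS u sX; have cF : #|[set x in [:: b; c; d]]| = 3 by rewrite cardsE (card_uniqP u).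
have /cards1P[x E] : #|X :\: [set x in [:: b; c; d]]| == 1.
  by rewrite cardsDS // cF (tet_card hS).
exists x; apply/setP => y; have /setP/(_ y) := E; have /subsetP/(_ y) := sX; rewrite !inE.
by case: (y == x); case: (y \in X); case: (_ || _) => //= /(_ isT).
Qed.

Lemma labels_neighbour a b c d a' b' c' d' x : labels a b c d a' b' c' d' ->
  x != a -> tet T [:: x; b; c; d] ->
  exists x', maps [:: x; b; c; d] [:: x'; b'; c'; d'] /\ x' != a'.
Proof.
case=> m [[_ _ ha] _ _ _] xa tx; have [u u'] := maps_uniq m; have [tX fX _ _] := m.
have YX : [set y in [:: x; b; c; d]] != [set y in [:: a; b; c; d]].
  apply/eqP => /setP/(_ x); rewrite !inE eqxx (negPf xa) /=.
  by have := tet_uniq hT tx erefl => /uniq4[/negPf-> /negPf-> /negPf-> _].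
have sY : [set y in [:: b; c; d]] \subset [set y in [:: x; b; c; d]].
  by apply/subsetP => y; rewrite !inE => ->; rewrite orbT.
have := ha _ tx YX; rewrite facet_seq // fX facet_seq // => /(_ sY) sY'.
have [|x' Ex] := apex hT' (f_in tx) _ sY'; first by case/andP: u'.
exists x'; split=> //; apply: contraNneq YX => xa'; apply/eqP; apply: f_inj => //.
by rewrite Ex fX xa'.
Qed.

Lemma labels_neighbour_ex a b c d a' b' c' d' : labels a b c d a' b' c' d' ->
  exists x x', [/\ maps [:: x; b; c; d] [:: x'; b'; c'; d'], x != a & x' != a'].
Proof.
move=> h; have [m _] := h; have [tX _ _ _] := m; have [u _] := maps_uniq m.
have [|Y [YT YX sY _]] := @facet_neighbour _ a tX; first by rewrite !inE eqxx.
rewrite facet_seq // in sY; have u3 : uniq [:: b; c; d] by case/andP: u.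
have [x Ex] := apex hT YT u3 sY.
have xa : x != a by apply: contraNneq YX => E; rewrite Ex E.
have [|x' [mx xa']] := labels_neighbour h xa; first by rewrite /tet -Ex.
by exists x, x'.
Qed.

(** * Labels of adjacent tetrahedra *)

Ltac ev1 H := match type of H with context [?x == ?y] => first
  [ constr_eq x y; rewrite (eqxx x) in H
  | match goal with N : is_true (x != y) |- _ => rewrite (negPf N) in H end
  | match goal with N : is_true (y != x) |- _ => rewrite [x == y]eq_sym (negPf N) in H end ] end.

(** Decides the equality tests settled by the context; the others remain as booleans for a case
    analysis. *)
Ltac evaluate H := rewrite /= ?inE in H; repeat (ev1 H); rewrite /= ?orbF ?orbT ?addn0 ?add0n in H.

Ltac disequalities H :=
  have [/uniq4[? ? ? [? ? ?]] /uniq4[? ? ? [? ? ?]]] := maps_uniq H.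

Ltac same_elements := by move=> ?; rewrite !inE; do ?case: (_ == _).

Lemma maps_fun l (l1 l2 : seq V') : maps l l1 -> maps l l2 -> l1 =i l2.
Proof. by move=> [_ f1 _ _] [_ f2 _ _] x; have /setP/(_ x) := etrans (esym f1) f2; rewrite !inE. Qed.

(** The common facet is mapped to the common facet, so [e] corresponds to [e']. What remains is a
    permutation of three vertices: the identity, three transpositions, two 3-cycles. *)
Lemma labels_adjacent a b c d a' b' c' d' e e' : labels a b c d a' b' c' d' ->
  maps [:: e; b; c; d] [:: e'; b'; c'; d'] -> e != a ->
  let L := labels e b c d e' in
  e' != a' /\ (L b' c' d' \/ L b' d' c' \/ L c' b' d' \/ L d' c' b' \/ L c' d' b' \/ L d' b' c').
Proof.
move=> hX mY ea L; have [mX _] := hX; have [tY fY _ _] := mY; have [tX fX _ _] := mX.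
disequalities mX; disequalities mY.
have XY : [set y in [:: a; b; c; d]] != [set y in [:: e; b; c; d]].
  by apply/eqP => /setP/(_ a) E; evaluate E.
have ea' : e' != a'.
  by apply: contraNneq XY => E; apply/eqP; apply: f_inj => //; rewrite fX fY E.
split=> //; have [e2 [b2 [c2 [d2 hY]]]] := labels_ex tY.
have [mY2 [[_ _ He] _ _ _]] := hY; have [_ uY2] := maps_uniq mY2; have [_ fY2 _ _] := mY2.
have E2 := maps_fun mY2 mY.
have ee : e2 = e'.
  apply/eqP/negPn/negP => ne.
  have := He _ tX XY; rewrite facet_seq ?(proj1 (maps_uniq mY)) // fY2 facet_seq //.
  have -> : [set x in [:: b; c; d]] \subset [set y in [:: a; b; c; d]].
    by apply/subsetP => y; rewrite !inE => ->; rewrite orbT.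
  move=> /(_ isT)/subsetP/(_ e') H.
  have e'2 := E2 e'; evaluate e'2.
  rewrite !inE e'2 in H; have {}H := H isT.
  by move: H; rewrite fX => H; evaluate H.
rewrite ee in E2 uY2 hY; move: hY; rewrite /L; disequalities mY2.
have h1 := E2 b2; have h2 := E2 c2; have h3 := E2 d2.
move: uY2 => /uniq4[? ? ? [? ? ?]].
evaluate h1; evaluate h2; evaluate h3.
case/or3P: (esym h1) => /eqP E1; case/or3P: (esym h2) => /eqP E3; case/or3P: (esym h3) => /eqP E4;
  subst; try (match goal with H : is_true (?x != ?x) |- _ => by rewrite eqxx in H end); tauto.
Qed.

(* Here and in [apex_aligned], compare the sizes of the intersections of the two
   neighbours with each other and with [1234] and [1235]. *)
Lemma apex_twisted v1 v2 v3 v4 v5 x y w1 w2 w3 w4 w5 x' y' :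
  maps [:: v1; v2; v3; v4] [:: w1; w2; w3; w4] -> maps [:: v1; v2; v3; v5] [:: w1; w2; w3; w5] ->
  v4 != v5 -> w4 != w5 ->
  maps [:: x; v2; v3; v4] [:: x'; w2; w3; w4] -> x != v1 -> x' != w1 ->
  maps [:: y; v2; v3; v5] [:: y'; w1; w3; w5] -> y != v1 -> y' != w2 ->
  x != y /\ x' = y'.
Proof.
move=> mX mY v45 w45 mx xv xw my yv yw.
have h1 := maps_count mx mY; have h2 := maps_count my mX; have h3 := maps_count mx my.
disequalities mX; disequalities mY; disequalities mx; disequalities my.
evaluate h1; evaluate h2; evaluate h3.
move: h1 h2 h3; rewrite [v4 == y]eq_sym [w4 == y']eq_sym.
by case: (x == v5); case: (x' == w5); case: (y == v4); case: (y' == w4);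
  case: (x == y); case: (x' =P y') => //=.
Qed.

Lemma apex_aligned v1 v2 v3 v4 v5 x y w1 w2 w3 w4 w5 x' y' :
  maps [:: v1; v2; v3; v4] [:: w1; w2; w3; w4] -> maps [:: v1; v2; v3; v5] [:: w1; w2; w3; w5] ->
  v4 != v5 -> w4 != w5 ->
  maps [:: x; v2; v3; v4] [:: x'; w2; w3; w4] -> x != v1 -> x' != w1 ->
  maps [:: y; v1; v3; v5] [:: y'; w2; w3; w5] -> y != v2 -> y' != w1 ->
  x = y /\ x' != y'.
Proof.
move=> mX mY v45 w45 mx xv xw my yv yw.
have h1 := maps_count mx mY; have h2 := maps_count my mX; have h3 := maps_count mx my.
disequalities mX; disequalities mY; disequalities mx; disequalities my.
evaluate h1; evaluate h2; evaluate h3.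
move: h1 h2 h3; rewrite [v4 == y]eq_sym [w4 == y']eq_sym.
by case: (x == v5); case: (x' == w5); case: (y == v4); case: (y' == w4);
  case: (x =P y); case: (x' == y') => //=.
Qed.

Ltac evaluate_goal := rewrite /crossed /same_edge /= ?inE;
  repeat (match goal with |- context [?x == ?y] => first
  [ constr_eq x y; rewrite (eqxx x)
  | match goal with N : is_true (x != y) |- _ => rewrite (negPf N) end
  | match goal with N : is_true (y != x) |- _ => rewrite [x == y]eq_sym (negPf N) end ] end);
  rewrite /= ?orbF ?orbT ?andbF ?andbT.

Ltac all_occur m l := lazymatch m with
  | ?x :: ?m' => lazymatch l with context [x] => all_occur m' l end
  | _ => idtac end.

Ltac known_tet := match goal with H : is_true (tet _ ?l) |- is_true (tet _ ?m) =>
  all_occur m l; by apply: (tet_eq H); same_elements end.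

Ltac known_link := match goal with H : is_true (tet _ ?l) |- is_true (in_link _ ?v ?x ?y) =>
  all_occur [:: v; x; y] l; by apply: (tet_link H); evaluate_goal end.

Ltac crossing h v p q s t a u w :=
  apply: (@no_crossing _ _ h v p q s t a u w); first [known_tet | known_link | by evaluate_goal].

(* The neighbours across [v1] and [v2] would yield two closed curves crossing
   exactly once in the link of [v3]. *)
Lemma transposition v1 v2 v3 v4 v5 w1 w2 w3 w4 w5 :
  labels v1 v2 v3 v4 w1 w2 w3 w4 -> labels v1 v2 v3 v5 w2 w1 w3 w5 ->
  v4 != v5 -> w4 != w5 -> False.
Proof.
move=> hX hY v45 w45; have [mX _] := hX; have [mY0 _] := hY.
have mY : maps [:: v1; v2; v3; v5] [:: w1; w2; w3; w5] by apply: maps_eq mY0 _ _ _ _ => //; same_elements.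
have mX' : maps [:: v2; v1; v3; v4] [:: w2; w1; w3; w4] by apply: maps_eq mX _ _ _ _ => //; same_elements.
have mY' : maps [:: v2; v1; v3; v5] [:: w2; w1; w3; w5] by apply: maps_eq mY _ _ _ _ => //; same_elements.
have [x1 [x1' [mx1 x1v x1w]]] := labels_neighbour_ex hX.
have [x2 [x2' [mx2 x2v x2w]]] := labels_neighbour_ex (labels_swap hX).
have [y1 [y1' [my1 y1v y1w]]] := labels_neighbour_ex hY.
have [y2 [y2' [my2 y2v y2w]]] := labels_neighbour_ex (labels_swap hY).
have [x1y1 x1y1'] := apex_twisted mX mY v45 w45 mx1 x1v x1w my1 y1v y1w.
have [x2y2 x2y2'] := apex_twisted mX' mY' v45 w45 mx2 x2v x2w my2 y2v y2w.
have [x1y2 _] := apex_aligned mX mY v45 w45 mx1 x1v x1w my2 y2v y2w.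
have [x2y1 _] := apex_aligned mX' mY' v45 w45 mx2 x2v x2w my1 y1v y1w.
subst y1 y2.
disequalities mX; disequalities mY; disequalities mx1; disequalities mx2; disequalities my1; disequalities my2.
have [tX _ _ _] := mX; have [tY _ _ _] := mY.
have [t1 _ _ _] := mx1; have [t2 _ _ _] := my2; have [t3 _ _ _] := mx2; have [t4 _ _ _] := my1.
(* By [apex_aligned], [x1] and [x2] are apexes on both sides: one closes the curve through the three
   edges, the other the path from [v1] to [v2]. *)
crossing hT v3 v1 v2 v4 v5 x1 x2 x2.
Qed.
Ltac known_maps := match goal with H : maps ?l ?l' |- maps ?m ?m' =>
  all_occur m l; all_occur m' l'; by apply: (maps_eq H); first [done | same_elements] end.

Ltac split_uniq H := let K := fresh in have K := H; rewrite /= !inE !negb_or in K;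
  repeat match goal with K : is_true (_ && _) |- _ =>
    let K1 := fresh in let K2 := fresh in case/andP: K => K1 K2 end.

Lemma maps_tet l l' : maps l l' -> tet T l /\ tet T' l'.
Proof. by case=> tl fl _ _; split=> //; rewrite /tet -fl f_in. Qed.

Ltac known_labels := match goal with H : labels _ _ _ _ _ _ _ _ |- _ =>
  first [ exact H
    | exact (labels_swap H)
    | exact (labels_rot H)
    | exact (labels_rot (labels_swap H))
    | exact (labels_swap (labels_rot H))
    | exact (labels_rot (labels_rot H))
    | exact (labels_swap (labels_rot (labels_swap H)))
    | exact (labels_rot (labels_rot (labels_swap H)))
    | exact (labels_rot (labels_swap (labels_rot H)))
    | exact (labels_swap (labels_rot (labels_rot H)))
    | exact (labels_rot (labels_rot (labels_rot H)))
    | exact (labels_rot (labels_swap (labels_rot (labels_swap H))))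
    | exact (labels_swap (labels_rot (labels_rot (labels_swap H))))
    | exact (labels_rot (labels_rot (labels_rot (labels_swap H))))
    | exact (labels_rot (labels_rot (labels_swap (labels_rot H))))
    | exact (labels_rot (labels_swap (labels_rot (labels_rot H))))
    | exact (labels_rot (labels_rot (labels_swap (labels_rot (labels_swap H)))))
    | exact (labels_rot (labels_swap (labels_rot (labels_rot (labels_swap H)))))
    | exact (labels_swap (labels_rot (labels_rot (labels_swap (labels_rot H)))))
    | exact (labels_rot (labels_rot (labels_rot (labels_swap (labels_rot H)))))
    | exact (labels_rot (labels_rot (labels_swap (labels_rot (labels_rot H)))))
    | exact (labels_swap (labels_rot (labels_rot (labels_swap (labels_rot (labels_swap H))))))
    | exact (labels_rot (labels_rot (labels_rot (labels_swap (labels_rot (labels_swap H))))))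
    | exact (labels_rot (labels_rot (labels_swap (labels_rot (labels_rot (labels_swap H)))))) ] end.

(* Two adjacent tetrahedra [1234] and [1235] whose labels on the common facet
   differ by a 3-cycle, and their neighbours. *)
Definition twisted (v1 v2 v3 v4 v5 a b c : V) (w1 w2 w3 w4 w5 a' b' c' : V') : Prop :=
  [/\ labels v1 v2 v3 v4 w1 w2 w3 w4 /\ labels v1 v2 v3 v5 w3 w1 w2 w5,
   [/\ maps [:: a; v2; v3; v4] [:: a'; w2; w3; w4], maps [:: v1; b; v3; v4] [:: w1; b'; w3; w4] &
       maps [:: v1; v2; c; v4] [:: w1; w2; c'; w4]],
   [/\ maps [:: c; v2; v3; v5] [:: a'; w1; w2; w5], maps [:: v1; a; v3; v5] [:: w3; b'; w2; w5] &
       maps [:: v1; v2; b; v5] [:: w3; w1; c'; w5]],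
   uniq [:: v1; v2; v3; v4; v5; a; b; c] & uniq [:: w1; w2; w3; w4; w5; a'; b'; c']].

(** [apex_twisted] identifies apexes of the image and [apex_aligned] apexes of the source, each
    applied to the three rotations of the common facet. *)
Lemma cycle_twisted v1 v2 v3 v4 v5 w1 w2 w3 w4 w5 :
  labels v1 v2 v3 v4 w1 w2 w3 w4 -> labels v1 v2 v3 v5 w3 w1 w2 w5 ->
  v4 != v5 -> w4 != w5 ->
  exists a b c a' b' c', twisted v1 v2 v3 v4 v5 a b c w1 w2 w3 w4 w5 a' b' c'.
Proof.
move=> hX hY v45 w45; have [mX _] := hX; have [mY _] := hY.
have [x1 [x1' [mx1 x1v x1w]]] := labels_neighbour_ex hX.
have [x2 [x2' [mx2 x2v x2w]]] := labels_neighbour_ex (labels_swap hX).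
have [x3 [x3' [mx3 x3v x3w]]] := labels_neighbour_ex (labels_rot (labels_rot hX)).
have [y1 [y1' [my1 y1v y1w]]] := labels_neighbour_ex hY.
have [y2 [y2' [my2 y2v y2w]]] := labels_neighbour_ex (labels_swap hY).
have [y3 [y3' [my3 y3v y3w]]] := labels_neighbour_ex (labels_rot (labels_rot hY)).
have [n1 e1] : x1 != y1 /\ x1' = y1'.
  by apply: (@apex_twisted v1 v3 v2 v4 v5 x1 y1 w1 w3 w2 w4 w5 x1' y1'); first [done | known_maps].
have [n2 e2] : x2 != y2 /\ x2' = y2'.
  by apply: (@apex_twisted v2 v1 v3 v4 v5 x2 y2 w2 w1 w3 w4 w5 x2' y2'); first [done | known_maps].
have [n3 e3] : x3 != y3 /\ x3' = y3'.
  by apply: (@apex_twisted v3 v2 v1 v4 v5 x3 y3 w3 w2 w1 w4 w5 x3' y3'); first [done | known_maps].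
have [e4 n4] : x1 = y2 /\ x1' != y2'.
  by apply: (@apex_aligned v1 v2 v3 v4 v5 x1 y2 w1 w2 w3 w4 w5 x1' y2'); first [done | known_maps].
have [e5 n5] : x2 = y3 /\ x2' != y3'.
  by apply: (@apex_aligned v2 v3 v1 v4 v5 x2 y3 w2 w3 w1 w4 w5 x2' y3'); first [done | known_maps].
have [e6 n6] : x3 = y1 /\ x3' != y1'.
  by apply: (@apex_aligned v3 v1 v2 v4 v5 x3 y1 w3 w1 w2 w4 w5 x3' y1'); first [done | known_maps].
subst y1 y2 y3 y1' y2' y3'; exists x1, x2, x3, x1', x2', x3'.
disequalities mX; disequalities mY; disequalities mx1; disequalities mx2; disequalities mx3.
disequalities my1; disequalities my2; disequalities my3.
split; [by [] | by split; known_maps | by split; known_maps | by evaluate_goal | by evaluate_goal].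
Qed.

(** Exchanging the two tetrahedra turns the statement on [3 4 a b] into the one on [3 5 a c]. *)
Lemma twisted_swap v1 v2 v3 v4 v5 a b c w1 w2 w3 w4 w5 a' b' c' :
  twisted v1 v2 v3 v4 v5 a b c w1 w2 w3 w4 w5 a' b' c' ->
  twisted v2 v1 v3 v5 v4 a c b w1 w3 w2 w5 w4 b' a' c'.
Proof.
case=> [[hX hY] [m1 m2 m3] [m4 m5 m6] u u']; split; first split; try exact: labels_swap.
- by split; known_maps.
- by split; known_maps.
- by split_uniq u; evaluate_goal.
- by split_uniq u'; evaluate_goal.
Qed.

(** * Further neighbours in a twisted configuration *)

Section Twisted.
Variables (v1 v2 v3 v4 v5 a b c : V) (w1 w2 w3 w4 w5 a' b' c' : V').
Hypothesis tw : twisted v1 v2 v3 v4 v5 a b c w1 w2 w3 w4 w5 a' b' c'.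

(* In the link of [v2], a closed curve through [c] separates [v1], [v5], [b]
   from [v3], [v4], [a]. *)
Lemma twisted_no_v2ab y : ~ tet T [:: v2; a; b; y].
Proof.
case: tw => [[[mX _] [mY _]] [m1 m2 m3] [m4 m5 m6] u _] t.
split_uniq u.
have [tX _ _ _] := mX; have [tY _ _ _] := mY; have [t1 _ _ _] := m1; have [t2 _ _ _] := m2.
have [t3 _ _ _] := m3; have [t4 _ _ _] := m4; have [t5 _ _ _] := m5; have [t6 _ _ _] := m6.
crossing hT v2 v1 v3 v5 v4 c b a.
Qed.

(** The same curve through [c] in the link of [v2]; the path is now [v1 a v3]. *)
Lemma twisted_no_v1v2a y : ~ tet T [:: v1; v2; a; y].
Proof.
case: tw => [[[mX _] [mY _]] [m1 m2 m3] [m4 m5 m6] u _] t.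
split_uniq u.
have [tX _ _ _] := mX; have [tY _ _ _] := mY; have [t1 _ _ _] := m1; have [t2 _ _ _] := m2.
have [t3 _ _ _] := m3; have [t4 _ _ _] := m4; have [t5 _ _ _] := m5; have [t6 _ _ _] := m6.
crossing hT v2 v1 v3 v5 v4 c a a.
Qed.

(** A 3-cycle between [1234] and [a234] would start another twisted configuration. There the apex
    over [v1 v3 v4] is again [b], and some tetrahedron contains [v2], [a] and [b]. *)
Lemma twisted_labels_a : labels a v2 v3 v4 a' w2 w3 w4.
Proof.
case: (tw) => [[hX hY] [m1 m2 m3] [m4 m5 m6] u u'].
split_uniq u; split_uniq u'.
have [mX _] := hX; have [mY _] := hY.
have av : a != v1 by evaluate_goal.
have [aw hy] := labels_adjacent hX m1 av.
have [tX _] := maps_tet mX; have [t2 _] := maps_tet m2; have [t3 _] := maps_tet m3.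
case: hy => [h|[h|[h|[h|[h|h]]]]].
- by [].
- by case: (@transposition v3 v4 v2 v1 a w3 w4 w2 w1 a'); first [known_labels | by evaluate_goal].
- by case: (@transposition v2 v3 v4 v1 a w2 w3 w4 w1 a'); first [known_labels | by evaluate_goal].
- by case: (@transposition v2 v4 v3 v1 a w2 w4 w3 w1 a'); first [known_labels | by evaluate_goal].
- have [||||a2 [b2 [c2 [a2' [b2' [c2' tw2]]]]]] := @cycle_twisted v3 v2 v4 v1 a w3 w2 w4 w1 a';
    try first [known_labels | by evaluate_goal].
  case: tw2 => [_ [n1 n2 n3] [n4 n5 n6] r _]; split_uniq r.
  have [t5 _] := maps_tet n2; have [t6 _] := maps_tet n6.
  have E : b2 = b by apply: (third_apex hT (z := v2) (b := v1) (c := v3) (d := v4)); first [known_tet | by evaluate_goal].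
  subst b2; case: (twisted_no_v2ab (y := v3)); known_tet.
- have [||||a2 [b2 [c2 [a2' [b2' [c2' tw2]]]]]] := @cycle_twisted v2 v3 v4 v1 a w2 w3 w4 w1 a';
    try first [known_labels | by evaluate_goal].
  case: tw2 => [_ [n1 n2 n3] [n4 n5 n6] r _]; split_uniq r.
  have [t5 _] := maps_tet n1; have [t6 _] := maps_tet n5.
  have E : a2 = b by apply: (third_apex hT (z := v2) (b := v1) (c := v3) (d := v4)); first [known_tet | by evaluate_goal].
  subst a2; case: (twisted_no_v2ab (y := v4)); known_tet.
Qed.

(** The intersections of the neighbour of [a234] across [v2] with [1235], [135a] and [134b] leave no
    other apex. *)
Lemma twisted_v3v4ab : maps [:: b; a; v3; v4] [:: b'; a'; w3; w4].
Proof.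
have hA := twisted_labels_a.
case: (tw) => [[hX hY] [m1 m2 m3] [m4 m5 m6] u u'].
split_uniq u; split_uniq u'.
have [mX _] := hX; have [mY _] := hY.
have [z [z' [mz zv zw]]] := labels_neighbour_ex (labels_swap hA).
disequalities mz.
have [tX tX'] := maps_tet mX; have [t2 t2'] := maps_tet m2; have [tz tz'] := maps_tet mz.
have zv1 : z != v1.
  apply/eqP => E; subst z; have /eqP : a = b; last by evaluate_goal.
  by apply: (third_apex hT (z := v2) (b := v1) (c := v3) (d := v4)); first [known_tet | by evaluate_goal].
have zw1 : z' != w1.
  apply/eqP => E; subst z'; have /eqP : a' = b'; last by evaluate_goal.
  by apply: (third_apex hT' (z := w2) (b := w1) (c := w3) (d := w4)); first [known_tet | by evaluate_goal].
have h1 := maps_count mz mY; have h2 := maps_count mz m5; have h3 := maps_count mz m2.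
evaluate h1; evaluate h2; evaluate h3.
have [ez ez'] : z = b /\ z' = b'.
  move: h1 h2 h3; case: (z == v5); case: (z' == w5); case: (z =P b); case: (z' =P b') => //=.
by rewrite -ez -ez'.
Qed.
End Twisted.

(* The labels around [a v2 v3 v4] being known, its neighbour [d a v2 v3] and the
   neighbour [t] of the latter across [v2] are tracked: [t] has to meet
   [1 3 5 a], [3 4 a b] and [3 5 a c] in the right numbers of vertices, and each
   possible image of [t] forces two separated vertices to be adjacent. *)
Lemma cycle_impossible v1 v2 v3 v4 v5 w1 w2 w3 w4 w5 :
  labels v1 v2 v3 v4 w1 w2 w3 w4 -> labels v1 v2 v3 v5 w3 w1 w2 w5 ->
  v4 != v5 -> w4 != w5 -> False.
Proof.
move=> hX hY v45 w45.
have [a [b [c [a' [b' [c' tw]]]]]] := cycle_twisted hX hY v45 w45.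
have hA := twisted_labels_a tw.
have m7 := twisted_v3v4ab tw; have m8 := twisted_v3v4ab (twisted_swap tw).
have no_v2ab := twisted_no_v2ab tw; have no_v1v2a := twisted_no_v1v2a tw.
case: tw => [_ [m1 m2 m3] [m4 m5 m6] u u'].
split_uniq u; split_uniq u'.
have [mX _] := hX; have [mY _] := hY.
have [tX tX'] := maps_tet mX; have [tY tY'] := maps_tet mY.
have [t1 t1'] := maps_tet m1; have [t2 t2'] := maps_tet m2; have [t4 _] := maps_tet m4.
have [t5 t5'] := maps_tet m5; have [t7 _] := maps_tet m7; have [t8 _] := maps_tet m8.
have [d [d' [mZ dv4 dw4]]] := labels_neighbour_ex (labels_rot (labels_rot (labels_rot hA))).
have [tZ tZ'] := maps_tet mZ.
disequalities mZ.
have dv1 : d != v1.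
  apply/eqP => E; subst d; have /eqP : a = v4; last by evaluate_goal.
  by apply: (third_apex hT (z := v5) (b := v1) (c := v2) (d := v3)); first [known_tet | by evaluate_goal].
have dv5 : d != v5.
  apply/eqP => E; subst d; have /eqP : a = v1; last by evaluate_goal.
  by apply: (third_apex hT (z := c) (b := v2) (c := v3) (d := v5)); first [known_tet | by evaluate_goal].
have dw1 : d' != w1.
  apply/eqP => E; subst d'; have /eqP : a' = w4; last by evaluate_goal.
  by apply: (third_apex hT' (z := w5) (b := w1) (c := w2) (d := w3)); first [known_tet | by evaluate_goal].
have dw5 : d' != w5.
  apply/eqP => E; subst d'; have /eqP : a' = w1; last by evaluate_goal.
  by apply: (third_apex hT' (z := b') (b := w2) (c := w3) (d := w5)); first [known_tet | by evaluate_goal].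
have db : d != b.
  by apply/eqP => E; subst d; case: (no_v2ab v3); known_tet.
have dc : d != c.
  have h := maps_count mZ m4; evaluate h; move: h; by case: (d == c).
have dw : d' != b'.
  have h := maps_count mZ m5; evaluate h; move: h; by case: (d' == b').
have [_ hZ] := labels_adjacent (labels_rot (labels_rot (labels_rot hA))) mZ dv4.
case: hZ => [h|[h|[h|[h|[h|h]]]]].
(* The labels agree. Intersection numbers force [z = b], which makes [b] and [d] adjacent in the
   link of [v3]. *)
- have [z [z' [mz zv zw]]] := labels_neighbour_ex (labels_rot (labels_rot h)).
  have [tz tz'] := maps_tet mz; disequalities mz.
  have zw5 : z' != w5.
    (* A crossing in the second manifold: the path [w1 w5 a' w2] in the link of [w3] against the
       curve through [b']. *)
    by apply/eqP => E; subst z'; crossing hT' w3 w1 w2 w5 w4 b' w5 a'.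
  have zv4 : z != v4.
    apply/eqP => E; subst z; have /eqP : d = v2; last by evaluate_goal.
    by apply: (third_apex hT (z := b) (b := a) (c := v3) (d := v4)); first [known_tet | by evaluate_goal].
  have h1 := maps_count mz m5; have h2 := maps_count mz m7.
  evaluate h1; evaluate h2.
  have zb : z = b.
    by move: h1 h2; case: (z == v1); case: (z == v5); case: (z =P b); case: (z' == b') => //=.
  by subst z; crossing hT v3 v1 v2 v4 v5 a b d.
- by case: (@transposition v2 v3 a v4 d w2 w3 a' w4 d'); first [known_labels | by evaluate_goal].
- by case: (@transposition a v2 v3 v4 d a' w2 w3 w4 d'); first [known_labels | by evaluate_goal].
- by case: (@transposition a v3 v2 v4 d a' w3 w2 w4 d'); first [known_labels | by evaluate_goal].
(* This 3-cycle starts a twisted configuration in which [v1] lies in a tetrahedron with [v2] and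
   [a]. *)
- have [||||a2 [b2 [c2 [a2' [b2' [c2' tw2]]]]]] := @cycle_twisted a v3 v2 v4 d a' w3 w2 w4 d';
    try first [known_labels | by evaluate_goal].
  case: tw2 => [_ [n1 n2 n3] [n4 n5 n6] r _]; split_uniq r.
  have [t9 _] := maps_tet n1; have [t10 _] := maps_tet n5.
  have E : a2 = v1 by apply: (third_apex hT (z := a) (b := v2) (c := v3) (d := v4)); first [known_tet | by evaluate_goal].
  by subst a2; case: (no_v1v2a d); known_tet.
(* For the inverse 3-cycle the intersection numbers force [z = v1], and the path [v1 d v2] in the
   link of [v3] crosses the curve through [a]. *)
- have [z [z' [mz zv zw]]] := labels_neighbour_ex (labels_rot (labels_rot h)).
  have [tz tz'] := maps_tet mz; disequalities mz.
  have zw4 : z' != w4.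
    apply/eqP => E; subst z'; have /eqP : d' = w1; last by evaluate_goal.
    by apply: (third_apex hT' (z := a') (b := w2) (c := w3) (d := w4)); first [known_tet | by evaluate_goal].
  have zv5 : z != v5.
    apply/eqP => E; subst z; have /eqP : d = v1; last by evaluate_goal.
    by apply: (third_apex hT (z := c) (b := a) (c := v3) (d := v5)); first [known_tet | by evaluate_goal].
  have h1 := maps_count mz m5; have h2 := maps_count mz m7.
  evaluate h1; evaluate h2.
  have zb : z = v1.
    by move: h1 h2; case: (z =P v1); case: (z == v4); case: (z == b); case: (z' == b'); case: (z' == w5) => //=.
  by subst z; crossing hT v3 v1 v2 v4 v5 a d d.
Qed.

(** Only the identity survives in [labels_adjacent]; exchanging the names of two common vertices
    turns one 3-cycle into its inverse. *)
Lemma corresponds_adjacent X Y v v' : X \in T -> Y \in T -> #|X :&: Y| = 3 -> v \in Y ->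
  corresponds X v v' -> corresponds Y v v'.
Proof.
move=> XT YT cI vY hv; have [vX _ _] := hv.
have vI : v \in enum (X :&: Y) by rewrite mem_enum inE vX vY.
have uI := enum_uniq (X :&: Y); have EI := set_enum (X :&: Y).
move: cI; rewrite cardE => cI.
case: (enum (X :&: Y)) cI vI uI EI => [|v1 [|v2 [|v3 [|]]]] // _ vI uI EI.
have [|a EX] := apex hT XT uI; first by rewrite EI subsetIl.
have [|e EY] := apex hT YT uI; first by rewrite EI subsetIr.
subst X Y; have ea : e != a.
  apply/eqP => E; subst e.
  have : #|[set x in [:: v1; v2; v3]]| = 4 by rewrite EI setIid (tet_card hT XT).
  by rewrite cardsE (card_uniqP uI).
have [a' [w1 [w2 [w3 hX]]]] := labels_ex XT.
have [e' [mY _]] := labels_neighbour hX ea YT.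
have [ea' hY] := labels_adjacent hX mY ea.
have {}hY : labels e v1 v2 v3 e' w1 w2 w3.
  case: hY => [//|[h|[h|[h|[h|h]]]]]; exfalso.
  - by apply: (@transposition v2 v3 v1 a e w2 w3 w1 a' e'); first [known_labels | rewrite eq_sym].
  - by apply: (@transposition v1 v2 v3 a e w1 w2 w3 a' e'); first [known_labels | rewrite eq_sym].
  - by apply: (@transposition v1 v3 v2 a e w1 w3 w2 a' e'); first [known_labels | rewrite eq_sym].
  - by apply: (@cycle_impossible v2 v1 v3 a e w2 w1 w3 a' e'); first [known_labels | rewrite eq_sym].
  - by apply: (@cycle_impossible v1 v2 v3 a e w1 w2 w3 a' e'); first [known_labels | rewrite eq_sym].
case: hX => _ [_ x1 x2 x3]; case: hY => _ [_ y1 y2 y3].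
move: vI hv; rewrite !inE => /or3P[]/eqP -> hv.
- by rewrite (corresponds_fun XT hv x1).
- by rewrite (corresponds_fun XT hv x2).
- by rewrite (corresponds_fun XT hv x3).
Qed.

Lemma vertex_map : exists phi : V -> V', bijective phi /\ forall X, X \in T -> phi @: X = f X.
Proof.
have ex v : exists v', forall X, X \in T -> v \in X -> corresponds X v v'.
  have [X XT vX] := tet_cover hT v; have [v' hv] := corresponds_ex XT vX.
  exists v' => Y YT vY.
  apply: (tet_connected hT (P := fun Z => corresponds Z v v') _ XT vX hv YT vY) => Z Z' ZT Z'T _ vZ' cI.
  exact: corresponds_adjacent.
have [phi Hphi] := fin_all_exists ex.
have phiE X : X \in T -> phi @: X = f X.
  move=> XT; apply/eqP; rewrite eqEcard; apply/andP; split.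
    by apply/subsetP => _ /imsetP[v vX ->]; have [] := Hphi v X XT vX.
  rewrite (tet_card hT' (f_in XT)) card_in_imset ?(tet_card hT XT) // => u v uX vX E.
  by apply: (corresponds_inj XT (Hphi u X XT uX)); rewrite E; exact: Hphi.
exists phi; split=> //.
have inj : injective phi.
  move=> u v E; have [X XT uX] := tet_cover hT u; have [Y YT vY] := tet_cover hT v.
  have [_ wX _] := Hphi u X XT uX; have [_ wY _] := Hphi v Y YT vY; rewrite -E in wY.
  (* Injectivity uses strong connectedness of the link of [phi u] in the second manifold. If passing
     to an adjacent image tetrahedron lost [u], the common facet would be the one opposite [phi u],
     although both images contain [phi u]. *)
  have [Z [ZT uZ /(f_inj ZT YT) EZ]] : exists Z, [/\ Z \in T, u \in Z & f Z = f Y].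
    apply: (tet_connected hT' (v := phi u) (P := fun Z' => exists Z, [/\ Z \in T, u \in Z & f Z = Z'])
      _ (f_in XT) wX _ (f_in YT) wY); last by exists X.
    move=> Z1' Z2' _ + _ wZ2 cI [Z1 [Z1T uZ1 E1]]; rewrite -{1}f_im => /imsetP[Z2 Z2T E2].
    subst Z1' Z2'; rewrite -f_card // in cI; exists Z2; split=> //; apply: contraT => uZ2.
    have sZ : Z1 :\ u \subset Z2.
      have /eqP <- : Z1 :&: Z2 == Z1 :\ u; last exact: subsetIr.
      rewrite eqEcard cI (facet_card hT Z1T uZ1) leqnn andbT.
      apply/subsetP => x; rewrite !inE => /andP[-> xZ2]; rewrite andbT.
      by apply: contraNneq uZ2 => <-.
    have Z21 : Z2 != Z1 by apply: contraNneq uZ2 => ->.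
    have [_ _ /(_ _ Z2T Z21 sZ) sf] := Hphi u Z1 Z1T uZ1.
    have : f Z1 \subset f Z2.
      apply/subsetP => x xZ1; have [->//|xw] := eqVneq x (phi u).
      by have /subsetP := sf; apply; rewrite !inE xw.
    rewrite f_card // in cI; move/setIidPl => E1.
    by move: cI; rewrite E1 (tet_card hT' (f_in Z1T)).
  subst Z; apply: (corresponds_inj YT (Hphi u Y YT uZ)); rewrite E; exact: Hphi.
apply: inj_card_bij => //; rewrite -cardsT; apply: leq_trans (leq_imset_card phi V).
apply: subset_leq_card; apply/subsetP => w _.
have [X' + wX'] := tet_cover hT' w; rewrite -f_im => /imsetP[X XT EX].
by move: wX'; rewrite EX -phiE // => /imsetP[v _ ->]; apply: imset_f.
Qed.
End Correspondence.

Theorem theorem1p6 (R : realType) (V V' : finType)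
    (D : {set {set V}}) (D' : {set {set V'}}) (f : {set V} -> {set V'}) :
  manifold_triangulation R D ->
  manifold_triangulation R D' ->
  intersection_preserving D D' f ->
  exists phi : V -> V',
    isomorphism D D' phi /\
    forall X : {set V}, X \in simplices 3 D -> phi @: X = f X.
Proof.
move=> mD mD' [f_inj f_im f_card].
have hT := manifold_tetrahedra mD; have hT' := manifold_tetrahedra mD'.
have [phi [phi_bij phiE]] := vertex_map hT hT' f_inj f_im f_card.
have [[sD _ _ _] [sD' _ _ _]] := (mD, mD').
exists phi; split=> //; split=> // X; apply/idP/idP => XD.
  have [Y YT XY] := low_simplex_in_tetrahedron sD mD XD.
  apply: (sD' _ _ _ (imsetS phi XY)); rewrite phiE //.
  have : f Y \in simplices 3 D' by rewrite -f_im imset_f.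
  by rewrite inE => /andP[].
have [Y' + XY] := low_simplex_in_tetrahedron sD' mD' XD.
rewrite -f_im => /imsetP[Y YT EY]; rewrite EY -phiE // in XY.
have YD : Y \in D by move: YT; rewrite inE => /andP[].
apply: sD YD _; apply/subsetP => x xX.
have /subsetP/(_ (phi x)) := XY; rewrite imset_f // => /(_ isT).
by rewrite mem_imset //; exact: bij_inj.
Qed.
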